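(* Let $\mathcal M$ be a non-linear semi-bounded o-minimal expansion of an ordered group, with a constant symbol $1$ naming a positive element such that the induced structure on $R=(0,1)$ expands a real closed field whose order agrees with $<$. Let $A\subseteq M$ and $p(x),q(y)\in S(A)$. If $p$ is short and $q$ is $\mathrm{scl}$-independent, then $p$ and $q$ are weakly orthogonal.
   Context: Let $\mathcal M=\langle M,<,+,0,\dots\rangle$ be an o-minimal expansion of an ordered group; ''definable'' means definable in $\mathcal M$ with parameters. $\Lambda$ is the set of $\emptyset$-definable partial endomorphisms of $\langle M,<,+,0\rangle$ (maps $\lambda$ from $M$ or a symmetric interval $(-a,a)$ to $M$ with $\lambda(x+y)=\lambda(x)+\lambda(y)$ whenever $x,y,x+y$ are in the domain), and $\mathcal B$ the collection of all bounded definable sets. $\mathcal M$ is linear if every definable set is definable in $\langle M,<,+,0,\{\lambda\}_{\lambda\in\Lambda}\rangle$, and semi-bounded if every definable set is definable in $\langle M,<,+,0,\{\lambda\}_{\lambda\in\Lambda},\{B\}_{B\in\mathcal B}\rangle$. The induced structure on $R$ has universe $R$ and a relation for the trace on powers of $R$ of each $\emptyset$-definable set. An interval $I$ is short if there is a definable bijection between $I$ and $R$. For $A\subseteq M$, $\mathrm{scl}(A)$ is the set of elements contained in some $A$-definable short interval; equivalently $\mathrm{scl}(A)=\mathrm{dcl}(AR)$. It is a pregeometry; $\mathrm{rk}_{\mathrm{scl}}(b/A)$ denotes the corresponding dimension of a tuple $b$ over $A$. For $p(x)\in S(A)$ (complete type over $A$ in finitely many variables) and $b\models p$ (in an elementary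 extension if necessary, with $\mathrm{scl}$ computed there), put $\mathrm{rk}_{\mathrm{scl}}(p):=\mathrm{rk}_{\mathrm{scl}}(b/A)$. $p$ is short if $\mathrm{rk}_{\mathrm{scl}}(p)=0$, and $\mathrm{scl}$-independent if $\mathrm{rk}_{\mathrm{scl}}(p)=|x|$. Types $p(x),q(y)\in S(A)$ are weakly orthogonal if $p(x)\cup q(y)$ implies a complete type over $A$ in variables $(x,y)$. *)

(* Defs.v *)
(* First-order structures in MathComp style, with sets from mathcomp-classical.
   A tuple of length n over T is a function 'I_n -> T. *)
From mathcomp Require Import all_boot all_order all_algebra.
From mathcomp Require Import all_classical.

Set Implicit Arguments.
Unset Strict Implicit.
Unset Printing Implicit Defensive.

Local Open Scope classical_set_scope.

Record signature := Signature {
  csym : Type;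
  fsym : Type;
  far : fsym -> nat;
  rsym : Type;
  rar : rsym -> nat }.

Record structure (L : signature) := Structure {
  carrier :> Type;
  cint : csym L -> carrier;
  fint : forall f : fsym L, ('I_(far f) -> carrier) -> carrier;
  rint : forall r : rsym L, ('I_(rar r) -> carrier) -> Prop }.

Inductive term (L : signature) (n : nat) : Type :=
| Var of 'I_n
| Cst of csym L
| App (f : fsym L) of ('I_(far f) -> term L n).

(* Formulas whose free variables are indexed by 'I_n.  [All] binds variable 0
   of its body and shifts the other variables by one. *)
Inductive formula (L : signature) : nat -> Type :=
| Bot n : formula L n
| Eq n : term L n -> term L n -> formula L n
| Rel n (r : rsym L) : ('I_(rar r) -> term L n) -> formula L n
| Imp n : formula L n -> formula L n -> formula L n
| All n : formula L n.+1 -> formula L n.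

Definition Not (L : signature) (n : nat) (phi : formula L n) : formula L n :=
  Imp phi (Bot L n).

Definition tcons (T : Type) (n : nat) (x : T) (v : 'I_n -> T) : 'I_n.+1 -> T :=
  fun i => oapp v x (unlift ord0 i).

Definition tcat (T : Type) (m n : nat) (v : 'I_m -> T) (w : 'I_n -> T) :
    'I_(m + n) -> T :=
  fun i => match fintype.split i with inl j => v j | inr k => w k end.

Fixpoint eval (L : signature) (M : structure L) (n : nat) (v : 'I_n -> M)
    (t : term L n) : M :=
  match t with
  | Var i => v i
  | Cst c => cint M c
  | App f ts => fint (fun i => eval v (ts i))
  end.

Fixpoint sat (L : signature) (M : structure L) (n : nat) (phi : formula L n) :
    ('I_n -> M) -> Prop :=
  match phi in formula _ k return ('I_k -> M) -> Prop with
  | Bot _ => fun _ => False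
  | Eq _ t u => fun v => eval v t = eval v u
  | Rel _ r ts => fun v => rint (fun i => eval v (ts i))
  | Imp _ phi1 phi2 => fun v => sat phi1 v -> sat phi2 v
  | All _ phi1 => fun v => forall x : M, sat phi1 (tcons x v)
  end.

(* The language L(C): new constant symbols indexed by C, interpreted by c. *)
Definition add_consts_sig (L : signature) (C : Type) : signature :=
  @Signature (csym L + C)%type (fsym L) (@far L) (rsym L) (@rar L).

Definition add_consts (L : signature) (M : structure L) (C : Type)
    (c : C -> M) : structure (add_consts_sig L C) :=
  @Structure (add_consts_sig L C) M
    (fun s => match s with inl s => cint M s | inr a => c a end)
    (@fint L M) (@rint L M).

Definition param_formula (L : signature) (M : structure L) (A : set M) (n : nat)
  : Type := formula (add_consts_sig L {a : M | A a}) n.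

Definition definable_over (L : signature) (M : structure L) (A : set M)
    (n : nat) (S : set ('I_n -> M)) : Prop :=
  exists phi : param_formula A n,
    forall v, S v <-> @sat _ (add_consts (@sval M A)) n phi v.

Definition definable (L : signature) (M : structure L) (n : nat)
    (S : set ('I_n -> M)) : Prop := definable_over [set: M] S.

Definition definable_over1 (L : signature) (M : structure L) (A : set M)
    (S : set M) : Prop :=
  definable_over A [set v : 'I_1 -> M | S (v ord0)].

(* Expansion of M by a relation symbol for every member of F. *)
Definition family (T : Type) : Type := forall n : nat, set (set ('I_n -> T)).

Definition add_rels_sig (L : signature) (T : Type) (F : family T) : signature :=
  @Signature (csym L) (fsym L) (@far L)
    (rsym L + {n : nat & {S : set ('I_n -> T) | F n S}})%type
    (fun r => match r with inl r => rar r | inr s => projT1 s end).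

Definition add_rels (L : signature) (M : structure L) (F : family M) :
    structure (add_rels_sig L F) :=
  @Structure (add_rels_sig L F) M (@cint L M) (@fint L M)
    (fun r => match r return ('I_(@rar (add_rels_sig L F) r) -> M) -> Prop with
              | inl r => @rint L M r
              | inr s => fun v => sval (projT2 s) v
              end).

Definition empty_sig : signature :=
  @Signature void void (of_void nat) void (of_void nat).

Definition pure_set (T : Type) : structure empty_sig :=
  @Structure empty_sig T (of_void T)
    (fun f : void => match f with end) (fun r : void => match r with end).

(* The induced structure on X: a relation for the trace on X^n of each
   0-definable subset of M^n, for every n. *)
Definition traces (L : signature) (M : structure L) (X : set M) :
    family {x : M | X x} :=
  fun n S => exists2 D : set ('I_n -> M), definable_over set0 D &
    S = [set v | D (fun i => sval (v i))].

Definition induced (L : signature) (M : structure L) (X : set M) :=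
  @add_rels empty_sig (pure_set {x : M | X x}) (@traces L M X).

(* The language {<, +, 0} and its expansions. *)
Definition og_sig : signature :=
  @Signature unit unit (fun _ => 2) unit (fun _ => 2).

Definition og_expansion (L : signature) : signature :=
  @Signature (unit + csym L)%type
    (unit + fsym L)%type
    (fun f => match f with inl _ => 2 | inr f => far f end)
    (unit + rsym L)%type
    (fun r => match r with inl _ => 2 | inr r => rar r end).

Section OrderedGroupExpansions.
Variables (L : signature) (M : structure (og_expansion L)).

Definition og_zero : M := cint M (inl tt).
Definition og_add (x y : M) : M :=
  @fint _ M (inl tt) (tnth [tuple x; y]).
Definition og_lt (x y : M) : Prop :=
  @rint _ M (inl tt) (tnth [tuple x; y]).

Definition og_reduct : structure og_sig :=
  @Structure og_sig M (fun _ => og_zero)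
    (fun _ => @fint _ M (inl tt)) (fun _ => @rint _ M (inl tt)).

Record ordered_group : Prop := OrderedGroup {
  og_addA : forall x y z, og_add x (og_add y z) = og_add (og_add x y) z;
  og_add0l : forall x, og_add og_zero x = x;
  og_addNl : forall x, exists y, og_add y x = og_zero;
  og_lt_irr : forall x, ~ og_lt x x;
  og_lt_trans : forall x y z, og_lt x y -> og_lt y z -> og_lt x z;
  og_lt_total : forall x y, [\/ og_lt x y, x = y | og_lt y x];
  og_lt_add2l : forall x y z, og_lt x y -> og_lt (og_add z x) (og_add z y);
  og_lt_add2r : forall x y z, og_lt x y -> og_lt (og_add x z) (og_add y z) }.

(* Open intervals with endpoints in M or infinite: [None] stands for -oo as a
   left endpoint and for +oo as a right endpoint. *)
Definition og_itv (a b : option M) : set M :=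
  [set x | (if a is Some a' then og_lt a' x else True) /\
           (if b is Some b' then og_lt x b' else True)].

Definition is_interval (S : set M) : Prop := exists a b, S = og_itv a b.

Definition o_minimal : Prop :=
  forall S : set M, definable_over1 [set: M] S ->
    exists (k : nat) (F : 'I_k -> set M),
      (forall i, (exists a, F i = [set a]) \/ is_interval (F i)) /\
      S = \bigcup_i F i.

(* Graphs of the 0-definable partial endomorphisms; in the second case the
   domain is the symmetric interval (-a, a), with b = -a. *)
Definition partial_endo : family M :=
  fun n => match n return set (set ('I_n -> M)) with
  | 2 => fun S => definable_over set0 S /\
      exists (D : set M) (f : M -> M),
        [/\ D = [set: M] \/
              (exists a b, [/\ og_lt og_zero a, og_add b a = og_zero
                 & D = og_itv (Some b) (Some a)]),
            forall x y, D x -> D y -> D (og_add x y) ->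
              f (og_add x y) = og_add (f x) (f y)
          & S = [set v | D (v ord0) /\ v ord_max = f (v ord0)]]
  | _ => set0
  end.
Arguments partial_endo : clear implicits.

Definition bounded_definable : family M :=
  fun n S => definable S /\
    exists a b : M, forall v, S v -> forall i, og_itv (Some a) (Some b) (v i).
Arguments bounded_definable : clear implicits.

Definition linear_structure : Prop :=
  forall (n : nat) (S : set ('I_n -> M)), definable S ->
    @definable _ (@add_rels og_sig og_reduct partial_endo) n S.

Definition semi_bounded : Prop :=
  forall (n : nat) (S : set ('I_n -> M)), definable S ->
    @definable _
      (@add_rels og_sig og_reduct
         (fun k => partial_endo k `|` bounded_definable k)) n S.

End OrderedGroupExpansions.

Section Short.
Variables (L : signature) (one : csym L) (M : structure (og_expansion L)).

Definition og_one : M := cint M (inr one).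

Definition unit_itv : set M := og_itv (Some (og_zero M)) (Some og_one).

(* The induced structure on (0,1) expands a real closed field, whose field
   operations and order are transported from K along the bijection f. *)
Definition unit_itv_expands_rcf : Prop :=
  exists (K : rcfType) (f : K -> induced unit_itv),
    [/\ bijective f,
        forall x y : K, (x < y)%R <-> og_lt (sval (f x)) (sval (f y)),
        definable_over set0
          [set v | exists x y : K, v = tnth [tuple f x; f y; f (x + y)%R]]
      & definable_over set0
          [set v | exists x y : K, v = tnth [tuple f x; f y; f (x * y)%R]]].

Definition short_interval (S : set M) : Prop :=
  is_interval S /\
  exists f : M -> M, set_bij S unit_itv f /\
    definable [set v : 'I_2 -> M | S (v ord0) /\ v ord_max = f (v ord0)].

Definition scl (A : set M) : set M :=
  [set b | exists S, [/\ definable_over1 A S, short_interval S & S b]].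

(* rk_scl(b/A) = k, witnessed by a basis of the tuple b over A. *)
Definition scl_rank (A : set M) (n : nat) (b : 'I_n -> M) (k : nat) : Prop :=
  exists s : {set 'I_n},
    [/\ #|s| = k,
        forall i, i \in s ->
          ~ scl (A `|` [set b j | j in [set j | j \in s /\ j <> i]]) (b i)
      & forall i, scl (A `|` [set b j | j in [set j | j \in s]]) (b i)].

End Short.

Definition elementary (L : signature) (M N : structure L) (e : M -> N) : Prop :=
  forall (n : nat) (phi : formula L n) (v : 'I_n -> M),
    sat phi v <-> sat phi (fun i => e (v i)).

Section Types.
Variables (L : signature) (M : structure L) (A : set M).

(* S_n(A): complete, and finitely satisfiable in M. *)
Definition complete_type (n : nat) (p : set (param_formula A n)) : Prop :=
  (forall (k : nat) (phi : 'I_k -> param_formula A n), (forall i, p (phi i)) ->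
     exists v : 'I_n -> M,
       forall i, @sat _ (add_consts (@sval M A)) n (phi i) v) /\
  (forall phi : param_formula A n, p phi \/ p (Not phi)).

Definition realizes (N : structure L) (e : M -> N) (n : nat) (b : 'I_n -> N)
    (p : set (param_formula A n)) : Prop :=
  forall phi, p phi ->
    @sat _ (add_consts (fun a : {a : M | A a} => e (sval a))) n phi b.

(* p(x) and q(y) together imply a complete type r(x,y) over A; implication is
   tested in the elementary extensions of M. *)
Definition weakly_orthogonal (m n : nat) (p : set (param_formula A m))
    (q : set (param_formula A n)) : Prop :=
  exists2 r : set (param_formula A (m + n)), complete_type r &
    forall (N : structure L) (e : M -> N), elementary e ->
    forall (b : 'I_m -> N) (c : 'I_n -> N),
      realizes e b p -> realizes e c q -> realizes e (tcat b c) r.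

End Types.

Section ShortTypes.
Variables (L : signature) (one : csym L) (M : structure (og_expansion L)).
Variable A : set M.

(* rk_scl(p) = k; it does not depend on the chosen realization of p. *)
Definition scl_rank_type (n : nat) (p : set (param_formula A n)) (k : nat) :
    Prop :=
  exists (N : structure (og_expansion L)) (e : M -> N) (b : 'I_n -> N),
    [/\ elementary e, realizes e b p & scl_rank one (e @` A) b k].

Definition short_type (n : nat) (p : set (param_formula A n)) : Prop :=
  scl_rank_type p 0.

Definition scl_independent_type (n : nat) (p : set (param_formula A n)) : Prop :=
  scl_rank_type p n.

End ShortTypes.

(* Main.v *)
(* Let c = (c_1, ..., c_n) realize q.  A realization of p lies in a product B of
   A-definable sets that embed definably in R = (0,1).  For a formula
   phi(x, y', t), let J(y') be the set of points at which phi(x, y', -) changes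
   truth value for some x in B.  An interval contained in J(y') maps definably,
   with finite fibres, to a power of R, so it is short.  Since c_k is in no short
   interval definable over A c_1 ... c_(k-1), it lies in one of the finitely many
   intervals cut out by J(c_1, ..., c_(k-1)) and disjoint from it, and that
   interval is definable over A c_1 ... c_(k-1).  On it phi(x, c', -) is constant
   for every x in B, so c_k can be eliminated from phi.  By induction on n, every
   phi(x, y) over A is decided by a formula of p and a formula of q.
   That the pieces are finite in number also in the elementary extension
   containing c is uniform finiteness, a consequence of the monotonicity
   theorem. *)
Require Import Defs.
From mathcomp Require Import all_boot all_order all_algebra.
From mathcomp Require Import all_classical.
From mathcomp Require Import zify ring lra.
From Stdlib Require List.

Set Implicit Arguments.
Unset Strict Implicit.
Unset Printing Implicit Defensive.

Local Open Scope classical_set_scope.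

(** * Formulas *)

(** The realization of [q] that witnesses independence lives in an elementary extension N. The
    interval argument takes place there, but its outcome must be formulas over A; hence [tdef],
    which keeps one formula together with its readings in two structures. O-minimality of N is not
    given: finiteness of a boundary is not first order, a bound n on its size is, and uniform
    finiteness supplies one n for a whole definable family ([tame_extend]). Uniform finiteness rests
    on definable choice, which needs definable points inside intervals. These come from the field:
    for 0 < d < 1 the interval (0,d) is a half-line {x < k} of the field, and a piecewise rational
    map takes it bijectively onto the whole field. This family of charts, uniform in d, also makes
    every interval of length at most 1 short. For this reason c_k cannot be an end point of a piece
    either: such a point e is definable over A c_1 ... c_(k-1), and so is the short interval (e-1,
    e+1) around it. *)

Definition scons (T : Type) (x : T) (v : nat -> T) : nat -> T :=
  fun k => if k is k'.+1 then v k' else x.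

Definition ncat (T : Type) (n : nat) (u v : nat -> T) : nat -> T :=
  fun k => if k < n then u k else v (k - n).

Lemma rint_ext (L : signature) (M : structure L) (r : rsym L)
    (f g : 'I_(rar r) -> M) : f =1 g -> rint f <-> rint g.
Proof. by move=> /funext ->. Qed.

Lemma of_voidE (T : Type) (f : void -> T) : f = of_void T.
Proof. by apply: funext => -[]. Qed.

Section Syntax.
Variable L : signature.

(** Variables are natural numbers and assignments are total functions, so neither terms nor formulas
    carry an arity and renaming needs no casts. Parameters have a constructor of their own, which
    makes a change of parameters a special case of substitution. *)
Inductive tm (C : Type) : Type :=
| TV of nat
| TP of C
| TK of csym L
| TF (f : Defs.fsym L) of ('I_(far f) -> tm C).

Inductive fm (C : Type) : Type :=
| FB
| FE of tm C & tm C
| FR (r : rsym L) of ('I_(rar r) -> tm C)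
| FI of fm C & fm C
| FA of fm C.

Arguments TV {C}. Arguments TK {C}. Arguments FB {C}.

Section Semantics.
Variables (S : structure L) (C : Type) (i : C -> S).

Fixpoint teval (v : nat -> S) (t : tm C) : S :=
  match t with
  | TV k => v k
  | TP a => i a
  | TK c => cint S c
  | TF f ts => @fint L S f (fun j => teval v (ts j))
  end.

Fixpoint fsat (phi : fm C) (v : nat -> S) : Prop :=
  match phi with
  | FB => False
  | FE t u => teval v t = teval v u
  | FR r ts => @rint L S r (fun j => teval v (ts j))
  | FI a b => fsat a v -> fsat b v
  | FA a => forall x, fsat a (scons x v)
  end.
End Semantics.

Section Substitution.
Variables (C C' : Type).

Fixpoint tsub (s : nat -> tm C') (p : C -> tm C') (t : tm C) : tm C' :=
  match t with
  | TV k => s k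
  | TP a => p a
  | TK c => TK c
  | TF f ts => TF (fun j => tsub s p (ts j))
  end.
End Substitution.

Definition tlift (C : Type) : tm C -> tm C :=
  tsub (fun k => TV k.+1) (@TP C).

Fixpoint fsub (C C' : Type) (s : nat -> tm C') (p : C -> tm C') (phi : fm C) :
    fm C' :=
  match phi with
  | FB => FB
  | FE t u => FE (tsub s p t) (tsub s p u)
  | FR r ts => FR (fun j => tsub s p (ts j))
  | FI a b => FI (fsub s p a) (fsub s p b)
  | FA a => FA (fsub (scons (TV 0) (fun k => tlift (s k))) (fun a => tlift (p a)) a)
  end.

Lemma teval_sub (S : structure L) (C C' : Type) (i : C' -> S) v
    (s : nat -> tm C') (p : C -> tm C') t :
  teval i v (tsub s p t) =
  teval (fun a => teval i v (p a)) (fun k => teval i v (s k)) t.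
Proof.
elim: t => //= f ts IH; congr fint; apply: funext => j; exact: IH.
Qed.

Lemma teval_lift (S : structure L) (C : Type) (i : C -> S) x v t :
  teval i (scons x v) (tlift t) = teval i v t.
Proof. by rewrite teval_sub. Qed.

Lemma fsat_sub (S : structure L) (C C' : Type) (i : C' -> S)
    (s : nat -> tm C') (p : C -> tm C') phi v :
  fsat i (fsub s p phi) v <->
  fsat (fun a => teval i v (p a)) phi (fun k => teval i v (s k)).
Proof.
elim: phi s p v => [|t u|r ts|a IHa b IHb|a IHa] s p v //=.
- by rewrite !teval_sub.
- by under [X in rint X]eq_fun do rewrite teval_sub.
- by rewrite IHa IHb.
- have E x : fsat i (fsub (scons (TV 0) (fun k => tlift (s k)))
      (fun a => tlift (p a)) a) (scons x v) <->
    fsat (fun a => teval i v (p a)) a (scons x (fun k => teval i v (s k))).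
    rewrite IHa; under eq_fun do rewrite teval_lift.
    rewrite (_ : (fun k => _) = scons x (fun k => teval i v (s k))) //.
    by apply: funext => -[|k] //=; rewrite teval_lift.
  by split=> h x; apply/E.
Qed.

(** The arguments of a symbol form a finite family, each with its own bound and list; since [Q] is
    monotone in both, the maximum of the bounds and the concatenation of the lists serve all
    arguments at once. *)
Lemma finite_support_union (C : Type) (I : finType) (Q : I -> nat -> seq C -> Prop) :
  (forall j, exists n l, Q j n l) ->
  (forall j n n' l l', Q j n l -> n <= n' -> (forall a, List.In a l -> List.In a l') ->
     Q j n' l') ->
  exists n l, forall j, Q j n l.
Proof.
move=> /choice[n] /choice[l] h mon.
exists (\max_j n j), (List.concat (map l (enum I))) => j.
apply: mon (h j) _ _; first exact: leq_bigmax.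
move=> a al; apply/List.in_concat; exists (l j); split=> //.
apply: List.in_map; have: j \in enum I by rewrite mem_enum.
by elim: (enum I) => //= k s IH; rewrite inE => /orP[/eqP->|/IH]; [left|right].
Qed.

Definition agree (C T : Type) (n : nat) (l : seq C) (i i' : C -> T)
    (v v' : nat -> T) : Prop :=
  (forall k, k < n -> v k = v' k) /\ (forall a, List.In a l -> i a = i' a).

Lemma agreeW (C T : Type) n n' (l l' : seq C) (i i' : C -> T) v v' :
  n <= n' -> (forall a, List.In a l -> List.In a l') ->
  agree n' l' i i' v v' -> agree n l i i' v v'.
Proof.
by move=> nn ll [h1 h2]; split=> [k kn|a al]; [apply: h1; lia|apply/h2/ll].
Qed.

Lemma tm_support (C : Type) (t : tm C) : exists n l,
  forall (S : structure L) (i i' : C -> S) v v',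
  agree n l i i' v v' -> teval i v t = teval i' v' t.
Proof.
elim: t => [k|a|c|f ts IH].
- by exists k.+1, [::] => S i i' v v' [h _]; apply: h.
- by exists 0, [:: a] => S i i' v v' [_ h]; apply: h; left.
- by exists 0, [::].
- have [|n [l h]] := finite_support_union IH.
    by move=> j n n' l l' h nn ll S i i' v v' /(agreeW nn ll) /h.
  exists n, l => S i i' v v' ag /=; congr fint; apply: funext => j; exact: h.
Qed.

Lemma fm_support (C : Type) (phi : fm C) : exists n l,
  forall (S : structure L) (i i' : C -> S) v v',
  agree n l i i' v v' -> (fsat i phi v <-> fsat i' phi v').
Proof.
have inl_ (l l' : seq C) a : List.In a l -> List.In a (l ++ l').
  by move=> ?; apply: List.in_or_app; left.
have inr_ (l l' : seq C) a : List.In a l' -> List.In a (l ++ l').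
  by move=> ?; apply: List.in_or_app; right.
elim: phi => [|t u|r ts|a [n [l h]] b [n' [l' h']]|a [n [l h]]].
- by exists 0, [::].
- have [n [l h]] := tm_support t; have [n' [l' h']] := tm_support u.
  exists (maxn n n'), (l ++ l') => S i i' v v' ag /=.
  by rewrite (h _ _ _ _ _ (agreeW (leq_maxl _ _) (inl_ _ _) ag))
    (h' _ _ _ _ _ (agreeW (leq_maxr _ _) (inr_ _ _) ag)).
- have [|n [l h]] := finite_support_union (fun j => tm_support (ts j)).
    by move=> j n n' l l' h nn ll S i i' v v' /(agreeW nn ll) /h.
  exists n, l => S i i' v v' ag /=.
  rewrite (_ : (fun j => teval i v _) = (fun j => teval i' v' (ts j))) //.
  by apply: funext => j; apply: h.
- exists (maxn n n'), (l ++ l') => S i i' v v' ag /=.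
  by rewrite (h _ _ _ _ _ (agreeW (leq_maxl _ _) (inl_ _ _) ag))
    (h' _ _ _ _ _ (agreeW (leq_maxr _ _) (inr_ _ _) ag)).
- exists n, l => S i i' v v' [h1 h2] /=.
  have E x : fsat i a (scons x v) <-> fsat i' a (scons x v').
    apply: h; split=> // -[|k] kn //=; apply: h1; lia.
  by split=> H x; apply/E.
Qed.

(* The parameters occurring in a formula become its first variables. *)
Lemma fm_elim (C : Type) (phi : fm C) :
  exists n (phi0 : fm void) (w : nat -> option C),
  forall (S : structure L) (i : C -> S) (i0 : void -> S) (d : S) v,
  fsat i phi v <-> fsat i0 phi0 (ncat n (fun k => oapp i d (w k)) v).
Proof.
have [n [l h]] := fm_support phi.
have /choice[j jP] : forall a, exists k, List.In a l ->
    k < size l /\ List.nth_error l k = Some a.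
  move=> a; case: (pselect (List.In a l)) => [al|]; last by exists 0.
  have [k kE] := List.In_nth_error l a al; exists k => _; split=> //.
  apply/ltP; apply/List.nth_error_Some; by rewrite kE.
exists (size l), (fsub (fun k => TV (k + size l)) (fun a => TV (j a)) phi),
  (List.nth_error l) => S i i0 d v.
rewrite fsat_sub; apply: h; split=> [k _|a /jP[jl ja]] /=.
- by rewrite /ncat ifN; [congr v; lia|lia].
- by rewrite /ncat jl ja.
Qed.

(** * Translation between formulas with and without arity *)

Section Conversion.
Variable z : csym L.

(** A variable out of range must become some term: it becomes the constant [z], and [ext] prolongs a
    tuple by the value of the same constant, so that both readings agree. *)
Fixpoint to_tm (C : Type) (n : nat) (t : tm C) : term (add_consts_sig L C) n :=
  match t with
  | TV k => if insub k is Some j then Var _ j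
            else @Cst (add_consts_sig L C) n (inl z)
  | TP a => @Cst (add_consts_sig L C) n (inr a)
  | TK c => @Cst (add_consts_sig L C) n (inl c)
  | TF f ts => @App (add_consts_sig L C) n f (fun j => to_tm n (ts j))
  end.

Fixpoint to_formula (C : Type) (n : nat) (phi : fm C) :
    formula (add_consts_sig L C) n :=
  match phi with
  | FB => Bot _ n
  | FE t u => Eq (to_tm n t) (to_tm n u)
  | FR r ts => @Rel (add_consts_sig L C) n r (fun j => to_tm n (ts j))
  | FI a b => Imp (to_formula n a) (to_formula n b)
  | FA a => All (to_formula n.+1 a)
  end.

(** The target is [L] itself and not [L] with an empty set of constants, because [elementary] speaks
    of formulas of [L]. *)
Fixpoint to_tm0 (n : nat) (t : tm void) : term L n :=
  match t with
  | TV k => if insub k is Some j then Var _ j else Cst n z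
  | TP a => match a with end
  | TK c => Cst n c
  | TF f ts => App (fun j => to_tm0 n (ts j))
  end.

Fixpoint to_formula0 (n : nat) (phi : fm void) : formula L n :=
  match phi with
  | FB => Bot _ n
  | FE t u => Eq (to_tm0 n t) (to_tm0 n u)
  | FR r ts => Rel (fun j => to_tm0 n (ts j))
  | FI a b => Imp (to_formula0 n a) (to_formula0 n b)
  | FA a => All (to_formula0 n.+1 a)
  end.

Definition ext (S : structure L) (n : nat) (v : 'I_n -> S) : nat -> S :=
  fun k => if insub k is Some j then v j else cint S z.

Lemma ext_ord (S : structure L) n (v : 'I_n -> S) (j : 'I_n) : ext v j = v j.
Proof. by rewrite /ext valK. Qed.

Lemma tcons0 (T : Type) n (x : T) (v : 'I_n -> T) : tcons x v ord0 = x.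
Proof. by rewrite /tcons unlift_none. Qed.

Lemma tconsS (T : Type) n (x : T) (v : 'I_n -> T) j :
  tcons x v (lift ord0 j) = v j.
Proof. by rewrite /tcons liftK. Qed.

Lemma ext_tcons (S : structure L) n (v : 'I_n -> S) x :
  ext (tcons x v) = scons x (ext v).
Proof.
apply: funext => -[|k] /=.
  by rewrite (_ : 0 = (@ord0 n : nat)) // ext_ord tcons0.
case: (ltnP k n) => kn.
  rewrite (_ : k.+1 = lift ord0 (Ordinal kn)) // ext_ord tconsS.
  by rewrite -[RHS]/(ext v (Ordinal kn)) ext_ord.
by rewrite /ext !insubF //; apply/negbTE; rewrite -leqNgt.
Qed.

Lemma eval_to_tm (S : structure L) (C : Type) (i : C -> S) n (v : 'I_n -> S) t :
  @eval _ (add_consts i) n v (to_tm n t) = teval i (ext v) t.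
Proof.
elim: t => [k|a|c|f ts IH] //=; first by rewrite /ext; case: insub.
by congr (@fint L S f); apply: funext => j; apply: IH.
Qed.

Lemma sat_to_formula (S : structure L) (C : Type) (i : C -> S) n (v : 'I_n -> S)
    phi :
  @sat _ (add_consts i) n (to_formula n phi) v <-> fsat i phi (ext v).
Proof.
elim: phi n v => [|t u|r ts|a IHa b IHb|a IHa] n v //=.
- by rewrite !eval_to_tm.
- by apply: (rint_ext (M := S)) => j; apply: eval_to_tm.
- by rewrite IHa IHb.
- by split=> H x; [rewrite -ext_tcons -IHa|rewrite IHa ext_tcons].
Qed.

Lemma eval_to_tm0 (S : structure L) (i : void -> S) n (v : 'I_n -> S) t :
  @eval _ S n v (to_tm0 n t) = teval i (ext v) t.
Proof.
elim: t => [k|[]|c|f ts IH] //=; first by rewrite /ext; case: insub.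
by congr (@fint L S f); apply: funext => j; apply: IH.
Qed.

Lemma sat_to_formula0 (S : structure L) (i : void -> S) n (v : 'I_n -> S) phi :
  sat (to_formula0 n phi) v <-> fsat i phi (ext v).
Proof.
elim: phi n v => [|t u|r ts|a IHa b IHb|a IHa] n v //=.
- by rewrite !(eval_to_tm0 i).
- by apply: (rint_ext (M := S)) => j; apply: eval_to_tm0.
- by rewrite IHa IHb.
- by split=> H x; [rewrite -ext_tcons -IHa|rewrite IHa ext_tcons].
Qed.

(** [elementary] concerns formulas without parameters on finite tuples. Parameters are therefore
    turned into variables by [fm_elim], and the assignment is cut down to the support of the
    formula. *)
Lemma fsat_elementary (M N : structure L) (e : M -> N) (C : Type) (i : C -> M)
    (i' : C -> N) (phi : fm C) v :
  elementary e -> (forall a, i' a = e (i a)) ->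
  fsat i phi v <-> fsat i' phi (fun k => e (v k)).
Proof.
move=> ee ii'; have [n [phi0 [w h]]] := fm_elim phi.
rewrite (h _ _ (of_void M) (cint M z)) (h _ _ (of_void N) (e (cint M z))).
set u := ncat n _ v; set u' := ncat n _ _.
have -> : u' = fun k => e (u k).
  by apply: funext => k; rewrite /u' /u /ncat; case: ifP => // _;
    case: (w k) => //=.
have [m [l s]] := fm_support phi0.
have ag (S : structure L) (f : nat -> S) (i0 : void -> S) : agree m l i0 i0 f (ext (fun j : 'I_m => f j)).
  split=> // k km; by rewrite (_ : k = Ordinal km :> nat) // ext_ord.
rewrite (s _ _ _ _ _ (ag _ u _)) (s _ _ _ _ _ (ag _ (fun k => e (u k)) _)).
by rewrite -!sat_to_formula0 ee.
Qed.
End Conversion.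

Fixpoint of_term (C : Type) (n : nat) (t : term (add_consts_sig L C) n) : tm C :=
  match t with
  | Var j => TV j
  | Cst (inl c) => TK c
  | Cst (inr a) => TP a
  | App f ts => @TF C f (fun j => of_term (ts j))
  end.

Fixpoint of_formula (C : Type) (n : nat) (phi : formula (add_consts_sig L C) n) :
    fm C :=
  match phi with
  | Bot _ => FB
  | Eq _ t u => FE (of_term t) (of_term u)
  | Rel _ r ts => @FR C r (fun j => of_term (ts j))
  | Imp _ a b => FI (of_formula a) (of_formula b)
  | All _ a => FA (of_formula a)
  end.

Lemma teval_of_term (S : structure L) (C : Type) (i : C -> S) n
    (t : term (add_consts_sig L C) n) v :
  teval i v (of_term t) = @eval _ (add_consts i) n (fun j => v j) t.
Proof.
elim: t => [j|[c|a]|f ts IH] //=.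
by congr (@fint L S f); apply: funext => j; apply: IH.
Qed.

Lemma fsat_of_formula (S : structure L) (C : Type) (i : C -> S) n
    (phi : formula (add_consts_sig L C) n) v :
  fsat i (of_formula phi) v <-> @sat _ (add_consts i) n phi (fun j => v j).
Proof.
elim: phi v => {n} [n|n t u|n r ts|n a IHa b IHb|n a IHa] v //=.
- by rewrite !teval_of_term.
- by apply: (rint_ext (M := S)) => j; apply: teval_of_term.
- by rewrite IHa IHb.
- have E x : tcons x (fun j : 'I_n => v j) = (fun j : 'I_n.+1 => scons x v j).
    apply: funext => j; case: (unliftP ord0 j) => [j' ->|->].
      by rewrite tconsS.
    by rewrite tcons0.
  by split=> H x; move: (H x); rewrite IHa E.
Qed.
End Syntax.

(** * Finite sets and linear orders *)

Section Finiteness.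
Variable T : Type.
Implicit Types (A B : T -> Prop).

(* A has at most n elements, in a form that is first order for each n. *)
Fixpoint atm (n : nat) A : Prop :=
  if n is n'.+1 then forall z, A z -> atm n' (fun t => A t /\ t <> z)
  else forall t, ~ A t.

Lemma atm_sub n A B : (forall t, B t -> A t) -> atm n A -> atm n B.
Proof.
elim: n A B => [|n IH] A B /= BA h; first by move=> t /BA /h.
by move=> z /BA /h; apply: IH => t [/BA].
Qed.

Lemma atm0 n A : (forall t, ~ A t) -> atm n A.
Proof. by case: n => [|n] h //= z /h. Qed.

Lemma atmW n m A : n <= m -> atm n A -> atm m A.
Proof.
elim: n m A => [|n IH] [|m] A //= nm h; first by move=> z /h.
by move=> z /h; apply: IH.
Qed.

(** The definition of [atm] asks for the removal of every point; removing a single one, in [A] or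
    not, is enough. *)
Lemma atm_add n A z : atm n (fun t => A t /\ t <> z) -> atm n.+1 A.
Proof.
elim: n A z => [|n IH] A z h w Aw.
  move=> t [At tw]; have wz : w = z by apply: contrapT => ne; case: (h w).
  by apply: (h t); rewrite -wz.
case: (pselect (w = z)) => [->|wz] //.
by apply: (IH _ z); apply: atm_sub (h w _) => // t [[? ?] ?].
Qed.

Lemma atm_union n m A B : atm n A -> atm m B -> atm (n + m) (fun t => A t \/ B t).
Proof.
elim: n A => [|n IH] A hA hB.
  by apply: atm_sub hB => t [/hA|].
case: (pselect (exists z, A z)) => [[z Az]|nA]; last first.
  apply: atmW (atm_sub _ hB); first exact: leq_addl.
  by move=> t [At|] //; case: nA; exists t.
apply: (atm_add (z := z)); apply: atm_sub (IH _ (hA z Az) hB).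
by move=> t [[] ? ?]; [left|right].
Qed.

Definition fin A : Prop := exists n, atm n A.

Lemma fin_sub A B : (forall t, B t -> A t) -> fin A -> fin B.
Proof. by move=> BA [n /(atm_sub BA)]; exists n. Qed.

Lemma fin_union A B : fin A -> fin B -> fin (fun t => A t \/ B t).
Proof. by move=> [n hA] [m hB]; exists (n + m); apply: atm_union. Qed.

Lemma fin_eq a : fin (fun t => t = a).
Proof. by exists 1 => z -> t [-> []]. Qed.
End Finiteness.

Lemma fin_cover (T I : Type) (X : I -> Prop) (F : I -> T -> Prop) :
  fin X -> (forall j, X j -> fin (F j)) -> fin (fun t => exists j, X j /\ F j t).
Proof.
move=> [n]; elim: n X => [|n IH] X hX hF; first by exists 0 => t [j [/hX]].
case: (pselect (exists j, X j)) => [[j Xj]|nX]; last first.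
  by exists 0 => t [j [Xj _]]; apply: nX; exists j.
have h1 := IH _ (hX j Xj) (fun k hk => hF k (proj1 hk)).
apply: fin_sub (fin_union (hF j Xj) h1) => t [k [Xk Fk]].
by case: (pselect (k = j)) => [<-|ne]; [left|right; exists k].
Qed.

(** [R] acts as a partial surjection from [A] onto [B]; it need be neither total nor injective for a
    bound on [A] to bound [B]. *)
Lemma atm_transport (T U : Type) (A : T -> Prop) (B : U -> Prop)
    (R : T -> U -> Prop) n :
  (forall b, B b -> exists a, A a /\ R a b) ->
  (forall a b b', A a -> B b -> B b' -> R a b -> R a b' -> b = b') ->
  atm n A -> atm n B.
Proof.
elim: n A B => [|n IH] A B sur inj /= hA.
  by move=> b /sur [a [/hA]].
move=> b Bb; have [a [Aa Rab]] := sur b Bb.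
apply: (IH (fun t => A t /\ t <> a)) (hA a Aa).
  move=> b' [Bb' b'b]; have [a' [Aa' Rab']] := sur b' Bb'.
  exists a'; split=> //; split=> // a'a; apply: b'b.
  by apply: (inj a) => //; rewrite -a'a.
by move=> c d d' [? _] [? _] [? _]; apply: inj.
Qed.

Section LinearOrders.
Variables (T : Type) (lt : T -> T -> Prop).

Record lin_order : Prop := LinOrder {
  lo_irr : forall x, ~ lt x x;
  lo_trans : forall x y z, lt x y -> lt y z -> lt x z;
  lo_total : forall x y, [\/ lt x y, x = y | lt y x] }.

(* Order facts about finitely many points are decided in nat. *)
Lemma rank_embed (s : seq T) : lin_order -> exists h : T -> nat,
  forall x y, List.In x s -> List.In y s ->
    (lt x y = (h x < h y)%coq_nat) /\ ((x = y) = (h x = h y)).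
Proof.
move=> [irr tr tot]; pose h x := count (fun y => `[< lt y x >]) s.
have hlt x y : List.In x s -> lt x y -> h x < h y.
  move=> xs xy; rewrite {}/h.
  have le s' : count (fun z => `[< lt z x >]) s' <= count (fun z => `[< lt z y >]) s'.
    elim: s' => //= z s' IH; apply: leq_add => //.
    case: asboolP => // zx; by rewrite asboolT //; apply: tr xy.
  elim: s xs => //= z s' IH [->|/IH {}IH].
    rewrite (asboolT xy) asboolF; last exact: irr.
    by rewrite add0n add1n ltnS le.
  have : nat_of_bool `[< lt z x >] <= `[< lt z y >].
    by case: asboolP => // zx; rewrite asboolT //; apply: tr xy.
  by move: IH; lia.
exists h => x y xs ys; split; apply/propext; split.
- by move=> /(hlt _ _ xs); lia.
- move=> hxy; case: (tot x y) hxy => // [->|/(hlt _ _ ys)]; lia.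
- by move=> ->.
- by case: (tot x y) => // [/(hlt _ _ xs)|/(hlt _ _ ys)]; lia.
Qed.

Lemma fin_min A : lin_order -> fin A -> (exists t, A t) ->
  exists m, A m /\ forall t, A t -> ~ lt t m.
Proof.
move=> [irr tr tot] [n]; elim: n A => [|n IH] A h [t At]; first by case: (h t).
case: (pselect (exists u, A u /\ u <> t)) => [ne|nA]; last first.
  exists t; split=> // u Au ut; apply: nA; exists u; split=> // ut'.
  by apply: (irr t); rewrite -{1}ut'.
have [m [[Am mt] hm]] := IH _ (h t At) ne.
case: (tot m t) => // [lmt|ltm].
- exists m; split=> // u Au um; apply: (hm u) => //; split=> // ut.
  by apply: (irr t); apply: tr lmt; rewrite -ut.
- exists t; split=> // u Au ut; apply: (hm u); last by apply: tr ltm.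
  by split=> // e; apply: (irr t); rewrite -{1}e.
Qed.
End LinearOrders.

Ltac qfree lt T :=
  lazymatch T with
  | lt _ _ => idtac
  | _ = _ => idtac
  | True => idtac
  | False => idtac
  | ~ ?A => qfree lt A
  | ?A /\ ?B => qfree lt A; qfree lt B
  | ?A \/ ?B => qfree lt A; qfree lt B
  | ?A <-> ?B => qfree lt A; qfree lt B
  | ?A -> ?B => qfree lt A; qfree lt B
  end.

Ltac In_list := solve [repeat first [left; reflexivity | right]].

Ltac points lt c s :=
  match goal with
  | |- context [lt ?x ?y] =>
      lazymatch s with context [x] => fail | _ => idtac end;
      points lt c constr:(cons x s)
  | |- context [lt ?x ?y] =>
      lazymatch s with context [y] => fail | _ => idtac end;
      points lt c constr:(cons y s)
  | |- _ => c s
  end.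

Ltac lord_lia O lt s :=
  let h := fresh "h" in let hP := fresh "hP" in
  have [h hP] := rank_embed s O;
  repeat match goal with
    | |- context [lt ?x ?y] =>
        rewrite (proj1 (hP x y ltac:(In_list) ltac:(In_list)))
    end;
  repeat match goal with
    | |- context [?x = ?y] =>
        rewrite (proj2 (hP x y ltac:(In_list) ltac:(In_list)))
    end;
  clear hP; intros; lia.

(** Hypotheses built without quantifiers from order atoms and equations go back into the goal; the
    points occurring there are then ranked in [nat]. *)
Ltac lord_with O lt :=
  intros;
  let T := lazymatch type of lt with ?T -> _ => T end in
  repeat match goal with
    | H : ?P |- _ =>
        lazymatch P with context [lt _ _] => idtac | @eq T _ _ => idtac
          | ~ @eq T _ _ => idtac | @eq T _ _ \/ _ => idtac end;
        qfree lt P; revert H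
    end;
  points lt ltac:(fun s => lord_lia O lt s) constr:(@nil T).

Ltac lord := match goal with O : lin_order ?lt |- _ => lord_with O lt end.

Section Neighbourhoods.
Variables (T : Type) (lt : T -> T -> Prop).

Definition is_inf (S : T -> Prop) s : Prop := (forall x, S x -> ~ lt x s) /\
  forall u, lt s u -> exists x, S x /\ lt x u.

Definition is_sup (S : T -> Prop) s : Prop := (forall x, S x -> ~ lt s x) /\
  forall u, lt u s -> exists x, S x /\ lt u x.

Definition locally (x : T) (P : T -> Prop) : Prop :=
  exists l r, lt l x /\ lt x r /\ forall y, lt l y -> lt y r -> P y.

Lemma locally_imp x (P Q : T -> Prop) : (forall y, P y -> Q y) ->
  locally x P -> locally x Q.
Proof.
move=> h [l [r [? [? H]]]]; exists l, r; split=> //; split=> // y ? ?.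
by apply: h; apply: H.
Qed.

Lemma locally_and x (P Q : T -> Prop) : lin_order lt ->
  locally x P -> locally x Q -> locally x (fun y => P y /\ Q y).
Proof.
move=> O [l [r [lx [xr hP]]]] [l' [r' [lx' [xr' hQ]]]].
have [l2 [l2l [l2l' l2x]]] : exists l2, ~ lt l2 l /\ ~ lt l2 l' /\ lt l2 x.
  by case: (pselect (lt l l')) => ?; [exists l'|exists l]; lord.
have [r2 [r2r [r2r' xr2]]] : exists r2, ~ lt r r2 /\ ~ lt r' r2 /\ lt x r2.
  by case: (pselect (lt r r')) => ?; [exists r|exists r']; lord.
exists l2, r2; split=> //; split=> // y ly yr.
by split; [apply: hP; lord|apply: hQ; lord].
Qed.
End Neighbourhoods.

(** * Definability *)

Section JointDefinability.
Variables (L : signature) (M N : structure L) (C : Type).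
Variables (i : C -> M) (i' : C -> N).

(* P and Q are defined by one formula, in M with parameters i and in N with
   parameters i'; with N = M and i' = i this is definability of P. *)
Definition tdef (P : (nat -> M) -> Prop) (Q : (nat -> N) -> Prop) : Prop :=
  exists phi : fm L C, (forall v, P v <-> fsat i phi v) /\
                       (forall v, Q v <-> fsat i' phi v).

Definition tfun (t : (nat -> M) -> M) (t' : (nat -> N) -> N) : Prop :=
  tdef (fun v => v 0 = t (fun k => v k.+1)) (fun v => v 0 = t' (fun k => v k.+1)).

Lemma t_ext P Q P' Q' : (forall v, P v <-> P' v) -> (forall v, Q v <-> Q' v) ->
  tdef P Q -> tdef P' Q'.
Proof.
by move=> h h' [phi [a b]]; exists phi; split=> v; [rewrite -h|rewrite -h'].
Qed.

Lemma t_false : tdef (fun _ => False) (fun _ => False).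
Proof. by exists (FB L C). Qed.

Lemma t_imp P Q P' Q' : tdef P P' -> tdef Q Q' ->
  tdef (fun v => P v -> Q v) (fun v => P' v -> Q' v).
Proof.
by move=> [a [ha ha']] [b [hb hb']]; exists (FI a b); split=> v /=;
  [rewrite ha hb|rewrite ha' hb'].
Qed.

Lemma t_not P P' : tdef P P' -> tdef (fun v => ~ P v) (fun v => ~ P' v).
Proof. by move=> h; apply: t_imp => //; apply: t_false. Qed.

Lemma t_true : tdef (fun _ => True) (fun _ => True).
Proof. by apply: t_ext (t_imp t_false t_false) => v. Qed.

Lemma t_or P Q P' Q' : tdef P P' -> tdef Q Q' ->
  tdef (fun v => P v \/ Q v) (fun v => P' v \/ Q' v).
Proof.
move=> hP hQ; apply: t_ext (t_imp (t_not hP) hQ) => v.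
  by case: (pselect (P v)); tauto.
by case: (pselect (P' v)); tauto.
Qed.

Lemma t_and P Q P' Q' : tdef P P' -> tdef Q Q' ->
  tdef (fun v => P v /\ Q v) (fun v => P' v /\ Q' v).
Proof.
move=> hP hQ; apply: t_ext (t_not (t_imp hP (t_not hQ))) => v.
  by case: (pselect (P v)); case: (pselect (Q v)); tauto.
by case: (pselect (P' v)); case: (pselect (Q' v)); tauto.
Qed.

Lemma t_iff P Q P' Q' : tdef P P' -> tdef Q Q' ->
  tdef (fun v => P v <-> Q v) (fun v => P' v <-> Q' v).
Proof. by move=> hP hQ; apply: t_and; apply: t_imp. Qed.

Lemma t_all (P : M -> (nat -> M) -> Prop) (P' : N -> (nat -> N) -> Prop) :
  tdef (fun v => P (v 0) (fun k => v k.+1)) (fun v => P' (v 0) (fun k => v k.+1)) ->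
  tdef (fun v => forall x, P x v) (fun v => forall x, P' x v).
Proof.
by move=> [a [h h']]; exists (FA a); split=> v /=; split=> H x;
  move: (H x); rewrite -?h -?h' //= => /h.
Qed.

Lemma t_ex (P : M -> (nat -> M) -> Prop) (P' : N -> (nat -> N) -> Prop) :
  tdef (fun v => P (v 0) (fun k => v k.+1)) (fun v => P' (v 0) (fun k => v k.+1)) ->
  tdef (fun v => exists x, P x v) (fun v => exists x, P' x v).
Proof.
move=> h; apply: t_ext (t_not (t_all (P := fun x v => ~ P x v)
  (P' := fun x v => ~ P' x v) (t_not h))) => v.
  by split=> [/existsNP [x /contrapT]|[x hx] /(_ x)]; first exists x.
by split=> [/existsNP [x /contrapT]|[x hx] /(_ x)]; first exists x.
Qed.

Lemma t_ren (r : nat -> nat) P P' : tdef P P' ->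
  tdef (fun v => P (fun k => v (r k))) (fun v => P' (fun k => v (r k))).
Proof.
move=> [a [h h']]; exists (fsub (fun k => TV L C (r k)) (@TP L C) a).
by split=> v; rewrite fsat_sub /= -?h -?h'.
Qed.

Lemma t_eqv j k : tdef (fun v => v j = v k) (fun v => v j = v k).
Proof. by exists (FE (TV L C j) (TV L C k)). Qed.

Lemma tfun_var k : tfun (fun v => v k) (fun v => v k).
Proof. exact: t_eqv. Qed.

Lemma tfun_const a : tfun (fun _ => i a) (fun _ => i' a).
Proof. by exists (FE (TV L C 0) (TP L a)). Qed.

Lemma t_forall_lt n (P : nat -> (nat -> M) -> Prop) P' :
  (forall k, k < n -> tdef (P k) (P' k)) ->
  tdef (fun v => forall k, k < n -> P k v) (fun v => forall k, k < n -> P' k v).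
Proof.
elim: n => [|n IH] h; first by apply: t_ext t_true.
apply: t_ext (t_and (IH _) (h n _)) => [v|v|k kn|] //; last by apply: h; lia.
  split=> [[H1 H2] k|H]; last by split=> [k kn|]; apply: H => //; lia.
  by rewrite ltnS leq_eqVlt => /orP [/eqP->|/H1].
split=> [[H1 H2] k|H]; last by split=> [k kn|]; apply: H => //; lia.
by rewrite ltnS leq_eqVlt => /orP [/eqP->|/H1].
Qed.

Lemma ncatSr (T : Type) n (u v : nat -> T) :
  ncat n.+1 u v = ncat n u (scons (u n) v).
Proof.
apply: funext => k; rewrite /ncat ltnS leq_eqVlt; case: eqP => [->|ne] /=.
  by rewrite ltnn subnn.
case: ltnP => // kn; have -> : k - n = (k - n.+1).+1 by lia.
by [].
Qed.

Lemma t_exs n P P' : tdef P P' ->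
  tdef (fun v => exists u, P (ncat n u v)) (fun v => exists u, P' (ncat n u v)).
Proof.
elim: n P P' => [|n IH] P P' h.
  apply: t_ext h => v; (have E u : ncat 0 u v = v by
    apply: funext => k; rewrite /ncat subn0); by split=> [?|[u]];
    [exists v; rewrite E|rewrite E].
have h1 := @t_ex (fun x v => exists u, P (ncat n u (scons x v)))
   (fun x v => exists u, P' (ncat n u (scons x v))).
apply: t_ext (h1 _) => [v|v|].
- split=> [[x [u H]]|[u H]]; last by exists (u n), u; rewrite -ncatSr.
  exists (fun k => if k < n then u k else x); rewrite ncatSr ltnn.
  congr P: H; apply: funext => k; by rewrite /ncat; case: ifP.
- split=> [[x [u H]]|[u H]]; last by exists (u n), u; rewrite -ncatSr.
  exists (fun k => if k < n then u k else x); rewrite ncatSr ltnn.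
  congr P': H; apply: funext => k; by rewrite /ncat; case: ifP.
- apply: t_ext (IH _ _ h) => v; (have -> : scons (v 0) (fun k => v k.+1) = v
    by apply: funext => -[]); by [].
Qed.

(** Definable functions are not terms, so literal substitution is impossible. Their values are
    quantified instead: some [u] with [u k = s k v] for all [k < n] satisfies [P], where [n] bounds
    the variables on which [P] depends in both structures. *)
Lemma t_sub P P' (s : nat -> (nat -> M) -> M) (s' : nat -> (nat -> N) -> N) :
  tdef P P' -> (forall k, tfun (s k) (s' k)) ->
  tdef (fun v => P (fun k => s k v)) (fun v => P' (fun k => s' k v)).
Proof.
move=> hP hs; have [phi [h h']] := hP; have [n [l supp]] := fm_support phi.
have sP u v : (forall k, k < n -> u k = v k) -> P u <-> P v.
  by move=> e; rewrite !h; apply: supp; split.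
have sP' u v : (forall k, k < n -> u k = v k) -> P' u <-> P' v.
  by move=> e; rewrite !h'; apply: supp; split.
have hk k : k < n -> tdef (fun v => v k = s k (fun j => v (n + j)))
                      (fun v => v k = s' k (fun j => v (n + j))).
  move=> _; apply: t_ext (t_ren (scons k (fun j => n + j)) (hs k)) => v //=.
have := t_exs n (t_and (t_forall_lt hk) hP).
apply: t_ext => v.
- have E u : (fun j => ncat n u v (n + j)) = v.
    apply: funext => j; rewrite /ncat ifN; last by lia.
    by congr v; lia.
  split=> [[u [H Pu]]|H].
    by apply/(sP _ (ncat n u v)) => // k kn; rewrite H ?E.
  exists (fun k => s k v); split=> [k kn|]; first by rewrite E /ncat kn.
  by apply/(sP _ (fun k => s k v)) => // k kn; rewrite /ncat kn.
- have E u : (fun j => ncat n u v (n + j)) = v.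
    apply: funext => j; rewrite /ncat ifN; last by lia.
    by congr v; lia.
  split=> [[u [H Pu]]|H].
    by apply/(sP' _ (ncat n u v)) => // k kn; rewrite H ?E.
  exists (fun k => s' k v); split=> [k kn|]; first by rewrite E /ncat kn.
  by apply/(sP' _ (fun k => s' k v)) => // k kn; rewrite /ncat kn.
Qed.

Definition D1 (P : M -> Prop) (P' : N -> Prop) : Prop :=
  tdef (fun v => P (v 0)) (fun v => P' (v 0)).
Definition D2 (P : M -> M -> Prop) (P' : N -> N -> Prop) : Prop :=
  tdef (fun v => P (v 0) (v 1)) (fun v => P' (v 0) (v 1)).
Definition D3 (P : M -> M -> M -> Prop) (P' : N -> N -> N -> Prop) : Prop :=
  tdef (fun v => P (v 0) (v 1) (v 2)) (fun v => P' (v 0) (v 1) (v 2)).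
Definition F1 (f : M -> M) (f' : N -> N) : Prop :=
  tfun (fun v => f (v 0)) (fun v => f' (v 0)).
Definition F2 (f : M -> M -> M) (f' : N -> N -> N) : Prop :=
  tfun (fun v => f (v 0) (v 1)) (fun v => f' (v 0) (v 1)).
(** The distinguished argument comes first among the variables; the remaining assignment is the
    parameter of a definable family. *)
Definition E1 (P : (nat -> M) -> M -> Prop) (P' : (nat -> N) -> N -> Prop) : Prop :=
  tdef (fun v => P (fun k => v k.+1) (v 0)) (fun v => P' (fun k => v k.+1) (v 0)).
Definition E2 (P : (nat -> M) -> M -> M -> Prop)
    (P' : (nat -> N) -> N -> N -> Prop) : Prop :=
  tdef (fun v => P (fun k => v k.+2) (v 0) (v 1))
       (fun v => P' (fun k => v k.+2) (v 0) (v 1)).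

Section Application.
Variables (s : nat -> (nat -> M) -> M) (s' : nat -> (nat -> N) -> N).
Variables (t u w : (nat -> M) -> M) (t' u' w' : (nat -> N) -> N).
Hypotheses (hs : forall k, tfun (s k) (s' k)).
Hypotheses (ht : tfun t t') (hu : tfun u u') (hw : tfun w w').

Lemma t_app1 P P' : D1 P P' -> tdef (fun v => P (t v)) (fun v => P' (t' v)).
Proof. by move=> h; apply: (t_sub (s := fun=> t) (s' := fun=> t') h). Qed.

Lemma t_app2 P P' : D2 P P' ->
  tdef (fun v => P (t v) (u v)) (fun v => P' (t' v) (u' v)).
Proof.
move=> h; apply: (t_sub (s := scons t (fun=> u)) (s' := scons t' (fun=> u')) h).
by case.
Qed.

Lemma t_app3 P P' : D3 P P' ->
  tdef (fun v => P (t v) (u v) (w v)) (fun v => P' (t' v) (u' v) (w' v)).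
Proof.
move=> h; apply: (t_sub (s := scons t (scons u (fun=> w)))
  (s' := scons t' (scons u' (fun=> w'))) h).
by case=> [|[]].
Qed.

Lemma t_eapp1 P P' : E1 P P' ->
  tdef (fun v => P (fun k => s k v) (t v)) (fun v => P' (fun k => s' k v) (t' v)).
Proof.
move=> h; apply: (t_sub (s := scons t s) (s' := scons t' s') h).
by case=> [|k] /=.
Qed.

Lemma t_eapp2 P P' : E2 P P' ->
  tdef (fun v => P (fun k => s k v) (t v) (u v))
       (fun v => P' (fun k => s' k v) (t' v) (u' v)).
Proof.
move=> h; apply: (t_sub (s := scons t (scons u s)) (s' := scons t' (scons u' s')) h).
by case=> [|[|k]] /=.
Qed.

Lemma t_eq : tdef (fun v => t v = u v) (fun v => t' v = u' v).
Proof. exact: (t_app2 (t_eqv 0 1)). Qed.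
End Application.

Lemma tfunS t t' : tfun t t' ->
  tfun (fun v => t (fun k => v k.+1)) (fun v => t' (fun k => v k.+1)).
Proof.
by move=> h; apply: t_ext (t_ren (fun k => if k is k'.+1 then k'.+2 else 0) h).
Qed.

Lemma tfun_app0 s s' t t' : tfun t t' -> (forall k, tfun (s k) (s' k)) ->
  tfun (fun v => t (fun k => s k v)) (fun v => t' (fun k => s' k v)).
Proof.
move=> ht hs.
apply: (t_sub (s := scons (fun v => v 0) (fun k v => s k (fun j => v j.+1)))
  (s' := scons (fun v => v 0) (fun k v => s' k (fun j => v j.+1))) ht).
by case=> [|k] /=; [apply: tfun_var|apply: tfunS].
Qed.

Lemma tfun_app1 f f' t t' : F1 f f' -> tfun t t' ->
  tfun (fun v => f (t v)) (fun v => f' (t' v)).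
Proof. by move=> h ht; apply: (tfun_app0 (s := fun=> t) (s' := fun=> t') h). Qed.

Lemma tfun_app2 f f' t t' u u' : F2 f f' -> tfun t t' -> tfun u u' ->
  tfun (fun v => f (t v) (u v)) (fun v => f' (t' v) (u' v)).
Proof.
move=> h ht hu; apply: (tfun_app0 (s := scons t (fun=> u))
  (s' := scons t' (fun=> u')) h); by case.
Qed.

Lemma t_atm n A A' : E1 A A' ->
  tdef (fun v => atm n (A v)) (fun v => atm n (A' v)).
Proof.
elim: n A A' => [|n IH] A A' h /=; first by apply: t_all; apply: t_not.
apply: t_all; apply: t_imp => //.
apply: (IH (fun v t => A (fun k => v k.+1) t /\ t <> v 0)
  (fun v t => A' (fun k => v k.+1) t /\ t <> v 0)).
apply: t_and; last by apply: t_not; apply: t_eqv.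
exact: (t_ren (scons 0 (fun k => k.+2)) h).
Qed.
End JointDefinability.

(* Definability of a predicate by recursion on its syntax. *)
Ltac dfb_step := cbn beta;
  lazymatch goal with
  | |- tdef _ _ (fun _ => True) _ => apply: t_true
  | |- tdef _ _ (fun _ => False) _ => apply: t_false
  | |- tdef _ _ (fun _ => _ /\ _) _ => apply: t_and
  | |- tdef _ _ (fun _ => _ \/ _) _ => apply: t_or
  | |- tdef _ _ (fun _ => _ <-> _) _ => apply: t_iff
  | |- tdef _ _ (fun _ => ~ _) _ => apply: t_not
  | |- tdef _ _ (fun _ => exists x, _) _ => apply: t_ex
  | |- tdef _ _ (fun _ => _ = _) _ => apply: t_eq
  | |- tdef _ _ (fun _ => atm _ _) _ => apply: t_atm; rewrite /E1
  | |- tdef _ _ (fun _ => forall x, _) _ => first [apply: t_imp | apply: t_all]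
  | |- tdef _ _ _ _ => match goal with
    | H : D1 _ _ ?P _ |- tdef _ _ (fun _ => ?P _) _ => apply: (t_app1 _ H)
    | H : D2 _ _ ?P _ |- tdef _ _ (fun _ => ?P _ _) _ => apply: (t_app2 _ _ H)
    | H : D3 _ _ ?P _ |- tdef _ _ (fun _ => ?P _ _ _) _ => apply: (t_app3 _ _ _ H)
    | H : E1 _ _ ?P _ |- tdef _ _ (fun _ => ?P _ _) _ => apply: (t_eapp1 _ _ H)
    | H : E2 _ _ ?P _ |- tdef _ _ (fun _ => ?P _ _ _) _ => apply: (t_eapp2 _ _ _ H)
    end
  | |- tfun _ _ (fun v => v _) _ => apply: tfun_var
  | H : tfun _ _ ?f ?g |- tfun _ _ ?f ?g => exact: H
  | |- tfun _ _ (fun v => _) _ => first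
      [ apply: tfun_const
      | match goal with
        | H : F1 _ _ ?f _ |- tfun _ _ (fun _ => ?f _) _ => apply: (tfun_app1 H)
        | H : F2 _ _ ?f _ |- tfun _ _ (fun _ => ?f _ _) _ => apply: (tfun_app2 H)
        | H : tfun _ _ ?f _ |- tfun _ _ (fun _ => ?f _) _ => apply: (tfun_app0 H)
        end ]
  | |- forall _ : nat, tfun _ _ _ _ => intro
  end.
Ltac dfb := repeat dfb_step.

(** * Transfer to an elementary extension *)

Section Transfer.
Variables (L : signature) (z : csym L) (M N : structure L) (e : M -> N).
Variables (C : Type) (i : C -> M) (i' : C -> N).
Hypotheses (ee : elementary e) (ii' : forall a, i' a = e (i a)).

Lemma tdef_elementary P Q v : tdef i i' P Q -> P v <-> Q (fun k => e (v k)).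
Proof.
by move=> [phi [h h']]; rewrite h h'; apply: (fsat_elementary z).
Qed.

(** Only finitely many variables matter, so the universal closure is a single sentence. Every [v] in
    N is covered, not only the image of an assignment in M. *)
Lemma tdef_forall P Q : tdef i i' P Q -> (forall v, P v) -> forall v, Q v.
Proof.
move=> hPQ; have [phi [h h']] := hPQ; have [n [l supp]] := fm_support phi.
have := tdef_elementary (fun _ => cint M z) (t_not (t_exs n (t_not hPQ))).
move=> H PP; have /H QQ : ~ exists u : nat -> M, ~ P (ncat n u (fun _ => cint M z)).
  by case=> u; apply.
move=> v; apply: contrapT => Qv; apply: QQ; exists v => /h' Q1; apply/Qv/h'.
by apply: (iffLR (supp _ _ _ _ _ _) Q1); split=> // k kn; rewrite /ncat kn.
Qed.
End Transfer.

(** * O-minimality *)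

Notation ddef := (tdef (@id _) (@id _)).

(** This is the topological boundary of [S] for the order topology. *)
Definition bd (T : Type) (lt : T -> T -> Prop) (S : T -> Prop) (t : T) : Prop :=
  forall l r, lt l t -> lt t r -> exists x y,
    (lt l x /\ lt x r) /\ (lt l y /\ lt y r) /\ S x /\ ~ S y.

Section OMinimality.
Variables (L : signature) (M : structure L).

(** Suprema, infima and finite boundaries replace the decomposition into points and intervals. For a
    definable family, the existence of suprema and infima is one first-order statement, and
    finiteness of the boundary becomes one as soon as a uniform bound is known; in this form
    o-minimality passes to elementary extensions. *)
Record omin (lt : M -> M -> Prop) : Prop := OMin {
  om_lin : lin_order lt;
  om_dense : forall x y, lt x y -> exists z, lt x z /\ lt z y;
  om_up : forall x, exists y, lt x y;
  om_down : forall x, exists y, lt y x;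
  om_def : D2 (@id M) (@id M) lt lt;
  om_sup : forall S : M -> Prop, D1 (@id M) (@id M) S S -> (exists x, S x) ->
    (exists u, forall x, S x -> ~ lt u x) ->
    exists s, is_sup lt S s;
  om_inf : forall S : M -> Prop, D1 (@id M) (@id M) S S -> (exists x, S x) ->
    (exists u, forall x, S x -> ~ lt x u) ->
    exists s, is_inf lt S s;
  om_bd : forall S : M -> Prop, D1 (@id M) (@id M) S S -> fin (bd lt S) }.

(** The notion is symmetric under reversal, which exchanges [om_sup] and [om_inf]; left-hand
    statements and decreasing functions are obtained in this way. *)
Lemma omin_flip lt : omin lt -> omin (fun x y => lt y x).
Proof.
move=> [[irr tr tot] dense up down def sup inf bdfin]; split=> //.
- split=> // [x y z yx zy|x y]; first exact: tr yx.
  by case: (tot x y) => [?|->|?]; [constructor 3|constructor 2|constructor 1].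
- by move=> x y /dense [z [? ?]]; exists z.
- by rewrite /D2; dfb.
- move=> S hS; apply: fin_sub (bdfin S hS) => t h l r lt' tr'.
  by have [x [y [[? ?] [[? ?] [? ?]]]]] := h r l tr' lt'; exists x, y.
Qed.
End OMinimality.

Ltac ol O := let O' := fresh "O" in have O' := om_lin O;
  lazymatch type of O with omin ?lt => lord_with O' lt end.

Section Basics.
Variables (L : signature) (M : structure L) (lt : M -> M -> Prop).
Hypothesis O : omin lt.
Let i : M -> M := @id M.
Let dlt : D2 i i lt lt := om_def O.
Implicit Types (S X : M -> Prop).

Definition itv (a b x : M) : Prop := lt a x /\ lt x b.

Lemma fin_gap X a b : fin X -> lt a b ->
  exists c, lt a c /\ lt c b /\ forall x, lt a x -> lt x c -> ~ X x.
Proof.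
move=> [n]; elim: n X b => [|n IH] X b h ab.
  by have [c [ac cb]] := om_dense O ab; exists c; split=> //; split=> // x _ _ /h.
case: (pselect (exists z, X z /\ lt a z /\ lt z b)) => [[z [Xz [az zb]]]|nX].
  have [c [ac [cz hc]]] := IH _ z (h z Xz) az.
  exists c; split=> //; split=> [|x ax xc Xx]; first by ol O.
  by apply: (hc x) => //; split=> // xz; move: xc; rewrite xz; ol O.
have [c [ac cb]] := om_dense O ab; exists c; split=> //; split=> // x ax xc Xx.
by apply: nX; exists x; split=> //; split=> //; ol O.
Qed.

Lemma itv_not_fin X a b : lt a b -> (forall x, lt a x -> lt x b -> X x) -> ~ fin X.
Proof.
move=> ab h /fin_gap /(_ ab) [c [ac [cb hc]]].
have [d [ad dc]] := om_dense O ac; apply: (hc d) => //; apply: h; ol O.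
Qed.

(** Let [s] be the supremum of the [t] such that [S] holds from [x] to [t]. As [s] is no boundary
    point, [S] is constant near it, hence holds at [s] and a little beyond; this contradicts the
    choice of [s] unless [y] has been reached. *)
Lemma connect_imp S x y : D1 i i S S -> ~ lt y x ->
  (forall t, ~ lt t x -> ~ lt y t -> ~ bd lt S t) -> S x -> S y.
Proof.
move=> dS xy hb Sx.
pose Z t := ~ lt t x /\ ~ lt y t /\ forall s, ~ lt s x -> ~ lt t s -> S s.
have dZ : D1 i i Z Z by rewrite /D1 /Z; dfb.
have Zx : Z x.
  split; [|split] => //; first by ol O.
  by move=> s sx xs; have -> : s = x by ol O.
have [s [sub sap]] := om_sup O dZ (ex_intro _ x Zx)
   (ex_intro _ y (fun t (h : Z t) => proj1 (proj2 h))).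
have xs := sub _ Zx.
have sy : ~ lt y s by move=> /sap [t [[_ [h _]] /h]].
have [l [r [ls [sr hlr]]]] : exists l r, lt l s /\ lt s r /\
    forall u v, itv l r u -> itv l r v -> S u -> S v.
  apply: contrapT => H; apply: (hb s) => // l r ls sr; apply: contrapT => H'.
  apply: H; exists l, r; split=> //; split=> // u v [? ?] [? ?] Su.
  by apply: contrapT => Sv; apply: H'; exists u, v.
have [t [[tx [ty hS]] lt']] := sap l ls.
have St : S t by apply: hS => //; ol O.
have ts := sub t (conj tx (conj ty hS)).
have Sr u : ~ lt u x -> lt u r -> S u.
  move=> ux ur; case: (pselect (lt t u)) => tu; last exact: hS.
  by apply: (hlr t); rewrite /itv //; ol O.
apply: contrapT => nSy.
have ys : lt s y.
  apply: contrapT => ys; apply: nSy; have -> : y = s by ol O.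
  by apply: Sr => //; ol O.
have [u [su [uy ur]]] : exists u, lt s u /\ lt u y /\ lt u r.
  case: (pselect (lt y r)) => yr.
    by have [u [? ?]] := om_dense O ys; exists u; ol O.
  by have [u [? ?]] := om_dense O sr; exists u; ol O.
apply: (sub u) => //; split; [ol O|split; first ol O].
by move=> w wx wu; apply: Sr => //; ol O.
Qed.

Lemma bd_not S t : bd lt (fun x => ~ S x) t -> bd lt S t.
Proof.
move=> h l r lt' tr; have [x [y [? [? [Sx Sy]]]]] := h l r lt' tr.
by exists y, x; split=> //; split=> //; split=> //; apply: contrapT.
Qed.

Lemma connect S x y : D1 i i S S -> ~ lt y x ->
  (forall t, ~ lt t x -> ~ lt y t -> ~ bd lt S t) -> S x <-> S y.
Proof.
move=> dS xy hb; split; first exact: connect_imp.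
move=> Sy; apply: contrapT => nSx.
apply: (@connect_imp (fun z => ~ S z) x y) => //; first by rewrite /D1; dfb.
by move=> t tx yt /bd_not; apply: hb.
Qed.

Lemma connect_itv S a b x y : D1 i i S S -> (forall t, itv a b t -> ~ bd lt S t) ->
  itv a b x -> itv a b y -> S x -> S y.
Proof.
move=> dS hb [ax xb] [ay yb].
case: (pselect (lt y x)) => yx.
  by apply: (iffRL (connect (x := y) (y := x) dS _ _)); [ol O|
    move=> t ? ?; apply: hb; rewrite /itv; ol O].
by apply: (iffLR (connect dS yx _)) => t ? ?; apply: hb; rewrite /itv; ol O.
Qed.

Lemma germ_right S a b : D1 i i S S -> lt a b -> exists c, lt a c /\ lt c b /\
  ((forall x, itv a c x -> S x) \/ (forall x, itv a c x -> ~ S x)).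
Proof.
move=> dS ab; have [c [ac [cb hc]]] := fin_gap (om_bd O dS) ab.
exists c; split=> //; split=> //.
have [m [am mc]] := om_dense O ac.
case: (pselect (S m)) => Sm; [left|right] => x xac; last move=> Sx; last apply: Sm.
  by apply: (connect_itv dS _ _ xac Sm) => // t [? ?]; apply: hc.
by apply: (connect_itv dS _ xac _ Sx) => // t [? ?]; apply: hc.
Qed.

Lemma not_bd_itv S t : ~ bd lt S t -> exists l r, lt l t /\ lt t r /\
  forall u, itv l r u -> (S u <-> S t).
Proof.
move=> nb; apply: contrapT => H; apply: nb => l r ls sr; apply: contrapT => H'.
apply: H; exists l, r; split=> //; split=> // u [? ?].
by split=> h; apply: contrapT => h'; apply: H'; [exists u, t|exists t, u].
Qed.

(** A point of [S] off the boundary has an interval inside [S] around it. A definable set that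
    contains no interval is therefore part of its own boundary. *)
Lemma fin_no_itv S a b : D1 i i S S ->
  (forall c d, ~ lt c a -> ~ lt b d -> lt c d -> exists x, itv c d x /\ ~ S x) ->
  fin (fun x => itv a b x /\ S x).
Proof.
move=> dS h; apply: fin_sub (om_bd O dS) => t [[at_ tb] St].
apply: contrapT => /not_bd_itv [l [r [lt' [tr hS]]]].
have [c [cl [ca ct]]] : exists c, ~ lt c l /\ ~ lt c a /\ lt c t.
  by case: (pselect (lt l a)) => ?; [exists a|exists l]; ol O.
have [d [dr [db td]]] : exists d, ~ lt r d /\ ~ lt b d /\ lt t d.
  by case: (pselect (lt b r)) => ?; [exists b|exists r]; ol O.
have cd : lt c d by ol O.
have [x [[cx xd] nSx]] := h c d ca db cd; apply: nSx; apply/hS => //.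
by rewrite /itv; ol O.
Qed.
End Basics.

Section Germs.
Variables (L : signature) (M : structure L) (lt : M -> M -> Prop).
Hypothesis O : omin lt.

Lemma germ_left S a b : D1 (@id M) (@id M) S S -> lt a b ->
  exists c, lt a c /\ lt c b /\
  ((forall x, itv lt c b x -> S x) \/ (forall x, itv lt c b x -> ~ S x)).
Proof.
move=> dS ab; have [c [? [? h]]] := germ_right (omin_flip O) dS ab.
by exists c; split=> //; split=> //; case: h => h; [left|right] => x [? ?]; apply: h.
Qed.

Lemma fin_gap_left X a b : fin X -> lt a b ->
  exists c, lt a c /\ lt c b /\ forall x, lt c x -> lt x b -> ~ X x.
Proof.
move=> fX ab; have [c [? [? h]]] := fin_gap (omin_flip O) fX ab.
by exists c; split=> //; split=> // x ? ?; apply: h.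
Qed.
End Germs.

(** * Monotonicity *)

Section Monotonicity.
Variables (L : signature) (M : structure L).
Implicit Types (lt : M -> M -> Prop).
Let i : M -> M := @id M.

Definition subitv lt (a b c d : M) : Prop := ~ lt c a /\ ~ lt b d /\ lt c d.

(** The orders of the source and of the target are kept apart, so that each can be reversed without
    the other. *)
Definition locmin lt lt' (f : M -> M) x := exists l r, lt l x /\ lt x r /\
  forall s, lt l s -> lt s r -> s <> x -> lt' (f x) (f s).

Definition locinc lt lt' (f : M -> M) x := exists l r, lt l x /\ lt x r /\
  (forall s, lt l s -> lt s x -> lt' (f s) (f x)) /\
  (forall s, lt x s -> lt s r -> lt' (f x) (f s)).

Definition jump lt lt' (f : M -> M) z := exists l r, lt l z /\ lt z r /\
  forall y w, lt l y -> lt y z -> lt z w -> lt w r -> lt' (f w) (f y).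

Definition inj_on lt a b (f : M -> M) : Prop :=
  forall x y, itv lt a b x -> itv lt a b y -> f x = f y -> x = y.

Definition inc_on lt lt' a b (f : M -> M) : Prop :=
  forall x y, itv lt a b x -> itv lt a b y -> lt x y -> lt' (f x) (f y).

Definition cont lt lt' (f : M -> M) x : Prop := forall u v, lt' u (f x) ->
  lt' (f x) v -> exists l r, lt l x /\ lt x r /\
  forall s, lt l s -> lt s r -> lt' u (f s) /\ lt' (f s) v.

(** If [f] is constant on no subinterval, its fibres contain no interval and are finite. If it is
    injective on none either, the set [E] of first points of fibres contains no interval and is
    finite. Then (a, b) would be a finite union of finite fibres. *)
Lemma const_or_inj lt f a b : omin lt -> F1 i i f f -> lt a b ->
  exists c d, subitv lt a b c d /\
    ((forall x y, itv lt c d x -> itv lt c d y -> f x = f y) \/ inj_on lt c d f).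
Proof.
move=> O df ab; have dlt := om_def O.
apply: contrapT => H.
have H1 c d : subitv lt a b c d -> ~ (forall x y, itv lt c d x -> itv lt c d y -> f x = f y).
  by move=> h h'; apply: H; exists c, d; split=> //; left.
have H2 c d : subitv lt a b c d -> ~ inj_on lt c d f.
  by move=> h h'; apply: H; exists c, d; split=> //; right.
have fib y : fin (fun x => itv lt a b x /\ f x = y).
  apply: (fin_no_itv O (S := fun x => f x = y)); first by rewrite /D1; dfb.
  move=> c d ca bd' cd; apply: contrapT => h.
  have h' x : itv lt c d x -> f x = y.
    by move=> cdx; apply: contrapT => fx; apply: h; exists x.
  by apply: (H1 c d) => // x x' /h' -> /h' ->.
pose E x := forall x', lt a x' -> lt x' x -> f x' <> f x.
have dE : D1 i i E E by rewrite /D1 /E; dfb.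
have finE : fin (fun x => itv lt a b x /\ E x).
  apply: (fin_no_itv O dE) => c d ca bd' cd; apply: contrapT => h.
  have h' x : itv lt c d x -> E x.
    by move=> cdx; apply: contrapT => fx; apply: h; exists x.
  apply: (H2 c d) => // x y [cx xd] [cy yd] fxy.
  apply: contrapT => xy; have [xy'|yx'] : lt x y \/ lt y x by ol O.
    by apply: (h' y _ x) => //; ol O.
  by apply: (h' x _ y) => //; ol O.
apply: (itv_not_fin O ab (X := itv lt a b)); first by [].
apply: fin_sub (fin_cover (F := fun e x => itv lt a b x /\ f x = f e) finE _); last first.
  by move=> e _; apply: fib.
move=> x abx.
have [m [[abm fm] hm]] := fin_min (om_lin O) (fib (f x)) (ex_intro _ x (conj abx erefl)).
exists m; split; last by rewrite fm.
split=> // x' ax' x'm fx'; apply: (hm x') => //; split; last by rewrite fx'.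
by case: abm => ? ?; split=> //; ol O.
Qed.

(** Some value [f x] is passed downwards for good before [b], and strict local minimality turns the
    place where this happens into a jump. *)
Lemma jump_exists lt lt' f a b : omin lt -> omin lt' -> F1 i i f f -> lt a b ->
  inj_on lt a b f -> (forall x, itv lt a b x -> locmin lt lt' f x) ->
  exists z, itv lt a b z /\ jump lt lt' f z.
Proof.
move=> O O' df + inj lmin; have dlt := om_def O; have dlt' := om_def O'.
move=> ab.
have lt'C x y : itv lt a b x -> itv lt a b y -> x <> y -> ~ lt' (f x) (f y) -> lt' (f y) (f x).
  move=> hx hy xy nxy; have ne : f x <> f y by move/inj => /(_ hx hy).
  by clear - ne nxy O'; ol O'.
(* [B] collects the points whose value lies below all later values. In an interval of such points, a
   strict local minimum would lie both below and above its left neighbours, so [B] is finite. *)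
pose B x := forall y, lt x y -> lt y b -> lt' (f x) (f y).
have dB : D1 i i B B by rewrite /D1 /B; dfb.
have finB : fin (fun x => itv lt a b x /\ B x).
  apply: (fin_no_itv O dB) => c d ca bd' cd; apply: contrapT => h.
  have h' x : itv lt c d x -> B x.
    by move=> cdx; apply: contrapT => fx; apply: h; exists x.
  have [x [cx xd]] := om_dense O cd.
  have [|l [r [lx [xr lm]]]] := lmin x; first by split; ol O.
  have [y [yl [yc yx]]] : exists y, lt l y /\ lt c y /\ lt y x.
    case: (pselect (lt l c)) => lc.
      by have [y [? ?]] := om_dense O cx; exists y; ol O.
    by have [y [? ?]] := om_dense O lx; exists y; ol O.
  have h1 : lt' (f x) (f y) by apply: lm => //; [ol O|move=> yx'; rewrite yx' in yx; ol O].
  have h2 : lt' (f y) (f x) by apply: (h' y) => //; [split; ol O|ol O].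
  by clear - h1 h2 O'; ol O'.
have [a' [aa' [a'b hB]]] := fin_gap_left O finB ab.
have nB x : lt a' x -> lt x b -> exists y, lt x y /\ lt y b /\ lt' (f y) (f x).
  move=> a'x xb; apply: contrapT => h; apply: (hB x) => //; split; first by split; ol O.
  move=> y xy yb; apply: contrapT => xy'; apply: h; exists y; split=> //; split=> //.
  by apply: lt'C => //; try (split; ol O); move=> e; rewrite e in xy; ol O.
have [x [a'x xb]] := om_dense O a'b.
have abx : itv lt a b x by split; ol O.
have inj' y : lt a' y -> lt y b -> y <> x -> ~ lt' (f y) (f x) -> lt' (f x) (f y).
  by move=> *; apply: lt'C => //; split; ol O.
(* The threshold [f x] is undercut everywhere near [b]. Otherwise let [z0] be the infimum of the
   points after which [f] is never below it. By [nB] neither [z0 = x] nor [f z0] below the threshold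
   is possible, and then strict minimality at [z0] lets [z0] move to the left. *)
have [b1 [xb1 [b1b hb1]]] : exists b1, lt x b1 /\ lt b1 b /\
    forall y, lt b1 y -> lt y b -> lt' (f y) (f x).
  have dS : D1 i i (fun y => lt' (f y) (f x)) (fun y => lt' (f y) (f x)).
    by rewrite /D1; dfb.
  have [c [xc [cb [h|h]]]] := germ_left O dS xb.
    by exists c; split=> //; split=> // y cy yb; apply: h.
  exfalso.
  pose Z z := ~ lt z x /\ lt z b /\ forall y, lt z y -> lt y b -> ~ lt' (f y) (f x).
  have dZ : D1 i i Z Z by rewrite /D1 /Z; dfb.
  have Zc : Z c.
    by split; [ol O|split=> // y cy yb; apply: h].
  have [z0 [lo app]] := om_inf O dZ (ex_intro _ c Zc)
    (ex_intro _ x (fun t (h : Z t) => proj1 h)).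
  have cz0 := lo _ Zc.
  have z0x : ~ lt z0 x by move=> /app [w [[wx _] /wx]].
  have hz y : lt z0 y -> lt y b -> ~ lt' (f y) (f x).
    by move=> /app [w [[_ [_ hw]] wy]]; apply: hw.
  have [y1 [xy1 [y1b fy1]]] := nB x a'x xb.
  have xz0 : x <> z0.
    by move=> e; apply: (hz y1) => //; rewrite -e.
  case: (pselect (lt' (f z0) (f x))) => fz0.
    have [||y2 [z0y2 [y2b fy2]]] := nB z0; [ol O|ol O|].
    by apply: (hz y2) => //; clear - fz0 fy2 O'; ol O'.
  have {}fz0 : lt' (f x) (f z0) by apply: inj' => //; try ol O; exact: nesym.
  have [|l [r [lz0 [z0r lm]]]] := lmin z0; first by split; ol O.
  have [w [lw [xw wz0]]] : exists w, lt l w /\ lt x w /\ lt w z0.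
    case: (pselect (lt l x)) => lx.
      have h1 : lt x z0 by ol O.
      by have [y [? ?]] := om_dense O h1; exists y; ol O.
    by have [y [? ?]] := om_dense O lz0; exists y; ol O.
  apply: (lo w) => //; split; first by ol O.
  split=> [|y wy yb]; first by ol O.
  case: (pselect (lt z0 y)) => z0y; first exact: hz.
  case: (pselect (y = z0)) => [->|yz0]; first by clear - fz0 O'; ol O'.
  have h1 : lt' (f z0) (f y) by apply: lm => //; ol O.
  by clear - h1 fz0 O'; ol O'.
(* The jump is at the infimum [z0] of the points after which [f] stays below [f x]. It differs from
   [x], which is a strict local minimum, and directly to its left [f] cannot be below the threshold
   without extending [Z]. *)
pose Z z := ~ lt z x /\ lt z b /\ forall y, lt z y -> lt y b -> lt' (f y) (f x).
have dZ : D1 i i Z Z by rewrite /D1 /Z; dfb.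
have Zb : Z b1 by split; [ol O|split].
have [z0 [lo app]] := om_inf O dZ (ex_intro _ b1 Zb)
  (ex_intro _ x (fun t (h : Z t) => proj1 h)).
have z0b1 := lo _ Zb.
have z0x : ~ lt z0 x by move=> /app [w [[wx _] /wx]].
have hz y : lt z0 y -> lt y b -> lt' (f y) (f x).
  by move=> /app [w [[_ [_ hw]] wy]]; apply: hw.
have lmz0 : locmin lt lt' f z0 by apply: lmin; split; ol O.
have [l [r [lz0 [z0r lm]]]] := lmz0.
have z0b : lt z0 b by ol O.
have xz0 : lt x z0.
  apply: contrapT => h; have e : z0 = x by ol O.
  rewrite e in z0r lm lz0 z0b hz.
  have [y [xy [yb yr]]] : exists y, lt x y /\ lt y b /\ lt y r.
    case: (pselect (lt b r)) => br.
      by have [y [? ?]] := om_dense O z0b; exists y; ol O.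
    by have [y [? ?]] := om_dense O z0r; exists y; ol O.
  have h1 : lt' (f x) (f y).
    by apply: lm => //; [ol O|move=> yx; rewrite yx in xy; ol O].
  by have h2 := hz y xy yb; clear - h1 h2 O'; ol O'.
have dS : D1 i i (fun y => lt' (f y) (f x)) (fun y => lt' (f y) (f x)).
  by rewrite /D1; dfb.
have [l' [l'l [l'x l'z]]] : exists l', ~ lt l' l /\ ~ lt l' x /\ lt l' z0.
  by case: (pselect (lt l x)) => ?; [exists x|exists l]; ol O.
have [c [l'c [cz0 [h|h]]]] := germ_left O dS l'z; last first.
  exists z0; split; first by split; ol O.
  exists c, b; split=> //; split=> // y w cy yz0 z0w wb.
  have h1 : ~ lt' (f y) (f x) by apply: h.
  by have h2 := hz w z0w wb; clear - h1 h2 O'; ol O'.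
exfalso.
have [w [cw wz0]] := om_dense O cz0.
have fz0 : lt' (f z0) (f x).
  have h1 : lt' (f w) (f x) by apply: h.
  have h2 : lt' (f z0) (f w).
    by apply: lm; [ol O|ol O|move=> e; rewrite e in wz0; ol O].
  by clear - h1 h2 O'; ol O'.
apply: (lo w) => //; split; [ol O|split; first ol O].
move=> y wy yb; case: (pselect (lt z0 y)) => z0y; first exact: hz.
case: (pselect (y = z0)) => [->|yz0] //.
by apply: h; split; ol O.
Qed.

(* Strict local minima everywhere force a downward jump in every interval and,
   reversing the order of the domain, an upward jump as well. *)
Lemma no_locmin lt lt' f a b : omin lt -> omin lt' -> F1 i i f f -> lt a b ->
  inj_on lt a b f -> ~ (forall x, itv lt a b x -> locmin lt lt' f x).
Proof.
move=> O O' df ab inj lmin; have dlt := om_def O; have dlt' := om_def O'.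
have dJ : D1 i i (jump lt lt' f) (jump lt lt' f) by rewrite /D1 /jump; dfb.
have [c [ac [cb hc]]] := germ_right O dJ ab.
have sub1 x : itv lt a c x -> itv lt a b x by move=> [? ?]; split; ol O.
have injc : inj_on lt a c f by move=> x y /sub1 hx /sub1 hy; apply: inj.
have lminc x : itv lt a c x -> locmin lt lt' f x by move=> /sub1; apply: lmin.
have {hc} hJ : forall x, itv lt a c x -> jump lt lt' f x.
  case: hc => // hc; have [z [/hc + ?]] := jump_exists O O' df ac injc lminc.
  by [].
have [||z [[zc az] jz]] := jump_exists (omin_flip O) O' df ac.
- by move=> x y [? ?] [? ?]; apply: injc.
- move=> x [? ?]; have [|l [r [? [? lm]]]] := lminc x; first by split.
  by exists r, l; split=> //; split=> // s ? ?; apply: lm.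
have [|l [r [lz [zr J]]]] := hJ z; first by split.
have [r' [l' [zr' [l'z J']]]] := jz.
have [y [ly [l'y yz]]] : exists y, lt l y /\ lt l' y /\ lt y z.
  case: (pselect (lt l l')) => ?.
    by have [y [? ?]] := om_dense O l'z; exists y; ol O.
  by have [y [? ?]] := om_dense O lz; exists y; ol O.
have [w [wr [wr' zw]]] : exists w, lt w r /\ lt w r' /\ lt z w.
  case: (pselect (lt r r')) => ?.
    by have [w [? ?]] := om_dense O zr; exists w; ol O.
  by have [w [? ?]] := om_dense O zr'; exists w; ol O.
have h1 := J y w ly yz zw wr.
have h2 : lt' (f y) (f w) by apply: J'.
by clear - h1 h2 O'; ol O'.
Qed.

(** Let [s0] be the supremum of the [t] up to which all values exceed [f x]. Local increase to the
    left of [s0] puts [f s0] above [f x]; to the right it carries the property past [s0], unless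
    [s0 = y]. *)
Lemma locinc_inc lt lt' f a b : omin lt -> omin lt' -> F1 i i f f ->
  (forall x, itv lt a b x -> locinc lt lt' f x) -> inc_on lt lt' a b f.
Proof.
move=> O O' df li x y [ax xb] [ay yb] xy.
have dlt := om_def O; have dlt' := om_def O'.
pose Z t := lt x t /\ ~ lt y t /\ forall s, lt x s -> ~ lt t s -> lt' (f x) (f s).
have dZ : D1 i i Z Z by rewrite /D1 /Z; dfb.
have tr u v w : lt' u v -> lt' v w -> lt' u w by clear - O'; ol O'.
have [t0 Zt0] : exists t, Z t.
  have [|l [r [lx [xr [_ hr]]]]] := li x; first by split.
  have [t [xt [ty tr']]] : exists t, lt x t /\ lt t y /\ lt t r.
    case: (pselect (lt r y)) => ?.
      by have [w [? ?]] := om_dense O xr; exists w; ol O.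
    by have [w [? ?]] := om_dense O xy; exists w; ol O.
  exists t; split=> //; split; first by ol O.
  by move=> s xs st; apply: hr => //; ol O.
have [s0 [up app]] := om_sup O dZ (ex_intro _ t0 Zt0)
   (ex_intro _ y (fun t (h : Z t) => proj1 (proj2 h))).
have s0y : ~ lt y s0 by move=> /app [t [[_ [h _]] /h]].
have xs0 : lt x s0 by have [? _] := Zt0; have ? := up _ Zt0; ol O.
have hs s : lt x s -> lt s s0 -> lt' (f x) (f s).
  by move=> xs /app [t [[_ [_ ht]] st]]; apply: ht => //; ol O.
have [|l [r [ls0 [s0r [hl hr]]]]] := li s0; first by split; ol O.
have fs0 : lt' (f x) (f s0).
  have [t [lt_ [xt ts0]]] : exists t, lt l t /\ lt x t /\ lt t s0.
    case: (pselect (lt l x)) => ?.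
      by have [w [? ?]] := om_dense O xs0; exists w; ol O.
    by have [w [? ?]] := om_dense O ls0; exists w; ol O.
  exact: tr (hs t xt ts0) (hl t lt_ ts0).
case: (pselect (y = s0)) => [->|ys0] //.
have {}s0y : lt s0 y by ol O.
have [t [s0t [ty tr']]] : exists t, lt s0 t /\ lt t y /\ lt t r.
  case: (pselect (lt r y)) => ?.
    by have [w [? ?]] := om_dense O s0r; exists w; ol O.
  by have [w [? ?]] := om_dense O s0y; exists w; ol O.
exfalso; apply: (up t) => //; split; first by ol O.
split=> [|s xs ts]; first by ol O.
case: (pselect (lt s s0)) => ss0; first exact: hs.
case: (pselect (s = s0)) => [->|ne] //.
by apply: tr fs0 _; apply: hr; ol O.
Qed.

(** The image of an injective map on an interval is infinite, hence contains an interval. An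
    increasing function is continuous where its values fill an interval, since prescribed bounds
    near [f x] are themselves values. *)
Lemma inc_cont lt lt' f a b : omin lt -> omin lt' -> F1 i i f f -> lt a b ->
  inc_on lt lt' a b f -> exists c d, subitv lt a b c d /\
  forall x, itv lt c d x -> cont lt lt' f x.
Proof.
move=> O O' df ab inc; have dlt := om_def O; have dlt' := om_def O'.
have refl x y : itv lt a b x -> itv lt a b y -> lt' (f x) (f y) -> lt x y.
  move=> hx hy fxy; apply: contrapT => xy.
  case: (pselect (x = y)) => [e|ne].
    by rewrite e in fxy; clear - fxy O'; ol O'.
  have h : lt' (f y) (f x) by apply: inc => //; ol O.
  by clear - h fxy O'; ol O'.
have [p0 [ap0 p0b]] := om_dense O ab; have [q0 [pq0 q0b]] := om_dense O p0b.
pose X y := exists x, itv lt a b x /\ f x = y.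
have dX : D1 i i X X by rewrite /D1 /X /itv; dfb.
have [u [v [uv [pu [vq uvX]]]]] : exists u v, lt' u v /\ ~ lt' u (f p0) /\ ~ lt' (f q0) v /\
    forall y, itv lt' u v y -> X y.
  apply: contrapT => H.
  have : fin (fun y => itv lt' (f p0) (f q0) y /\ X y).
    apply: (fin_no_itv O' dX) => u v ? ? uv; apply: contrapT => h; apply: H.
    exists u, v; split=> //; split=> //; split=> // y uvy.
    by apply: contrapT => nX; apply: h; exists y.
  case=> n hn; apply: (itv_not_fin O pq0 (X := itv lt p0 q0)); first by [].
  exists n; apply: (atm_transport (R := fun y x => f x = y)) hn.
    move=> x [px xq]; exists (f x); split=> //.
    have abx : itv lt a b x by split; ol O.
    by split; [split; apply: inc => //; split; ol O|exists x].
  move=> y x x' _ [px xq] [px' xq'] <- e.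
  have abx : itv lt a b x by split; ol O.
  have abx' : itv lt a b x' by split; ol O.
  apply: contrapT => ne; have [xx|xx] : lt x x' \/ lt x' x by ol O.
    by move: (inc _ _ abx abx' xx); rewrite e; clear - O'; ol O'.
  by move: (inc _ _ abx' abx xx); rewrite e; clear - O'; ol O'.
have [y1 [uy1 y1v]] := om_dense O' uv; have [y2 [y12 y2v]] := om_dense O' y1v.
have [|x1 [abx1 fx1]] := uvX y1; first by split.
have [|x2 [abx2 fx2]] := uvX y2; first by split => //; clear - uy1 y12 O'; ol O'.
have x12 : lt x1 x2 by apply: refl => //; rewrite fx1 fx2.
exists x1, x2; split; first by case: abx1 abx2 => ? ? [? ?]; split; [|split]; ol O.
move=> x [x1x xx2] u' v' u'x xv'.
have abx : itv lt a b x by case: abx1 abx2 => ? ? [? ?]; split; ol O.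
have fx1x : lt' y1 (f x) by rewrite -fx1; apply: inc.
have fxx2 : lt' (f x) y2 by rewrite -fx2; apply: inc.
have [l [abl [ul lx]]] : exists l, itv lt a b l /\ ~ lt' (f l) u' /\ lt' (f l) (f x).
  case: (pselect (lt' y1 u')) => h; last by exists x1; rewrite fx1.
  have [|l [? fl]] := uvX u'.
    by split; clear - O' u'x fxx2 y2v h uy1; ol O'.
  by exists l; rewrite fl; split=> //; split=> //; clear - O'; ol O'.
have [r [abr [rv xr]]] : exists r, itv lt a b r /\ ~ lt' v' (f r) /\ lt' (f x) (f r).
  case: (pselect (lt' v' y2)) => h; last by exists x2; rewrite fx2.
  have [|r [? fr]] := uvX v'.
    by split; clear - O' xv' fx1x y2v h uy1; ol O'.
  by exists r; rewrite fr; split=> //; split=> //; clear - O'; ol O'.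
exists l, r; split; first exact: refl.
split; first exact: refl.
move=> s ls sr; have abs : itv lt a b s by case: abl abr => ? ? [? ?]; split; ol O.
have h1 := inc l s abl abs ls; have h2 := inc s r abs abr sr.
by split; clear - O' h1 h2 ul rv; ol O'.
Qed.

Lemma subitv_trans lt a b c d c' d' : lin_order lt ->
  subitv lt a b c d -> subitv lt c d c' d' -> subitv lt a b c' d'.
Proof. by move=> O [? [? ?]] [? [? ?]]; split; [|split]; lord. Qed.

Lemma subitv_itv lt a b c d x : lin_order lt ->
  subitv lt a b c d -> itv lt c d x -> itv lt a b x.
Proof. by move=> O [? [? ?]] [? ?]; split; lord. Qed.

(** On a subinterval where [f] is injective, [f] exceeds [f x] directly to the right of every [x] or
    of none, and likewise on the left. Of the four combinations, [no_locmin] excludes strict minima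
    and, with the target reversed, strict maxima; the other two are local increase and local
    decrease. *)
Lemma monotonicity lt lt' f a b : omin lt -> omin lt' -> F1 i i f f -> lt a b ->
  exists c d, subitv lt a b c d /\ (forall x, itv lt c d x -> cont lt lt' f x) /\
  [\/ forall x y, itv lt c d x -> itv lt c d y -> f x = f y,
      forall x, itv lt c d x -> locinc lt lt' f x
    | forall x, itv lt c d x -> locinc lt (fun x y => lt' y x) f x].
Proof.
move=> O O' df ab; have dlt := om_def O; have dlt' := om_def O'.
have [c [d [sub1 [cst|inj]]]] := const_or_inj O df ab.
  exists c, d; split=> //; split; last by constructor 1.
  move=> x cdx u v ux xv; case: (cdx) => cx xd; exists c, d; split=> //; split=> // s cs sd.
  by rewrite (cst s x).
have cd : lt c d by case: sub1 => _ [].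
pose RP x := exists r, lt x r /\ forall s, lt x s -> lt s r -> lt' (f x) (f s).
pose LP x := exists l, lt l x /\ forall s, lt l s -> lt s x -> lt' (f x) (f s).
have dRP : D1 i i RP RP by rewrite /D1 /RP; dfb.
have dLP : D1 i i LP LP by rewrite /D1 /LP; dfb.
have lt'C x y : itv lt c d x -> itv lt c d y -> x <> y -> ~ lt' (f x) (f y) -> lt' (f y) (f x).
  move=> hx hy xy nxy; have ne : f x <> f y by move/inj => /(_ hx hy).
  by clear - ne nxy O'; ol O'.
have RN x : itv lt c d x -> ~ RP x ->
    exists r, lt x r /\ forall s, lt x s -> lt s r -> lt' (f s) (f x).
  move=> cdx nR; case: (cdx) => cx xd.
  have dS : D1 i i (fun s => lt' (f x) (f s)) (fun s => lt' (f x) (f s)).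
    by rewrite /D1; dfb.
  have [r [xr [rd [h|h]]]] := germ_right O dS xd.
    by case: nR; exists r; split=> // s xs sr; apply: h.
  exists r; split=> // s xs sr; apply: lt'C => //; first by split; ol O.
    by move=> e; rewrite -e in xs; ol O.
  by apply: h.
have LN x : itv lt c d x -> ~ LP x ->
    exists l, lt l x /\ forall s, lt l s -> lt s x -> lt' (f s) (f x).
  move=> cdx nR; case: (cdx) => cx xd.
  have dS : D1 i i (fun s => lt' (f x) (f s)) (fun s => lt' (f x) (f s)).
    by rewrite /D1; dfb.
  have [r [xr [rd [h|h]]]] := germ_left O dS cx.
    by case: nR; exists r; split=> // s xs sr; apply: h.
  exists r; split=> // s xs sr; apply: lt'C => //; first by split; ol O.
    by move=> e; rewrite -e in sr; ol O.
  by apply: h.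
have [e1 [ce1 [e1d hR]]] := germ_right O dRP cd.
have [e [ce [ee1 hL]]] := germ_right O dLP ce1.
have sub2 : subitv lt c d c e by split; [|split]; ol O.
have sub3 : subitv lt c e1 c e by split; [|split]; ol O.
have ine x : itv lt c e x -> itv lt c d x by apply: subitv_itv => //; case: O.
have ine1 x : itv lt c e x -> itv lt c e1 x by apply: subitv_itv => //; case: O.
have inj' : inj_on lt c e f by move=> x y /ine hx /ine hy; apply: inj.
have inc_case lt2 : omin lt2 -> (forall x, itv lt c e x -> locinc lt lt2 f x) ->
    exists c' d', subitv lt a b c' d' /\ (forall x, itv lt c' d' x -> cont lt lt2 f x) /\
    forall x, itv lt c' d' x -> locinc lt lt2 f x.
  move=> O2 hl; have [c' [d' [sub4 hc]]] := inc_cont O O2 df ce (locinc_inc O O2 df hl).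
  exists c', d'; split; last first.
    by split=> // x hx; apply: hl; apply: subitv_itv (om_lin O) sub4 hx.
  exact: subitv_trans (om_lin O) (subitv_trans (om_lin O) sub1 sub2) sub4.
case: hR => hR; case: hL => hL.
- exfalso; apply: (no_locmin O O' df ce inj') => x hx.
  have [r [xr hr]] := hR x (ine1 x hx); have [l [lx hl]] := hL x hx.
  exists l, r; split=> //; split=> // s ls sr sx.
  by case: (pselect (lt s x)) => ?; [apply: hl|apply: hr => //; ol O].
- have [|c' [d' [? [? ?]]]] := inc_case lt' O'.
    move=> x hx; have [r [xr hr]] := hR x (ine1 x hx).
    have [l [lx hl]] := LN x (ine x hx) (hL x hx).
    by exists l, r.
  by exists c', d'; split=> //; split=> //; constructor 2.
- have [|c' [d' [? [hc ?]]]] := inc_case _ (omin_flip O').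
    move=> x hx; have [r [xr hr]] := RN x (ine x hx) (hR x (ine1 x hx)).
    have [l [lx hl]] := hL x hx.
    by exists l, r.
  exists c', d'; split=> //; split; last by constructor 3.
  move=> x hx u v ux xv; have [l [r [? [? h]]]] := hc x hx v u xv ux.
  by exists l, r; split=> //; split=> // s ? ?; have [] := h s.
- exfalso; apply: (no_locmin O (omin_flip O') df ce inj') => x hx.
  have [r [xr hr]] := RN x (ine x hx) (hR x (ine1 x hx)).
  have [l [lx hl]] := LN x (ine x hx) (hL x hx).
  exists l, r; split=> //; split=> // s ls sr sx.
  by case: (pselect (lt s x)) => ?; [apply: hl|apply: hr => //; ol O].
Qed.
End Monotonicity.

(** * Definable choice *)

Section Choice.
Variables (L : signature) (M : structure L) (lt : M -> M -> Prop).
Let i : M -> M := @id M.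

(** Density and the absence of end points, witnessed by definable functions. [mid a b] is any point
    between the two and not necessarily the centre. *)
Record picks : Prop := Picks {
  pk_mid : exists mid, F2 i i mid mid /\
    forall a b, lt a b -> lt a (mid a b) /\ lt (mid a b) b;
  pk_up : exists up, F1 i i up up /\ forall a, lt a (up a);
  pk_down : exists dn, F1 i i dn dn /\ forall a, lt (dn a) a }.

Lemma dfun_of_rel (R : (nat -> M) -> M -> Prop) : E1 i i R R ->
  (forall v, exists y, R v y) -> (forall v y y', R v y -> R v y' -> y = y') ->
  exists t, tfun i i t t /\ forall v, R v (t v).
Proof.
move=> dR /choice[t ht] uni; exists t; split=> //.
apply: t_ext dR => v; (split=> [h|->]; [exact: uni h (ht _)|exact: ht]).
Qed.

Section Pick.
Hypothesis O : omin lt.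
Variables (mid : M -> M -> M) (up : M -> M) (o : M).
Hypotheses (dmid : F2 i i mid mid) (dup : F1 i i up up).
Hypotheses (midP : forall a b, lt a b -> lt a (mid a b) /\ lt (mid a b) b).
Hypothesis upP : forall a, lt a (up a).

(** The canonical element of the part of [X] from [o] upwards: its infimum [s] when that lies in
    [X]. Otherwise [X] contains an interval that starts at [s], and [mid] selects a point of the
    longest such interval, capped at [up s] so that the supremum [z] exists. *)
Definition pick (X : M -> Prop) (y : M) : Prop := exists s,
  is_inf lt (fun x => X x /\ ~ lt x o) s /\
  (X s /\ y = s \/
   ~ X s /\ exists z, is_sup lt (fun z => lt s z /\ ~ lt (up s) z /\
      forall t, lt s t -> lt t z -> X t) z /\ y = mid s z).

Lemma pick_uniq X y y' : pick X y -> pick X y' -> y = y'.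
Proof.
have infU S s s' : is_inf lt S s -> is_inf lt S s' -> s = s'.
  move=> [h1 h2] [h1' h2']; apply: contrapT => ne.
  have [h|h] : lt s s' \/ lt s' s by ol O.
    by have [x [/h1' ? ?]] := h2 _ h.
  by have [x [/h1 ? ?]] := h2' _ h.
have supU S s s' : is_sup lt S s -> is_sup lt S s' -> s = s'.
  move=> [h1 h2] [h1' h2']; apply: contrapT => ne.
  have [h|h] : lt s s' \/ lt s' s by ol O.
    by have [x [/h1 ? ?]] := h2' _ h.
  by have [x [/h1' ? ?]] := h2 _ h.
move=> [s [hs H]] [s' [hs' H']]; rewrite -(infU _ _ _ hs hs') in H'.
case: H H' => [[Xs ->]|[nXs [z [hz ->]]]] [[Xs' ->]|[nXs' [z' [hz' ->]]]] //.
by rewrite (supU _ _ _ hz hz').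
Qed.

Lemma pick_exists X : D1 i i X X -> (exists x, X x /\ ~ lt x o) ->
  exists y, X y /\ pick X y.
Proof.
move=> dX ne; have dlt := om_def O.
have dS : D1 i i (fun x => X x /\ ~ lt x o) (fun x => X x /\ ~ lt x o).
  by rewrite /D1; dfb.
have [s hs] := om_inf O dS ne (ex_intro _ o (fun x h => proj2 h)).
case: (pselect (X s)) => Xs.
  by exists s; split=> //; exists s; split=> //; left.
pose Z z := lt s z /\ ~ lt (up s) z /\ forall t, lt s t -> lt t z -> X t.
have dZ : D1 i i Z Z by rewrite /D1 /Z; dfb.
have us := upP s.
have [c [sc [cu hc]]] := germ_right O dX us.
have Zc : Z c.
  split=> //; split; first by ol O.
  case: hc => hc t st tc; first exact: hc.
  exfalso; have [x [[Xx xo] xc]] := proj2 hs c sc.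
  have sx := proj1 hs x (conj Xx xo).
  by case: (pselect (x = s)) => [e|ne']; [rewrite e in Xx|
    apply: (hc x) => //; split=> //; ol O].
have [z hz] := om_sup O dZ (ex_intro _ c Zc)
  ltac:(by exists (up s) => z0 [_ []]).
have cz := proj1 hz _ Zc.
have [sm mz] := midP (a := s) (b := z) ltac:(ol O).
exists (mid s z); split; last by exists s; split=> //; right; split=> //; exists z.
by have [w [[_ [_ hw]] mw]] := proj2 hz _ mz; apply: hw.
Qed.
End Pick.
End Choice.

(** [pick] handles the fibres with a point from [o] upwards; the reversed order, with [mid] and [up]
    replaced accordingly, handles the other nonempty ones; an empty fibre gets the value [o]. *)
Lemma definable_choice (L : signature) (M : structure L) (lt : M -> M -> Prop)
    (R : (nat -> M) -> M -> Prop) : omin lt -> picks lt -> M ->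
  E1 (@id M) (@id M) R R ->
  exists t, tfun (@id M) (@id M) t t /\ forall v y, R v y -> R v (t v).
Proof.
pose i := @id M; move=> O [[mid [dmid midP]] [up [dup upP]] [dn [ddn dnP]]] o dR.
have dlt := om_def O; have O' := omin_flip O.
pose mid' a b := mid b a.
have dmid' : F2 i i mid' mid' by rewrite /F2 /mid'; dfb.
have dRv v : D1 i i (R v) (R v).
  apply: (t_eapp1 (s := fun k _ => v k) _ _ dR); dfb.
pose gt := fun x y => lt y x.
pose pos v := exists x, R v x /\ ~ lt x o.
pose neg v := exists x, R v x /\ ~ gt x o.
pose G v y := (pos v /\ pick lt mid up o (R v) y) \/
  (~ pos v /\ ((neg v /\ pick gt mid' dn o (R v) y) \/ ~ neg v /\ y = o)).
have midP' a b : gt a b -> gt a (mid' a b) /\ gt (mid' a b) b.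
  by move=> /midP [? ?].
have exG v : exists y, G v y /\ ((exists x, R v x) -> R v y).
  case: (pselect (pos v)) => hp.
    by have [y [? ?]] := pick_exists O midP upP (dRv v) hp; exists y; split=> //; left.
  case: (pselect (neg v)) => hn.
    have [y [? ?]] := pick_exists O' midP' dnP (dRv v) hn.
    by exists y; split=> //; right; split=> //; left.
  exists o; split; first by right; split=> //; right.
  case=> x Rx; case: (pselect (lt x o)) => xo; last by case: hp; exists x.
  by case: hn; exists x; split=> // ox; rewrite /gt in ox; ol O.
have uniG v y y' : G v y -> G v y' -> y = y'.
  case=> [[h1 p1]|[h1 [[h2 p1]|[h2 ->]]]] [[h1' p1']|[h1' [[h2' p1']|[h2' ->]]]] //.
    exact: pick_uniq p1 p1'.
  exact: (pick_uniq O' p1 p1').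
have dG : E1 i i G G.
  by rewrite /E1 /G /pos /neg /pick /is_inf /is_sup /gt; dfb.
have [t [dt tG]] := dfun_of_rel dG (fun v => let: ex_intro y h := exG v in
  ex_intro _ y (proj1 h)) uniG.
exists t; split=> // v y Ry; have [y' [Gy' h]] := exG v.
by rewrite (uniG _ _ _ (tG v) Gy'); apply: h; exists y.
Qed.

(** * Uniform finiteness *)

Section Locally.
Variables (L : signature) (M : structure L) (lt : M -> M -> Prop).
Hypothesis O : omin lt.

Lemma locally_itv a b x : itv lt a b x -> locally lt x (itv lt a b).
Proof. by case=> ax xb; exists a, b. Qed.

Lemma locally_not_bd (S : M -> Prop) x : locally lt x (fun y => S y <-> S x) -> ~ bd lt S x.
Proof.
move=> [l [r [lx [xr h]]]] /(_ l r lx xr) [u [v [[? ?] [[? ?] [Su Sv]]]]].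
by apply: Sv; apply: (iffRL (h v _ _)) => //; apply: (iffLR (h u _ _)).
Qed.

Lemma contL f x u : cont lt lt f x -> lt u (f x) -> locally lt x (fun y => lt u (f y)).
Proof.
move=> c ux; have [v xv] := om_up O (f x).
by apply: locally_imp (c u v ux xv) => y [].
Qed.

Lemma contR f x v : cont lt lt f x -> lt (f x) v -> locally lt x (fun y => lt (f y) v).
Proof.
move=> c xv; have [u ux] := om_down O (f x).
by apply: locally_imp (c u v ux xv) => y [].
Qed.

Lemma cont_on_sub f a b : F1 (@id M) (@id M) f f -> lt a b ->
  exists c d, subitv lt a b c d /\ forall x, itv lt c d x -> cont lt lt f x.
Proof.
by move=> df ab; have [c [d [? [? _]]]] := monotonicity O O df ab; exists c, d.
Qed.

Lemma germ_sub S a b : D1 (@id M) (@id M) S S -> lt a b -> exists c d,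
  subitv lt a b c d /\
  ((forall x, itv lt c d x -> S x) \/ (forall x, itv lt c d x -> ~ S x)).
Proof.
move=> dS ab; have [c [ac [cb h]]] := germ_right O dS ab.
by exists a, c; split=> //; split; [|split]; ol O.
Qed.

Lemma fin_no_itvT S : D1 (@id M) (@id M) S S ->
  (forall c d, lt c d -> exists x, itv lt c d x /\ ~ S x) -> fin S.
Proof.
move=> dS h; apply: fin_sub (om_bd O dS) => t St.
apply: contrapT => /not_bd_itv [l [r [lt' [tr hS]]]].
have [|x [xx nS]] := h l r; first by ol O.
by apply: nS; apply/hS.
Qed.
End Locally.

Lemma definable_choice1 (L : signature) (M : structure L) (lt : M -> M -> Prop)
    (R : M -> M -> Prop) : omin lt -> picks lt -> M ->
  D2 (@id M) (@id M) R R ->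
  exists f, F1 (@id M) (@id M) f f /\ forall x y, R x y -> R x (f x).
Proof.
move=> O K o dR.
have [|t [dt ht]] := @definable_choice L M lt (fun v y => R (v 0) y) O K o.
  by rewrite /E1; dfb.
exists (fun x => t (fun=> x)); split; last by move=> x y /(ht (fun=> x)).
by apply: (tfun_app0 (s := fun _ v => v 0) (s' := fun _ v => v 0) dt); dfb.
Qed.

Section UniformFiniteness.
Variables (L : signature) (M : structure L) (lt : M -> M -> Prop).
Hypotheses (O : omin lt) (K : picks lt).
(** [near e] stands for distance less than [e]. Besides the choice functions, the two properties
    that follow are the only trace of the group in uniform finiteness. *)
Variables (o : M) (near : M -> M -> M -> Prop).
Let i : M -> M := @id M.
Hypothesis dnear : D3 i i near near.
Hypothesis near_loc : forall e b, lt o e -> locally lt b (near e b).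
Hypothesis near_sep : forall u v, lt u v -> exists e0, lt o e0 /\
  forall e, lt o e -> ~ lt e0 e -> forall b b', ~ lt u b -> ~ lt b' v ->
  ~ near e b b' /\ ~ near e b' b.

(** The relation [near e], restricted to the two sets, is the graph of a bijection. Being first
    order, this can stand for equality of cardinalities. *)
Definition matched e (X X' : M -> Prop) : Prop :=
  ((forall b, X b -> exists b', X' b' /\ near e b b') /\
   (forall b', X' b' -> exists b, X b /\ near e b b')) /\
  ((forall b b1 b2, X b -> X' b1 -> X' b2 -> near e b b1 -> near e b b2 -> b1 = b2) /\
   (forall b' b1 b2, X' b' -> X b1 -> X b2 -> near e b1 b' -> near e b2 b' -> b1 = b2)).

Lemma matched_ext e X X' Y Y' : (forall b, X b <-> Y b) -> (forall b, X' b <-> Y' b) ->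
  matched e X X' -> matched e Y Y'.
Proof.
move=> h h'; have -> : Y = X by apply: funext => b; apply/propext; split=> /h.
by have -> : Y' = X' by apply: funext => b; apply/propext; split=> /h'.
Qed.

Lemma matched_add e (X X' : M -> Prop) p p' : matched e X X' -> near e p p' ->
  (forall b, X b -> ~ near e b p') -> (forall b', X' b' -> ~ near e p b') ->
  matched e (fun b => X b \/ b = p) (fun b => X' b \/ b = p').
Proof.
move=> [[m1 m2] [m3 m4]] pp h1 h2; split; split.
- move=> b [/m1 [b' [? ?]]|->]; first by exists b'; split=> //; left.
  by exists p'; split=> //; right.
- move=> b [/m2 [b' [? ?]]|->]; first by exists b'; split=> //; left.
  by exists p; split=> //; right.
- by move=> b b1 b2 [Xb|->] [Xb1|->] [Xb2|->] // n1 n2; try exact: (m3 b);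
    solve [case: (h1 _ Xb) => // | case: (h2 _ Xb1) => // | case: (h2 _ Xb2) => //].
- by move=> b b1 b2 [Xb|->] [Xb1|->] [Xb2|->] // n1 n2; try exact: (m4 b);
    solve [case: (h2 _ Xb) => // | case: (h1 _ Xb1) => // | case: (h1 _ Xb2) => //].
Qed.

Lemma matched_atm e X X' n : matched e X X' -> atm n X <-> atm n X'.
Proof.
move=> [[m1 m2] [m3 m4]]; split.
  by apply: (atm_transport (R := near e)) => // b b1 b2 *; apply: (m3 b).
by apply: (atm_transport (R := fun b b' => near e b' b)) => // b b1 b2 *; apply: (m4 b).
Qed.

(* Near x, the fibre of A varies by small displacements of its points only. *)
Definition good (A : M -> M -> Prop) (x : M) : Prop := exists e0, lt o e0 /\
  forall e, lt o e -> ~ lt e0 e -> locally lt x (fun x' => matched e (A x) (A x')).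

Definition below (A : M -> M -> Prop) (u x b : M) : Prop := A x b /\ lt b u.

(** The fibre cut off just above [b] is good, which allows the points of a fibre to be treated one
    at a time from below. *)
Definition well (A : M -> M -> Prop) (x b : M) : Prop := exists u0, lt b u0 /\
  forall u, lt b u -> lt u u0 -> good (below A u) x.

Lemma good_atm A x : good A x ->
  locally lt x (fun x' => forall n, atm n (A x') <-> atm n (A x)).
Proof.
move=> [e0 [pe he]]; apply: locally_imp (he e0 pe _) => [y m n|].
  by rewrite (matched_atm _ m).
by ol O.
Qed.

(** Cut off just above [beta], the fibre consists of the fibre cut off just above the predecessor
    and of [beta] itself. The first part is matched because the predecessor is [well], the pair
    formed by [beta x] and [beta y] is added by continuity, and separation keeps the two from
    interfering. *)
Lemma well_at_least (A : M -> M -> Prop) (beta pred succ : M -> M) x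
    (J : M -> Prop) (hasP hasS : Prop) :
  locally lt x J -> J x ->
  cont lt lt beta x -> cont lt lt pred x -> cont lt lt succ x ->
  (forall y, J y -> A y (beta y)) ->
  (hasP -> well A x (pred x) /\ forall y, J y -> lt (pred y) (beta y) /\ A y (pred y)) ->
  (forall y, J y -> forall b, A y b -> lt b (beta y) -> hasP /\ ~ lt (pred y) b) ->
  (hasS -> lt (beta x) (succ x)) ->
  (forall y, J y -> forall b, A y b -> lt (beta y) b -> hasS /\ ~ lt b (succ y)) ->
  well A x (beta x).
Proof.
move=> JJ Jx cb cp cs Ab hP hP' hS hS'.
(* Cutting before the next point of the fibre, if there is one, leaves [beta] as the last point;
   continuity of [succ] keeps this true nearby. *)
have [u0 [bu0 hu0]] : exists u0, lt (beta x) u0 /\ (hasS -> u0 = succ x).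
  case: (pselect hasS) => h; first by exists (succ x); split=> //; apply: hS.
  by have [u0 ?] := om_up O (beta x); exists u0.
exists u0; split=> // u bu uu0.
have split_below (X : M -> M -> Prop) : locally lt x (fun y => forall b,
      A y b -> lt b (beta y) -> X y b) ->
    locally lt x (fun y => forall b, X y b -> A y b /\ lt b (beta y)) ->
    locally lt x (fun y => forall b, below A u y b <-> (X y b \/ b = beta y)).
  move=> h1 h2.
  have h3 : locally lt x (fun y => hasS -> lt u (succ y)).
    case: (pselect hasS) => h; last by apply: locally_imp JJ.
    by rewrite (hu0 h) in uu0; apply: locally_imp (contL O cs uu0).
  have h4 := contR O cb bu.
  apply: locally_imp (locally_and (om_lin O) (locally_and (om_lin O) h1 h2)
    (locally_and (om_lin O) JJ (locally_and (om_lin O) h3 h4))) => y [[k1 k2] [Jy [k3 k4]]] b.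
  split=> [[Ayb bu']|[Xyb|->]].
  - case: (pselect (b = beta y)) => [->|ne]; first by right.
    case: (pselect (lt b (beta y))) => bb; first by left; apply: k1.
    have bb' : lt (beta y) b by ol O.
    have [hs sb] := hS' y Jy b Ayb bb'; have := k3 hs; clear - O sb bu'.
    by move=> us; exfalso; ol O.
  - by have [? ?] := k2 b Xyb; split=> //; ol O.
  - by split=> //; apply: Ab.
have here (P : M -> Prop) : locally lt x P -> P x.
  by move=> [l [r [? [? h]]]]; apply: h.
case: (pselect hasP) => hp; last first.
  have hX : locally lt x (fun y => forall b, below A u y b <-> (False \/ b = beta y)).
    apply: (split_below (fun _ _ => False)); last by apply: locally_imp JJ.
    by apply: locally_imp JJ => y Jy b Ayb bb; apply: hp; case: (hP' y Jy b).
  have [e0 oe0] := om_up O o; exists e0; split=> // e oe ee0.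
  have hx := here _ hX; have [l [r [lb [br hn]]]] := near_loc (beta x) oe.
  apply: locally_imp (locally_and (om_lin O) hX (locally_and (om_lin O) (contL O cb lb) (contR O cb br))).
  move=> y [hy [? ?]]; apply: (@matched_ext _ (fun b => False \/ b = beta x)
    (fun b => False \/ b = beta y)); try by move=> b; symmetry.
  by apply: matched_add => //; apply: hn.
have [[u1 [pu1 wu1]] hP1] := hP hp.
have pb : lt (pred x) (beta x) by have [] := hP1 x Jx.
have [u2 [pu2 [u2b u2u]]] : exists u2, lt (pred x) u2 /\ lt u2 (beta x) /\ lt u2 u1.
  case: (pselect (lt u1 (beta x))) => ?.
    by have [y [? ?]] := om_dense O pu1; exists y; ol O.
  by have [y [? ?]] := om_dense O pb; exists y; ol O.
have [v [u2v vb]] := om_dense O u2b.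
have hX : locally lt x (fun y => forall b, below A u y b <->
    (below A u2 y b \/ b = beta y)).
  apply: split_below.
    apply: locally_imp (locally_and (om_lin O) (contR O cp pu2) JJ) => y [py Jy] b Ayb bb.
    have [_ ?] := hP' y Jy b Ayb bb; split=> //; clear bb; ol O.
  apply: locally_imp (contL O cb u2b) => y u2y b [Ayb bu2]; split=> //; ol O.
have hx := here _ hX.
have [e0 [pe0 he0]] := wu1 u2 pu2 u2u.
(* Below this tolerance no point under [u2] is near a point above [v], so [beta] cannot be matched
   with an earlier point of a fibre. *)
have [e1 [pe1 he1]] := near_sep u2v.
have [e2 [pe2 [e20 e21]]] : exists e2, lt o e2 /\ ~ lt e0 e2 /\ ~ lt e1 e2.
  by case: (pselect (lt e0 e1)) => ?; [exists e0|exists e1]; ol O.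
exists e2; split=> // e oe ee2.
have [l [r [lb [br hn]]]] := near_loc (beta x) oe.
have ee0 : ~ lt e0 e by ol O.
have ee1 : ~ lt e1 e by ol O.
apply: locally_imp (locally_and (om_lin O) (locally_and (om_lin O) hX (he0 e oe ee0))
  (locally_and (om_lin O) (contL O cb vb) (locally_and (om_lin O) (contL O cb lb) (contR O cb br)))).
move=> y [[hy my] [vy [ly yr]]].
apply: (@matched_ext _ (fun b => below A u2 x b \/ b = beta x)
  (fun b => below A u2 y b \/ b = beta y)); try by move=> b; symmetry.
apply: matched_add => //; first exact: hn.
  move=> b [_ bu2]; apply: (proj1 (he1 e oe ee1 b (beta y) _ _)); clear - O bu2 vy; ol O.
move=> b [_ bu2]; apply: (proj2 (he1 e oe ee1 b (beta x) _ _)); clear - O bu2 vb; ol O.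
Qed.

(* Otherwise the least point of the fibre that is not [well] and its neighbours
   in the fibre depend continuously on x in some subinterval. *)
Lemma good_dense (A : M -> M -> Prop) a b : D2 i i A A -> (forall x, fin (A x)) ->
  lt a b -> exists x, itv lt a b x /\ good A x.
Proof.
move=> dA fA ab; have dlt := om_def O; have Ol := om_lin O.
have dW : D2 i i (well A) (well A).
  by rewrite /D2 /well /good /locally /below /matched; dfb.
pose bad x b := A x b /\ ~ well A x b.
have dS : D1 i i (fun x => exists b, bad x b) (fun x => exists b, bad x b).
  by rewrite /D1 /bad; dfb.
(* After shrinking, bad points exist over every [x] or over none; the second case comes first. *)
have [a1 [b1 [s1 [hbad|hbad]]]] := germ_sub O dS ab; last first.
  have ab1 : lt a1 b1 by case: s1 => _ [].
  have dN : D1 i i (fun x => exists b, A x b) (fun x => exists b, A x b).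
    by rewrite /D1; dfb.
  have [a2 [b2 [s2 hne]]] := germ_sub O dN ab1.
  have ab2 : lt a2 b2 by case: s2 => _ [].
  case: hne => hne; last first.
    have [x [ax xb]] := om_dense O ab2; exists x; split.
      by apply: subitv_itv s1 _ => //; apply: subitv_itv s2 _.
    have [e0 oe0] := om_up O o; exists e0; split=> // e _ _.
    apply: locally_imp (locally_itv (conj ax xb)) => y hy.
    have nx := hne x (conj ax xb); have ny := hne y hy.
    by split; split=> // ? ?; solve [case: nx; eexists; eassumption
      | case: ny; eexists; eassumption | move=> *; case: nx; eexists; eassumption
      | move=> *; case: ny; eexists; eassumption].
  (* Without bad points the largest point of the fibre is [well], and a cut just above it removes
     nothing from the fibres near [x]. *)
  pose isT x c := A x c /\ forall c', A x c' -> ~ lt c c'.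
  have dT : D2 i i isT isT by rewrite /D2 /isT; dfb.
  have [top [dtop htop]] := definable_choice1 O K o dT.
  have [a3 [b3 [s3 hc]]] := cont_on_sub O dtop ab2.
  have ab3 : lt a3 b3 by case: s3 => _ [].
  have [x [ax xb]] := om_dense O ab3.
  have in2 y : itv lt a3 b3 y -> itv lt a2 b2 y by apply: subitv_itv.
  have topP y : itv lt a3 b3 y -> isT y (top y).
    move=> /in2 /hne ne; have [m hm] := fin_min (om_lin (omin_flip O)) (fA y) ne.
    exact: (htop y m hm).
  have x3 : itv lt a3 b3 x by [].
  have [Axt tx] := topP x x3.
  exists x; split; first by apply: subitv_itv s1 _ => //; apply: subitv_itv s2 _ => //; apply: in2.
  have wx : well A x (top x).
    apply: contrapT => nw; apply: (hbad x); last by exists (top x).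
    by apply: subitv_itv s2 _ => //; apply: in2.
  have [u0 [tu0 hu0]] := wx; have [u [tu uu0]] := om_dense O tu0.
  have hA y : itv lt a3 b3 y -> lt (top y) u -> forall c, below A u y c <-> A y c.
    move=> /topP [_ ty] yu c; split=> [[]|Ayc] //; split=> //.
    by have := ty c Ayc; clear - O yu => h; ol O.
  have [e0 [pe0 he0]] := hu0 u tu uu0; exists e0; split=> // e oe ee0.
  apply: locally_imp (locally_and (om_lin O) (he0 e oe ee0) (locally_and (om_lin O) (locally_itv x3)
    (contR O (hc x x3) tu))) => y [my [y3 yu]].
  by apply: matched_ext my; apply: hA.
exfalso.
have ab1 : lt a1 b1 by case: s1 => _ [].
pose isB x c := bad x c /\ forall c', bad x c' -> ~ lt c' c.
have dB : D2 i i isB isB by rewrite /D2 /isB /bad; dfb.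
have [beta [dbeta hbeta]] := definable_choice1 O K o dB.
pose isP x c := (A x c /\ lt c (beta x)) /\ forall c', A x c' /\ lt c' (beta x) -> ~ lt c c'.
have dP : D2 i i isP isP by rewrite /D2 /isP; dfb.
have [pred [dpred hpred]] := definable_choice1 O K o dP.
pose isS x c := (A x c /\ lt (beta x) c) /\ forall c', A x c' /\ lt (beta x) c' -> ~ lt c' c.
have dS' : D2 i i isS isS by rewrite /D2 /isS; dfb.
have [succ [dsucc hsucc]] := definable_choice1 O K o dS'.
have [a2 [b2 [s2 cb]]] := cont_on_sub O dbeta ab1.
have ab2 : lt a2 b2 by case: s2 => _ [].
have [a3 [b3 [s3 cp]]] := cont_on_sub O dpred ab2.
have ab3 : lt a3 b3 by case: s3 => _ [].
have [a4 [b4 [s4 cs]]] := cont_on_sub O dsucc ab3.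
have ab4 : lt a4 b4 by case: s4 => _ [].
(* Whether a predecessor exists, and then whether a successor does, is made constant on a
   subinterval; the propositions [hasP] and [hasS] taken at [x] then speak for all nearby points. *)
have dhP : D1 i i (fun x => exists c, A x c /\ lt c (beta x))
  (fun x => exists c, A x c /\ lt c (beta x)) by rewrite /D1; dfb.
have [a5 [b5 [s5 hp]]] := germ_sub O dhP ab4.
have ab5 : lt a5 b5 by case: s5 => _ [].
have dhS : D1 i i (fun x => exists c, A x c /\ lt (beta x) c)
  (fun x => exists c, A x c /\ lt (beta x) c) by rewrite /D1; dfb.
have [a6 [b6 [s6 hs]]] := germ_sub O dhS ab5.
have ab6 : lt a6 b6 by case: s6 => _ [].
have [x [ax xb]] := om_dense O ab6; have x6 : itv lt a6 b6 x by [].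
have in5 y : itv lt a6 b6 y -> itv lt a5 b5 y by apply: subitv_itv.
have in4 y : itv lt a6 b6 y -> itv lt a4 b4 y by move/in5; apply: subitv_itv.
have in3 y : itv lt a6 b6 y -> itv lt a3 b3 y by move/in4; apply: subitv_itv.
have in2 y : itv lt a6 b6 y -> itv lt a2 b2 y by move/in3; apply: subitv_itv.
have in1 y : itv lt a6 b6 y -> itv lt a1 b1 y by move/in2; apply: subitv_itv.
have betaP y : itv lt a6 b6 y -> isB y (beta y).
  move=> /in1 /hbad ne; have [|m hm] := fin_min Ol _ ne; last exact: (hbeta y m hm).
  by apply: fin_sub (fA y) => t [].
have predP y c : A y c -> lt c (beta y) -> isP y (pred y).
  move=> Ayc cb'; have [||m hm] := @fin_min _ _ (fun c => A y c /\ lt c (beta y)) (om_lin (omin_flip O)).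
  - by apply: fin_sub (fA y) => t [].
  - by exists c.
  - exact: (hpred y m hm).
have succP y c : A y c -> lt (beta y) c -> isS y (succ y).
  move=> Ayc cb'; have [||m hm] := @fin_min _ _ (fun c => A y c /\ lt (beta y) c) Ol.
  - by apply: fin_sub (fA y) => t [].
  - by exists c.
  - exact: (hsucc y m hm).
have [[Axb nw] least] := betaP x x6; apply: nw.
apply: (@well_at_least A beta pred succ x (itv lt a6 b6)
  (exists c, A x c /\ lt c (beta x)) (exists c, A x c /\ lt (beta x) c)).
- exact: locally_itv.
- by [].
- by apply: cb; apply: in2.
- by apply: cp; apply: in3.
- by apply: cs; apply: in4.
- by move=> y /betaP [[]].
- move=> [c [Axc cb']]; have [[Axp pb] _] := predP x c Axc cb'; split.
    by apply: contrapT => nw; apply: (least (pred x)).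
  move=> y y6; case: hp => hp; last by case: (hp x (in5 x x6)); exists c.
  have [c1 [Ayc1 cb1]] := hp y (in5 y y6).
  by have [[? ?] _] := predP y c1 Ayc1 cb1.
- move=> y y6 c Ayc cb'; split; last by have [_ h] := predP y c Ayc cb'; apply: h.
  case: hp => hp; first exact: hp x (in5 x x6).
  by case: (hp y (in5 y y6)); exists c.
- by move=> [c [Axc cb']]; have [[]] := succP x c Axc cb'.
- move=> y y6 c Ayc cb'; split; last by have [_ h] := succP y c Ayc cb'; apply: h.
  case: hs => hs; first exact: hs x x6.
  by case: (hs y y6); exists c.
Qed.

Lemma good_const (A : M -> M -> Prop) n x y : D2 i i A A -> ~ lt y x ->
  (forall t, ~ lt t x -> ~ lt y t -> good A t) -> atm n (A x) <-> atm n (A y).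
Proof.
move=> dA xy hg; apply: (connect O (S := fun x => atm n (A x))) => //.
  by rewrite /D1; dfb.
move=> t tx yt; apply: locally_not_bd; apply: locally_imp (good_atm (hg t tx yt)).
by move=> u.
Qed.

(** A choice function may use every parameter; resetting those from [k] on to [o] makes it depend on
    the first [k] alone, as the induction on [k] requires. *)
Definition trunc k (z : nat -> M) : nat -> M := fun j => if j < k then z j else o.

(** Split off one parameter [x]. For fixed other parameters [z] the set [B z] of [x] with a fibre
    that is not good is finite by [good_dense], hence uniformly bounded by induction. Between
    consecutive points of [B z] the size of the fibre is constant, so it is enough to bound it at
    definably chosen sample points. *)
Lemma uniform_bound_aux k (D : (nat -> M) -> M -> Prop) : E1 i i D D ->
  (forall z z', (forall j, j < k -> z j = z' j) -> D z = D z') ->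
  (forall z, fin (D z)) -> exists n, forall z, atm n (D z).
Proof.
have dlt := om_def O.
elim: k D => [|k IH] D dD kD fD.
  have [n hn] := fD (fun=> o); exists n => z.
  by rewrite (kD z (fun=> o)).
pose A z x := D (scons x z).
have kA z z' : (forall j, j < k -> z j = z' j) -> A z = A z'.
  move=> h; apply: funext => x; apply: kD => -[|j] //= jk; exact: h.
have dA : E2 i i A A.
  by apply: (t_eapp1 (s := fun j v => scons (v 0) (fun k => v k.+2) j) _ _ dD);
    [case=> [|j] /=|]; dfb.
have dAz z : D2 i i (A z) (A z).
  by apply: (t_eapp2 (s := fun k _ => z k) _ _ _ dA); dfb.
pose B z x := ~ good (A z) x.
have dB : E1 i i B B.
  by rewrite /E1 /B /good /locally /matched; dfb.
have dBz z : D1 i i (B z) (B z).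
  by apply: (t_eapp1 (s := fun k _ => z k) _ _ dB); dfb.
have [||N hN] := IH B dB.
- by move=> z z' h; rewrite /B (kA z z' h).
- move=> z; apply: (fin_no_itvT O (dBz z)) => c d cd.
  have [x [cdx gx]] := good_dense (dAz z) (fun x => fD _) cd.
  by exists x; split=> // -[].
(* Along a definable section [x = w z] only [k] parameters are left, so the induction hypothesis
   applies. *)
have point w : tfun i i w w -> (forall z z', (forall j, j < k -> z j = z' j) -> w z = w z') ->
    exists n, forall z, atm n (A z (w z)).
  move=> dw kw; apply: (IH (fun z => A z (w z))).
  - rewrite /E1; apply: (t_eapp2 (s := fun k v => v k.+1) (t := fun v => w (fun k => v k.+1)) (u := fun v => v 0) _ _ _ dA); dfb.
  - by move=> z z' h; rewrite (kA z z' h) (kw z z' h).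
  - by move=> z; apply: fD.
have choose (R : (nat -> M) -> M -> Prop) : E1 i i R R ->
    (forall z z', (forall j, j < k -> z j = z' j) -> R z = R z') ->
    exists w, tfun i i w w /\ (forall z y, R z y -> R z (w z)) /\
      (forall z z', (forall j, j < k -> z j = z' j) -> w z = w z').
  move=> dR kR; have [w [dw hw]] := definable_choice O K o dR.
  exists (fun z => w (trunc k z)); split; last split.
  - apply: (tfun_app0 (s := fun j z => trunc k z j) (s' := fun j z => trunc k z j) dw).
    by move=> j; rewrite /trunc; case: (j < k); dfb.
  - move=> z y; have -> : R z = R (trunc k z) by apply: kR => j jk; rewrite /trunc jk.
    exact: hw.
  - move=> z z' h; congr w; apply: funext => j; rewrite /trunc; case: ifP => //; exact: h.
(* Induction on the number of bad points in a convex family [J]: with none, one sample point of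
   [J z] determines the size; otherwise a bad point [w z] is chosen and the parts on either side of
   it contain fewer. *)
have main j (J : (nat -> M) -> M -> Prop) : E1 i i J J ->
    (forall z z', (forall j, j < k -> z j = z' j) -> J z = J z') ->
    (forall z x y t, J z x -> J z y -> ~ lt t x -> ~ lt y t -> J z t) ->
    (forall z, atm j (fun x => B z x /\ J z x)) ->
    exists n, forall z x, J z x -> atm n (A z x).
  elim: j J => [|j IHj] J dJ kJ cJ hJ.
    have [w [dw [hw kw]]] := choose J dJ kJ; have [n hn] := point w dw kw.
    exists n => z x Jx; have Jw := hw z x Jx.
    have gd t : J z t -> good (A z) t.
      by move=> Jt; apply: contrapT => nt; apply: (hJ z t).
    case: (pselect (lt x (w z))) => xw.
      apply: (iffRL (@good_const (A z) n x (w z) (dAz z) _ _)) => //; first by ol O.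
      by move=> t tx tw; apply: gd; apply: (cJ z x (w z)).
    apply: (iffLR (@good_const (A z) n (w z) x (dAz z) xw _)) => //.
    by move=> t tx tw; apply: gd; apply: (cJ z (w z) x).
  have [||w [dw [hw kw]]] := choose (fun z x => B z x /\ J z x).
  - by rewrite /E1; dfb.
  - by move=> z z' h; apply: funext => x; rewrite (kJ z z' h) /B (kA z z' h).
  have [n hn] := point w dw kw.
  have rest z (P : M -> Prop) : ~ P (w z) -> atm j (fun x => B z x /\ J z x /\ P x).
    move=> nP; case: (pselect (exists x, B z x /\ J z x)) => [[x0 /hw Bw]|ne].
      by apply: atm_sub (hJ z (w z) Bw) => x [? [? Px]]; split=> // e; apply: nP; rewrite -e.
    by apply: atm0 => x [? [? _]]; apply: ne; exists x.
  have [||||n1 hn1] := IHj (fun z x => J z x /\ lt x (w z)).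
  - by rewrite /E1; dfb.
  - by move=> z z' h; apply: funext => x; rewrite (kJ z z' h) (kw z z' h).
  - by move=> z x y t [Jx xw] [Jy yw] tx yt; split; [apply: (cJ z x y)|ol O].
  - by move=> z; apply: (rest z (fun x => lt x (w z))); ol O.
  have [||||n2 hn2] := IHj (fun z x => J z x /\ lt (w z) x).
  - by rewrite /E1; dfb.
  - by move=> z z' h; apply: funext => x; rewrite (kJ z z' h) (kw z z' h).
  - by move=> z x y t [Jx xw] [Jy yw] tx yt; split; [apply: (cJ z x y)|ol O].
  - by move=> z; apply: (rest z (fun x => lt (w z) x)); ol O.
  exists (n + n1 + n2) => z x Jx.
  case: (pselect (lt x (w z))) => xw; first by apply: atmW (hn1 z x _) => //; lia.
  case: (pselect (lt (w z) x)) => wx; first by apply: atmW (hn2 z x _) => //; lia.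
  have -> : x = w z by ol O.
  by apply: atmW (hn z); lia.
have [||||n hn] := main N (fun _ _ => True).
- by rewrite /E1; dfb.
- by [].
- by [].
- by move=> z; apply: atm_sub (hN z) => t [].
exists n => z; rewrite (kD z (scons (z 0) (fun j => z j.+1))); first exact: hn.
by case.
Qed.

(** The support of the defining formula bounds the number of parameters on which the fibres
    depend. *)
Lemma uniform_bound (D : (nat -> M) -> M -> Prop) : E1 i i D D ->
  (forall z, fin (D z)) -> exists n, forall z, atm n (D z).
Proof.
move=> dD; have [phi [h _]] := dD; have [k [l supp]] := fm_support phi.
have DE z t : D z t <-> fsat i phi (scons t z) by rewrite -h.
apply: (@uniform_bound_aux k) => // z z' zz; apply: funext => t; apply/propext.
rewrite !DE; apply: supp; split=> // -[|j] //= jk; apply: zz; lia.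
Qed.
End UniformFiniteness.

(** * Ordered groups with a chart of (0,1) *)

Section Groups.
Variables (L : signature) (M : structure (og_expansion L)).
Hypothesis G : ordered_group M.
Local Notation "x [+] y" := (@og_add L M x y) (at level 50, left associativity).
Local Notation lt := (@og_lt L M).
Local Notation zero := (og_zero M).

Lemma og_lin : lin_order lt.
Proof. by case: G. Qed.
Let Ol := og_lin.

Lemma og_ltl x y z : lt (z [+] x) (z [+] y) <-> lt x y.
Proof.
split; last exact: og_lt_add2l.
move=> h; case: (og_lt_total G x y) => // [e|/(og_lt_add2l G z)]; last by lord.
by rewrite e in h; lord.
Qed.

Lemma og_ltr x y z : lt (x [+] z) (y [+] z) <-> lt x y.
Proof.
split; last exact: og_lt_add2r.
move=> h; case: (og_lt_total G x y) => // [e|/(og_lt_add2r G z)]; last by lord.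
by rewrite e in h; lord.
Qed.

Lemma og_addIl x y z : z [+] x = z [+] y -> x = y.
Proof.
move=> e; case: (og_lt_total G x y) => // /(og_lt_add2l G z);
  by rewrite e => ?; lord.
Qed.

Lemma og_addIr x y z : x [+] z = y [+] z -> x = y.
Proof.
move=> e; case: (og_lt_total G x y) => // /(og_lt_add2r G z);
  by rewrite e => ?; lord.
Qed.

Lemma og_addr0 x : x [+] zero = x.
Proof. by apply: (@og_addIr _ _ x); rewrite -og_addA // og_add0l. Qed.

Lemma og_addrN x : exists y, x [+] y = zero.
Proof.
have [y yx] := og_addNl G x; exists y; apply: (@og_addIl _ _ y).
by rewrite og_addA // yx og_add0l // og_addr0.
Qed.

Lemma og_solvel a b : exists d, a [+] d = b.
Proof.
by have [y ay] := og_addrN a; exists (y [+] b); rewrite og_addA // ay og_add0l.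
Qed.

Lemma og_solver a b : exists d, d [+] a = b.
Proof.
have [y ya] := og_addNl G a; exists (b [+] y).
by rewrite -og_addA // ya og_addr0.
Qed.

Lemma og_addp x d : lt x (x [+] d) <-> lt zero d.
Proof. by rewrite -{1}(og_addr0 x) og_ltl. Qed.

End Groups.

Section GroupSymbols.
Variables (L : signature) (M N : structure (og_expansion L)) (C : Type).
Variables (i : C -> M) (i' : C -> N).

Lemma d_add : F2 i i' (@og_add L M) (@og_add L N).
Proof.
pose t : 'I_2 -> tm (og_expansion L) C := tnth [tuple TV _ _ 1; TV _ _ 2].
exists (FE (TV _ C 0) (@TF (og_expansion L) C (inl tt) t)).
by split=> v /=; rewrite (_ : (fun j => _) = tnth [tuple v 1; v 2]) //;
  apply: funext => j; rewrite /t !(tnth_nth (v 0)) !(tnth_nth (TV _ _ 0)) /=;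
  case: j => [[|[|]]].
Qed.

Lemma d_lt : D2 i i' (@og_lt L M) (@og_lt L N).
Proof.
pose t : 'I_2 -> tm (og_expansion L) C := tnth [tuple TV _ _ 0; TV _ _ 1].
exists (@FR (og_expansion L) C (inl tt) t).
by split=> v /=; rewrite (_ : (fun j => _) = tnth [tuple v 0; v 1]) //;
  apply: funext => j; rewrite /t !(tnth_nth (v 0)) !(tnth_nth (TV _ _ 0)) /=;
  case: j => [[|[|]]].
Qed.

Lemma d_zero : tfun i i' (fun _ => og_zero M) (fun _ => og_zero N).
Proof. by exists (FE (TV _ C 0) (@TK (og_expansion L) C (inl tt))). Qed.

Lemma d_one one : tfun i i' (fun _ => og_one one M) (fun _ => og_one one N).
Proof. by exists (FE (TV _ C 0) (@TK (og_expansion L) C (inr one))). Qed.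
End GroupSymbols.

Section Tame.
Variables (L : signature) (one : csym L).
Implicit Types (M : structure (og_expansion L)).

(** The essential point is uniformity: one definable function of two variables provides the
    bijections for all [d], which makes the condition first order and yields definable points inside
    intervals. *)
Definition chart M (G : M -> M -> M) : Prop :=
  forall d, og_lt (og_zero M) d -> og_lt d (og_one one M) ->
  [/\ forall x, itv (@og_lt L M) (og_zero M) d x -> unit_itv one (G d x),
      forall x y, itv (@og_lt L M) (og_zero M) d x ->
        itv (@og_lt L M) (og_zero M) d y -> G d x = G d y -> x = y
    & forall y, unit_itv one y ->
        exists x, itv (@og_lt L M) (og_zero M) d x /\ G d x = y].

Record tame_group M : Prop := TameGroup {
  tg_group : ordered_group M;
  tg_one : og_lt (og_zero M) (og_one one M);
  tg_half : exists u : M, unit_itv one u;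
  tg_chart : exists G, F2 (@id M) (@id M) G G /\ chart G }.

Record tame M : Prop := Tame {
  tm_group : tame_group M;
  tm_omin : omin (@og_lt L M) }.

Section Facts.
Variable (M : structure (og_expansion L)).
Hypothesis T : tame_group M.
Local Notation "x [+] y" := (@og_add L M x y) (at level 50, left associativity).
Local Notation lt := (@og_lt L M).
Local Notation zero := (og_zero M).
Let i : M -> M := @id M.
Let Gp := tg_group T.
Let Ol := og_lin Gp.
Let dadd : F2 i i (@og_add L M) (@og_add L M) := d_add i i.
Let dlt : D2 i i lt lt := d_lt i i.

(** Let [d] be the distance from [a] to [b]. For [d < 1] a fixed point [u] of (0,1) is pulled back
    along the chart of (0,d) and added to [a]; for larger [d] the point [a + u] already lies in
    between. The chart thus replaces halving in the group. *)
Lemma tame_picks : picks lt.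
Proof.
have [u [u0 u1]] := tg_half T; have [G [dG hG]] := tg_chart T.
split.
- pose R (v : nat -> M) y := (lt (v 0) (v 1) /\ exists d, v 0 [+] d = v 1 /\
     (lt d (og_one one M) /\ (exists x, (lt zero x /\ lt x d) /\ G d x = u /\ y = v 0 [+] x) \/
     ~ lt d (og_one one M) /\ y = v 0 [+] u)) \/ (~ lt (v 0) (v 1) /\ y = v 0).
  have [||v y y' []|t [dt ht]] := @dfun_of_rel _ _ R.
  + by rewrite /E1 /R; dfb.
  + move=> v; case: (pselect (lt (v 0) (v 1))) => ab; last by exists (v 0); right.
    have [d ad] := og_solvel Gp (v 0) (v 1).
    have d0 : lt zero d by rewrite -(og_addp Gp (v 0)) ad.
    case: (pselect (lt d (og_one one M))) => d1; last first.
      by exists (v 0 [+] u); left; split=> //; exists d; split=> //; right.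
    have [_ _ /(_ u (conj u0 u1)) [x [xd Gx]]] := hG d d0 d1.
    by exists (v 0 [+] x); left; split=> //; exists d; split=> //; left; split=> //; exists x.
  + move=> [ab [d [ad h]]]; case=> [[_ [d' [ad' h']]]|[] //].
    have dd : d' = d by apply: (@og_addIl _ _ Gp _ _ (v 0)); rewrite ad ad'.
    rewrite {}dd in h'; case: h h' => [[d1 [x [xd [Gx ->]]]]|[d1 ->]] [[d1' [x' [xd' [Gx' ->]]]]|[d1' ->]] //.
    have d0 : lt zero d by case: xd => ? ?; lord.
    have [_ inj _] := hG d d0 d1.
    by rewrite (inj x x') // Gx Gx'.
  + by move=> [nab ->]; case=> [[]|[_ ->]].
  exists (fun a b => t (scons a (fun=> b))); split.
    apply: (tfun_app0 (s := fun k v => scons (v 0) (fun=> v 1) k)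
       (s' := fun k v => scons (v 0) (fun=> v 1) k) dt).
    by case=> [|k] /=; dfb.
  move=> a b ab; case: (ht (scons a (fun=> b))) => /= [[_ [d [ad h]]]|[] //].
  have d0 : lt zero d by rewrite -(og_addp Gp a) ad.
  case: h => [[_ [x [[x0 xd] [_ ->]]]]|[d1 ->]].
    by subst b; split; [apply/(og_addp Gp)|apply/(og_ltl Gp)].
  subst b; split; [by apply/(og_addp Gp)|apply/(og_ltl Gp)]; lord.
- exists (fun x => x [+] og_one one M); split; first by rewrite /F1; dfb.
  by move=> a; apply/(og_addp Gp); apply: tg_one.
- have [||v y y'|t [dt ht]] := @dfun_of_rel _ _ (fun v y => y [+] og_one one M = v 0).
  + by rewrite /E1; dfb.
  + by move=> v; apply: og_solver.
  + by move=> <- /og_addIr ->.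
  exists (fun a => t (fun=> a)); split.
    by apply: (tfun_app0 (s := fun k v => v 0) (s' := fun k v => v 0) dt); dfb.
  move=> a; rewrite -{2}(ht (fun=> a)); apply/(og_addp Gp); exact: tg_one.
Qed.

(** Distance less than [e], written without inverses. *)
Definition near (e b b' : M) : Prop := lt b (b' [+] e) /\ lt b' (b [+] e).

Lemma tame_uniform_bound (D : (nat -> M) -> M -> Prop) : omin lt -> E1 i i D D ->
  (forall z, fin (D z)) -> exists n, forall z, atm n (D z).
Proof.
move=> O; apply: (uniform_bound (near := near) (o := zero) O tame_picks).
- by rewrite /D3 /near; dfb.
- move=> e b e0; have [l le] := og_solver Gp e b.
  exists l, (b [+] e); split; first by rewrite -le; apply/(og_addp Gp).
  split; first by apply/(og_addp Gp).
  move=> y ly yb; split=> //; rewrite -le; exact/(og_ltr Gp).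
- move=> u v uv; have [d ud] := og_solvel Gp u v.
  exists d; split; first by apply/(og_addp Gp u); rewrite ud.
  move=> e e0 ed b b' bu vb'.
  have h1 : ~ lt v (u [+] e) by rewrite -ud => /(og_ltl Gp).
  have h2 : ~ lt (u [+] e) (b [+] e) by move=> /(og_ltr Gp).
  by split=> -[? ?]; lord.
Qed.
End Facts.

(** * Tameness of elementary extensions *)

Section Extension.
Variables (M N : structure (og_expansion L)) (e : M -> N).
Hypothesis ee : elementary e.
Let i : M -> M := @id M.

Lemma tdef_right (L' : signature) (M' N' : structure L') (C C' : Type)
    (j : C -> M') (j' : C -> N') (k : C' -> N') (g : C -> C') P Q :
  (forall a, k (g a) = j' a) -> tdef j j' P Q -> tdef k k Q Q.
Proof.
move=> kg [phi [_ h]]; exists (fsub (TV L' C') (fun a => TP L' (g a)) phi).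
by split=> v; rewrite fsat_sub h /=; under eq_fun do rewrite kg.
Qed.

(** That a formula defines a total single-valued function is itself first order, so the formula for
    [t] defines a function on N as well. *)
Lemma tfun_extend (t : (nat -> M) -> M) : tfun i i t t ->
  exists t' : (nat -> N) -> N, tfun i e t t'.
Proof.
move=> [phi [h _]]; have ex : tdef i e (fun v => exists y, fsat i phi (scons y v))
    (fun v => exists y, fsat e phi (scons y v)).
  apply: t_ex; exists phi; split=> v;
    by rewrite (_ : scons (v 0) _ = v) //; apply: funext => -[].
have un : tdef i e (fun v => forall y y', fsat i phi (scons y v) -> fsat i phi (scons y' v) -> y = y')
    (fun v => forall y y', fsat e phi (scons y v) -> fsat e phi (scons y' v) -> y = y').
  have d0 : E1 i e (fun v y => fsat i phi (scons y v)) (fun v y => fsat e phi (scons y v)).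
    exists phi; split=> v;
    by rewrite (_ : scons (v 0) _ = v) //; apply: funext => -[].
  apply: t_all; apply: t_all; apply: t_imp; last apply: t_imp; last by dfb.
    by apply: (t_eapp1 (s := fun k v => v k.+2) _ _ d0); dfb.
  by apply: (t_eapp1 (s := fun k v => v k.+2) _ _ d0); dfb.
have ii' a : e a = e (i a) by [].
have /choice[t' ht'] := tdef_forall (inl tt : csym (og_expansion L)) ee ii' ex
  (fun v => ex_intro _ (t v) (proj1 (h (scons (t v) v)) erefl)).
exists t'; exists phi; split=> // v.
have U := tdef_forall (inl tt : csym (og_expansion L)) ee ii' un.
have -> : v = scons (v 0) (fun k => v k.+1) by apply: funext => -[].
split=> /= [->|hv]; first exact: ht'.
apply: (U _ (fun k => v k.+1) _ _ hv (ht' _)).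
by move=> w y y' /(h (scons y w)) /= -> /(h (scons y' w)) /= ->.
Qed.

(** Parameters of N outside the image of [e] cannot be transferred. They become the variables [z] of
    a family defined by one formula in both structures, and transfer then speaks of all members of
    the family at once. *)
Lemma definable_family (S : N -> Prop) : D1 (@id N) (@id N) S S ->
  exists D D' (z : nat -> N), E1 i e D D' /\ forall t, S t <-> D' z t.
Proof.
move=> [phi [h _]]; have [n [phi0 [w hw]]] := fm_elim phi.
pose D (R : structure (og_expansion L)) (z : nat -> R) t :=
  fsat (of_void R) phi0 (ncat n z (fun=> t)).
exists (@D M), (@D N), (fun k => oapp id (og_zero N) (w k)); split; last first.
  by move=> t; rewrite (h (fun=> t)) (hw _ _ (of_void N) (og_zero N)).
exists (fsub (fun k => if k < n then TV _ M k.+1 else TV _ M 0)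
  (of_void (tm (og_expansion L) M)) phi0); split=> v; rewrite fsat_sub /D.
  rewrite [X in _ <-> fsat X phi0 _]of_voidE.
  have -> // : (fun k => teval i v (if k < n then TV _ M k.+1 else TV _ M 0)) =
    ncat n (fun k => v k.+1) (fun=> v 0).
  by apply: funext => k; rewrite /ncat; case: ifP.
rewrite [X in _ <-> fsat X phi0 _]of_voidE.
have -> // : (fun k => teval e v (if k < n then TV _ M k.+1 else TV _ M 0)) =
    ncat n (fun k => v k.+1) (fun=> v 0).
  by apply: funext => k; rewrite /ncat; case: ifP.
Qed.

(** The group axioms and the chart are finitely many first-order statements. The remaining clauses
    quantify over definable sets and are transferred family by family with the help of
    [definable_family]. *)
Lemma tame_extend : tame M -> tame N.
Proof.
move=> [T O]; have Gp := tg_group T.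
have ii' a : e a = e (i a) by [].
have lift0 P Q : tdef i e P Q -> (forall v, P v) -> forall v, Q v.
  exact: (tdef_forall (inl tt : csym (og_expansion L)) ee ii').
have lift (F : forall R : structure (og_expansion L), (nat -> R) -> Prop) :
    tdef i e (F M) (F N) -> (forall v, F M v) -> forall v, F N v by exact: lift0.
have dadd := d_add i e; have dlt := d_lt i e; have dz := d_zero i e.
have d1 := d_one i e one.
have G' : ordered_group N.
  split.
  - move=> x y z; apply: (lift (fun R v => og_add (v 0) (og_add (v 1) (v 2)) =
      og_add (og_add (v 0) (v 1)) (v 2)) _ _ (scons x (scons y (fun=> z)))).
      by dfb.
    by move=> v; apply: og_addA.
  - move=> x; apply: (lift (fun R v => og_add (og_zero R) (v 0) = v 0) _ _ (fun=> x)).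
      by dfb.
    by move=> v; apply: og_add0l.
  - move=> x; apply: (lift (fun R v => exists y, og_add y (v 0) = og_zero R)
      _ _ (fun=> x)); first by dfb.
    by move=> v; apply: og_addNl.
  - move=> x; apply: (lift (fun R v => ~ og_lt (v 0) (v 0)) _ _ (fun=> x)).
      by dfb.
    by move=> v; apply: og_lt_irr.
  - move=> x y z; apply: (lift (fun R v => og_lt (v 0) (v 1) -> og_lt (v 1) (v 2) ->
      og_lt (v 0) (v 2)) _ _ (scons x (scons y (fun=> z)))); first by dfb.
    by move=> v; apply: og_lt_trans.
  - move=> x y; have := lift (fun R v => og_lt (v 0) (v 1) \/ v 0 = v 1 \/ og_lt (v 1) (v 0)).
    move=> /(_ _ _ (scons x (fun=> y))) [||?|[?|?]]; first by dfb.
    + by move=> v; case: (og_lt_total Gp (v 0) (v 1)) => ?; [left|right; left|right; right].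
    + by constructor 1.
    + by constructor 2.
    + by constructor 3.
  - move=> x y z; apply: (lift (fun R v => og_lt (v 0) (v 1) ->
      og_lt (og_add (v 2) (v 0)) (og_add (v 2) (v 1)))
      _ _ (scons x (scons y (fun=> z)))); first by dfb.
    by move=> v; apply: og_lt_add2l.
  - move=> x y z; apply: (lift (fun R v => og_lt (v 0) (v 1) ->
      og_lt (og_add (v 0) (v 2)) (og_add (v 1) (v 2)))
      _ _ (scons x (scons y (fun=> z)))); first by dfb.
    by move=> v; apply: og_lt_add2r.
have T' : tame_group N.
  split=> //.
  - apply: (lift (fun R _ => og_lt (og_zero R) (og_one one R)) _ _ (fun=> og_zero N)).
      by dfb.
    by move=> _; apply: tg_one.
  - apply: (lift (fun R _ => exists u, og_lt (og_zero R) u /\ og_lt u (og_one one R))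
      _ _ (fun=> og_zero N)); first by dfb.
    by move=> _; apply: tg_half.
  - have [G [dG hG]] := tg_chart T; have [t dt] := tfun_extend dG.
    pose G2 x y := t (scons x (fun=> y)).
    have dG2 : F2 i e G G2.
      apply: (t_ext _ _ (tfun_app0 (s := fun k v => scons (v 0) (fun=> v 1) k)
       (s' := fun k v => scons (v 0) (fun=> v 1) k) dt _)) => //.
      by case=> [|k] /=; dfb.
    exists G2; split; first by apply: (tdef_right (g := e) _ dG2).
    move=> d d0 d1'.
    pose inside (R : structure (og_expansion L)) (b x : R) :=
      og_lt (og_zero R) x /\ og_lt x b.
    pose chart_at (R : structure (og_expansion L)) (H : R -> R -> R) (v : nat -> R) :=
      og_lt (og_zero R) (v 0) -> og_lt (v 0) (og_one one R) ->
      (forall x, inside R (v 0) x -> inside R (og_one one R) (H (v 0) x)) /\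
      (forall x y, inside R (v 0) x -> inside R (v 0) y -> H (v 0) x = H (v 0) y -> x = y) /\
      (forall y, inside R (og_one one R) y -> exists x, inside R (v 0) x /\ H (v 0) x = y).
    have [||h1 [h2 h3]] := lift0 (chart_at M G) (chart_at N G2) _ _ (fun=> d) d0 d1'.
    + by rewrite /chart_at /inside; dfb.
    + by move=> v v0 v1; have [? ? ?] := hG (v 0) v0 v1.
    + by split.
split=> //.
have K := tame_picks T'.
have left2 (D : (nat -> M) -> M -> Prop) D' : E1 i e D D' -> E1 i i D D.
  by move=> [phi [h _]]; exists phi.
split.
- by case: G'.
- move=> x y xy; have [mid [_ h]] := pk_mid K; exists (mid x y); exact: h.
- by move=> x; have [up [_ h]] := pk_up K; exists (up x).
- by move=> x; have [dn [_ h]] := pk_down K; exists (dn x).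
- exact: d_lt.
- move=> S /definable_family [D [D' [z [dD hS]]]].
  have -> : S = D' z by apply: funext => t; apply/propext.
  pose has_sup (R : structure (og_expansion L)) (F : (nat -> R) -> R -> Prop) v :=
    (exists x, F v x) -> (exists u, forall x, F v x -> ~ og_lt u x) ->
    exists s, is_sup (@og_lt L R) (F v) s.
  apply: (lift0 (has_sup M D) (has_sup N D')).
    by rewrite /has_sup /is_sup; dfb.
  move=> v; apply: (om_sup O); apply: (t_eapp1 (s := fun k _ => v k) _ _ (left2 _ _ dD)); dfb.
- move=> S /definable_family [D [D' [z [dD hS]]]].
  have -> : S = D' z by apply: funext => t; apply/propext.
  pose has_inf (R : structure (og_expansion L)) (F : (nat -> R) -> R -> Prop) v :=
    (exists x, F v x) -> (exists u, forall x, F v x -> ~ og_lt x u) ->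
    exists s, is_inf (@og_lt L R) (F v) s.
  apply: (lift0 (has_inf M D) (has_inf N D')).
    by rewrite /has_inf /is_inf; dfb.
  move=> v; apply: (om_inf O); apply: (t_eapp1 (s := fun k _ => v k) _ _ (left2 _ _ dD)); dfb.
- move=> S /definable_family [D [D' [z [dD hS]]]].
  have -> : S = D' z by apply: funext => t; apply/propext.
  have dDl := left2 _ _ dD; have dltl := d_lt i i.
  (* Here uniform finiteness is indispensable: only a bound [n] valid for every member of the family
     in M can be carried over to N. *)
  have [||n hn] := tame_uniform_bound T (D := fun z => bd (@og_lt L M) (D z)) O.
  + by rewrite /E1 /bd; dfb.
  + by move=> v; apply: (om_bd O); apply: (t_eapp1 (s := fun k _ => v k) _ _ dDl); dfb.
  exists n; apply: (lift0 (fun v => atm n (bd (@og_lt L M) (D v)))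
    (fun v => atm n (bd (@og_lt L N) (D' v)))) => //.
  by rewrite /bd; dfb.
Qed.
End Extension.
End Tame.

(** * The structure M *)

Section BasicSets.
Variables (T : Type).
Implicit Types (lt : T -> T -> Prop) (X : T -> Prop).

Definition above lt (a : option T) (x : T) : Prop :=
  if a is Some a' then lt a' x else True.

Definition basic lt X : Prop := (exists a, forall x, X x <-> x = a) \/
  exists a b, forall x, X x <-> above lt a x /\ above (fun x y => lt y x) b x.

Lemma basic_flip lt X : basic lt X -> basic (fun x y => lt y x) X.
Proof.
case=> [h|[a [b h]]]; first by left.
by right; exists b, a => x; rewrite h; split=> -[].
Qed.

Definition dlo lt : Prop := [/\ lin_order lt,
  forall x y, lt x y -> exists z, lt x z /\ lt z y,
  forall x, exists y, lt x y & forall x, exists y, lt y x].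

Lemma dlo_flip lt : dlo lt -> dlo (fun x y => lt y x).
Proof.
move=> [[irr tr tot] dense up down]; split=> //; last first.
  by move=> x y /dense [z [? ?]]; exists z.
split=> // [x y z yx zy|x y]; first exact: tr yx.
by case: (tot x y) => [?|->|?]; [constructor 3|constructor 2|constructor 1].
Qed.

Lemma basic_sup lt X u : dlo lt -> basic lt X -> (exists x, X x) ->
  (forall x, X x -> ~ lt u x) -> exists s, is_sup lt X s.
Proof.
move=> [O dense up down] [[a h] _ _|[a [b h]] [x Xx] Xu].
  exists a; split=> [y /h ->|v va]; first by lord.
  by exists a; split=> //; apply/h.
case: b h => [b|] h; last first.
  exfalso; have [m [um xm]] : exists m, ~ lt m u /\ ~ lt m x.
    by case: (pselect (lt u x)) => ?; [exists x|exists u]; lord.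
  have [y my] := up m; apply: (Xu y); last by lord.
  apply/h; split=> //; have /h [ax _] := Xx.
  by case: a ax {h} => //= a ax; lord.
exists b; split=> [y /h [_ /= yb]|v vb]; first by lord.
have /h [ax /= xb] := Xx.
have [m [vm [xm mb]]] : exists m, ~ lt m v /\ ~ lt m x /\ lt m b.
  by case: (pselect (lt v x)) => ?; [exists x|exists v]; lord.
have [y [my yb]] := dense _ _ mb; exists y; split; last by lord.
apply/h; split=> //; by case: a ax {h Xx} => //= a ax; lord.
Qed.

Lemma union_sup lt k (F : 'I_k -> T -> Prop) u : dlo lt -> (forall j, basic lt (F j)) ->
  (exists j x, F j x) -> (forall j x, F j x -> ~ lt u x) ->
  exists s, is_sup lt (fun x => exists j, F j x) s.
Proof.
move=> D; have [O _ _ _] := D.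
elim: k F => [|k IH] F bF [j0 [x0 Fx0]] Fu; first by case: j0 {Fx0}.
have split_ord j : F j = F ord0 \/ exists j', F j = F (lift ord0 j').
  by case: (unliftP ord0 j) => [j' ->|->]; [right; exists j'|left].
have sup0 : (exists x, F ord0 x) -> exists s, is_sup lt (F ord0) s.
  by move=> ne; apply: (basic_sup (u := u)) => //; apply: Fu.
have supS : (exists j x, F (lift ord0 j) x) ->
    exists s, is_sup lt (fun x => exists j, F (lift ord0 j) x) s.
  by move=> ne; apply: IH => // j x; apply: Fu.
case: (pselect (exists x, F ord0 x)) => [ne0|e0]; last first.
  have [|s [s1 s2]] := supS.
    case: (split_ord j0) => [E|[j' E]]; last by exists j', x0; rewrite -E.
    by case: e0; exists x0; rewrite -E.
  exists s; split=> [x [j Fx]|v /s2 [x [[j Fx] ?]]]; last first.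
    by exists x; split=> //; exists (lift ord0 j).
  apply: s1; case: (split_ord j) => [E|[j' E]]; last by exists j'; rewrite -E.
  by case: e0; exists x; rewrite -E.
have [s [s1 s2]] := sup0 ne0.
case: (pselect (exists j x, F (lift ord0 j) x)) => [neS|eS]; last first.
  exists s; split=> [x [j Fx]|v /s2 [x [Fx ?]]]; last first.
    by exists x; split=> //; exists ord0.
  apply: s1; case: (split_ord j) => [<-|[j' E]] //.
  by case: eS; exists j', x; rewrite -E.
have [s' [s1' s2']] := supS neS.
case: (pselect (lt s s')) => ss'.
  exists s'; split=> [x [j Fx]|v /s2' [x [[j Fx] ?]]]; last first.
    by exists x; split=> //; exists (lift ord0 j).
  case: (split_ord j) => [E|[j' E]]; last by apply: s1'; exists j'; rewrite -E.
  by have := s1 x; rewrite -E => /(_ Fx); lord.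
exists s; split=> [x [j Fx]|v /s2 [x [Fx ?]]]; last by exists x; split=> //; exists ord0.
case: (split_ord j) => [E|[j' E]]; first by apply: s1; rewrite -E.
have : ~ lt s' x by apply: s1'; exists j'; rewrite -E.
by lord.
Qed.
End BasicSets.

Section BasicBoundary.
Variables (T : Type) (lt : T -> T -> Prop).
Hypothesis D : dlo lt.

Lemma loc_lt a t : t <> a -> locally lt t (fun y => (lt a y <-> lt a t) /\ (lt y a <-> lt t a)).
Proof.
have [O _ up down] := D; move=> ta; have [l lt_] := down t; have [r tr] := up t.
have [h|h] : lt t a \/ lt a t by lord.
  by exists l, a; split=> //; split=> // y ? ?; split; lord.
by exists a, r; split=> //; split=> // y ? ?; split; lord.
Qed.

Lemma basic_loc X : basic lt X -> exists E, fin E /\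
  forall t, ~ E t -> locally lt t (fun y => X y <-> X t).
Proof.
have [O _ up down] := D.
case=> [[a h]|[a [b h]]].
  exists (fun t => t = a); split; first exact: fin_eq.
  move=> t ta; apply: locally_imp (loc_lt ta) => y [h1 h2]; rewrite !h; move: h1 h2 ta; lord.
have half (c : option T) : exists E, fin E /\ forall t, ~ E t -> locally lt t (fun y =>
   (above lt c y <-> above lt c t) /\
   (above (fun x y => lt y x) c y <-> above (fun x y => lt y x) c t)).
  case: c => [c|]; first by exists (fun t => t = c); split; [exact: fin_eq|move=> t tc; exact: (loc_lt tc)].
  exists (fun _ => False); split; first by exists 0 => ? [].
  by move=> t _; have [l lt_] := down t; have [r tr] := up t; exists l, r.
have [E [fE hE]] := half a; have [E' [fE' hE']] := half b.
exists (fun t => E t \/ E' t); split; first exact: fin_union.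
move=> t nE; have h1 : ~ E t by tauto.
have h2 : ~ E' t by tauto.
by apply: locally_imp (locally_and O (hE t h1) (hE' t h2)) => y; rewrite !h; tauto.
Qed.

Lemma union_loc k (F : 'I_k -> T -> Prop) : (forall j, basic lt (F j)) ->
  exists E, fin E /\ forall t, ~ E t ->
    locally lt t (fun y => (exists j, F j y) <-> (exists j, F j t)).
Proof.
have [O _ up down] := D.
elim: k F => [|k IH] F bF.
  exists (fun _ => False); split; first by exists 0 => ? [].
  move=> t _; have [l lt_] := down t; have [r tr] := up t; exists l, r.
  by split=> //; split=> // y _ _; split=> -[[]].
have [E [fE hE]] := IH (fun j => F (lift ord0 j)) (fun j => bF _).
have [E' [fE' hE']] := basic_loc (bF ord0).
exists (fun t => E t \/ E' t); split; first exact: fin_union.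
move=> t nE; have h1 : ~ E t by tauto.
have h2 : ~ E' t by tauto.
have un y : (exists j, F j y) <-> (F ord0 y \/ exists j, F (lift ord0 j) y).
  split=> [[j]|[Fy|[j Fy]]]; [|by exists ord0|by exists (lift ord0 j)].
  by case: (unliftP ord0 j) => [j' ->|->]; [right; exists j'|left].
by apply: locally_imp (locally_and O (hE t h1) (hE' t h2)) => y; rewrite !un; tauto.
Qed.
End BasicBoundary.

Section Base.
Variables (L : signature) (one : csym L) (M : structure (og_expansion L)).
Let i : M -> M := @id M.
Local Notation lt := (@og_lt L M).

Lemma definable_over_ddef (L' : signature) (M' : structure L') (A : set M') n
    (D : set ('I_n -> M')) : definable_over A D ->
  exists P : (nat -> M') -> Prop, tdef (@id M') (@id M') P P /\
    forall w : nat -> M', D (fun j => w j) <-> P w.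
Proof.
move=> [phi h]; exists (fsat (@sval M' A) (of_formula phi)); split.
  exists (fsub (TV L' M') (fun a => TP L' (sval a)) (of_formula phi)).
  by split=> v; rewrite fsat_sub.
by move=> w; rewrite h fsat_of_formula.
Qed.

Lemma ddef_definable_over1 (S : M -> Prop) : D1 i i S S ->
  definable_over1 [set: M] S.
Proof.
move=> [phi [h _]].
pose p (a : M) : {a : M | [set: M] a} := exist _ a I.
exists (to_formula (inl tt : csym (og_expansion L)) 1 (fsub (TV (og_expansion L) _) (fun a => TP _ (p a)) phi)).
move=> v; rewrite sat_to_formula fsat_sub /= -(h (ext _ v)).
by rewrite -{1}(ext_ord (inl tt : csym (og_expansion L)) v ord0).
Qed.

(** [tame_picks] makes the order dense without end points. A finite union of points and intervals
    then has suprema and infima, and only the finitely many points and end points can lie on its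
    boundary. *)
Lemma o_minimal_omin : tame_group one M -> o_minimal M -> omin lt.
Proof.
move=> T om; have K := tame_picks T.
have [mid [_ hmid]] := pk_mid K; have [up [_ hup]] := pk_up K.
have [dn [_ hdn]] := pk_down K.
have D : dlo lt.
  split; first exact: og_lin (tg_group T).
  - by move=> x y xy; exists (mid x y); apply: hmid.
  - by move=> x; exists (up x).
  - by move=> x; exists (dn x).
have [Ol dense upx downx] := D.
have pieces S : D1 i i S S -> exists k (F : 'I_k -> M -> Prop),
    (forall j, basic lt (F j)) /\ forall x, S x <-> exists j, F j x.
  move=> /ddef_definable_over1 /om [k [F [hF ->]]]; exists k, F; split.
    move=> j; case: (hF j) => [[a ->]|[a [b ->]]]; first by left; exists a.
    by right; exists a, b.
  by move=> x; split=> [[j _ Fx]|[j Fx]]; exists j.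
split=> //; first exact: d_lt.
- move=> S /pieces [k [F [bF SF]]] [x /SF [j Fx]] [u hu].
  have [||s [s1 s2]] := union_sup (u := u) D bF.
  + by exists j, x.
  + by move=> j' y Fy; apply: hu; apply/SF; exists j'.
  exists s; split=> [y /SF|v /s2 [y [Fy ?]]]; first exact: s1.
  by exists y; split=> //; apply/SF.
- move=> S /pieces [k [F [bF SF]]] [x /SF [j Fx]] [u hu].
  have [||s [s1 s2]] := union_sup (u := u) (dlo_flip D) (fun j => basic_flip (bF j)).
  + by exists j, x.
  + by move=> j' y Fy; apply: hu; apply/SF; exists j'.
  exists s; split=> [y /SF|v /s2 [y [Fy ?]]]; first exact: s1.
  by exists y; split=> //; apply/SF.
- move=> S /pieces [k [F [bF SF]]].
  have [E [fE hE]] := union_loc D bF; apply: fin_sub fE => t bt.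
  apply: contrapT => /hE [l [r [lt_ [tr h]]]].
  have [x [y [[? ?] [[? ?] [/SF Sx Sy]]]]] := bt l r lt_ tr.
  by apply: Sy; apply/SF/h => //; apply/(h x).
Qed.
End Base.

(** * From the induced structure on an interval back to M *)

Section InducedStructure.
Variables (L : signature) (M : structure (og_expansion L)) (X : set M).
Hypothesis dX : D1 (@id M) (@id M) X X.
Let i : M -> M := @id M.

(** Quantifiers are relativized to [X] and each trace is replaced by the set of which it is the
    trace. Terms cause no trouble: there are no function symbols and no constants, so they are
    variables. *)
Lemma induced_ddef n (S : set ('I_n -> induced X)) : definable_over set0 S ->
  exists P : (nat -> M) -> Prop, ddef P P /\
  forall (v : 'I_n -> induced X) (w : nat -> M),
    (forall j : 'I_n, w j = sval (v j)) -> (S v <-> P w).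
Proof.
pose sig0 := add_consts_sig (add_rels_sig empty_sig (@traces _ M X))
  {a : induced X | set0 a}.
pose str0 : structure sig0 := add_consts (@sval (induced X) set0).
have term_var k (t : term sig0 k) : exists j, t = Var sig0 j.
  by case: t => [j|[[]|[a []]]|[]]; exists j.
suff H n' (phi : formula sig0 n') : exists P : (nat -> M) -> Prop, ddef P P /\
    forall (v : 'I_n' -> str0) (w : nat -> M),
    (forall j : 'I_n', w j = sval (v j)) -> (sat phi v <-> P w).
  move=> [phi h]; have [P [dP hP]] := H n phi; exists P; split=> // v w vw.
  by rewrite h; apply: hP.
elim: phi => {n S} [n|n t u|n r ts|n a [P [dP hP]] b [Q [dQ hQ]]|n a [P [dP hP]]].
- by exists (fun _ => False); split=> //; apply: t_false.
- have [j ->] := term_var _ t; have [k ->] := term_var _ u.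
  exists (fun w => w j = w k); split; first exact: t_eqv.
  move=> v w vw /=; rewrite !vw; split=> [->//|].
  by case: (v j) (v k) => [x Xx] [y Xy] /= e; subst y; congr exist; apply: Prop_irrelevance.
- case: r ts => [[]|[k [S tS]]] ts.
  have /choice[j tsj] := fun l => term_var _ (ts l).
  case: (tS) => D dD SE.
  have [P [dP hP]] := definable_over_ddef dD.
  exists (fun w => P (fun l => w (if insub l is Some l' then j l' : nat else 0))).
  split; first exact: (t_ren (fun l => if insub l is Some l' then j l' : nat else 0) dP).
  move=> v w vw /=.
  have -> : (fun l => @eval _ str0 n v (ts l)) = (fun l => v (j l)).
    by apply: funext => l; rewrite tsj.
  have SD u : S u <-> D (fun l => sval (u l)) by rewrite SE.
  apply: (iff_trans (SD _)); rewrite -hP.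
  rewrite (_ : (fun l : 'I_k => sval (v (j l))) =
     (fun l : 'I_k => w (if insub (l : nat) is Some l' then j l' : nat else 0))) //.
  by apply: funext => l; rewrite valK vw.
- exists (fun w => P w -> Q w); split; first exact: t_imp.
  by move=> v w vw /=; have := hP v w vw; have := hQ v w vw; tauto.
- exists (fun w => forall x, X x -> P (scons x w)); split.
    apply: (t_all (P := fun x w => X x -> P (scons x w)) (P' := fun x w => X x -> P (scons x w))).
    apply: t_imp; first exact: dX.
    by apply: t_ext dP => v; rewrite (_ : scons (v 0) _ = v) //; apply: funext => -[].
  move=> v w vw /=.
  have E x (xX : X x) : sat a (@tcons str0 n (exist _ x xX) v) <-> P (scons x w).
    apply: hP => j; case: (unliftP ord0 j) => [j' ->|->]; last by rewrite tcons0.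
    by rewrite tconsS /= vw.
  by split=> [h x xX|h [x xX]]; [apply/E|apply/E/h].
Qed.
End InducedStructure.

(** * The charts given by the real closed field *)

Section FieldChart.
Import Order.TTheory GRing.Theory Num.Theory.
Local Open Scope ring_scope.

(** A decreasing bijection from the positive elements onto [K]: those up to 1 go to the elements at
    least 0, the others to the negative ones. Composed with [k - x] it maps the half-line of all
    [x < k] onto [K]. *)
Definition fold_half (K : rcfType) (d : K) : K := if d <= 1 then d^-1 - 1 else 1 - d.

Lemma fold_half_inj (K : rcfType) (c d : K) : 0 < c -> 0 < d ->
  fold_half c = fold_half d -> c = d.
Proof.
rewrite /fold_half => c0 d0.
have inv_ge (x : K) : 0 < x -> x <= 1 -> 0 <= x^-1 - 1.
  by move=> x0 x1; rewrite subr_ge0 invf_ge1.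
case: (leP c 1) => hc; case: (leP d 1) => hd.
- by move=> /addIr /invr_inj.
- by move=> e; have := inv_ge c c0 hc; rewrite e; lra.
- by move=> e; have := inv_ge d d0 hd; rewrite -e; lra.
- lra.
Qed.

Lemma fold_half_surj (K : rcfType) (y : K) : exists d, 0 < d /\ fold_half d = y.
Proof.
rewrite /fold_half; case: (leP 0 y) => y0; last first.
  exists (1 - y); split; first by lra.
  by case: leP => ?; lra.
have y1 : 0 < 1 + y by lra.
exists (1 + y)^-1; split; first by rewrite invr_gt0.
rewrite ifT; last by rewrite invf_le1 //; lra.
by rewrite invrK; ring.
Qed.

Variables (L : signature) (one : csym L) (M : structure (og_expansion L)).
Local Notation lt := (@og_lt L M).
Let i : M -> M := @id M.

(** The field exhausts (0,1), so if [d] corresponds to [k], then (0,d) corresponds to the half-line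
    below [k], and the chart of (0,d) is [x] to [fold_half (k - x)], read in M. *)
Lemma rcf_tame_group : ordered_group M -> lt (og_zero M) (og_one one M) ->
  unit_itv_expands_rcf one M -> tame_group one M.
Proof.
move=> Gp h01 [K [f [bf f_lt dAdd dMul]]].
have dlt : D2 i i lt lt := d_lt i i.
have dX : D1 i i (unit_itv one (M:=M)) (unit_itv one (M:=M)).
  by rewrite /D1 /unit_itv /og_itv /=; dfb.
pose g x := sval (f x).
have gX x : unit_itv one (g x) by exact: (svalP (f x)).
have [f' fK f'K] := bf.
have g_sur y : unit_itv one y -> exists x, g x = y.
  by move=> Xy; exists (f' (exist _ y Xy)); rewrite /g f'K.
have g_lt x y : (x < y)%R <-> lt (g x) (g y) by exact: f_lt.
have g_inj x y : g x = g y -> x = y.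
  move=> e; apply: (can_inj fK).
  rewrite /g in e; case: (f x) (f y) e => [a Xa] [b Xb] /= e; subst b.
  by congr exist; apply: Prop_irrelevance.
have graph (op : K -> K -> K) : definable_over set0
      [set v : 'I_3 -> induced (unit_itv one (M:=M)) | exists x y, v = tnth [tuple f x; f y; f (op x y)]] ->
    exists R : M -> M -> M -> Prop, D3 i i R R /\
      forall x y c, R (g x) (g y) (g c) <-> c = op x y.
  move=> /(induced_ddef dX) [P [dP hP]].
  exists (fun a b c => P (scons a (scons b (fun=> c)))); split.
    pose s k (v : nat -> M) := scons (v 0%N) (scons (v 1%N) (fun=> v 2%N)) k.
    apply: (t_sub (s := s) (s' := s) dP).
    by rewrite /s; case=> [|[|k]] /=; dfb.
  move=> x y c; rewrite -(hP (tnth [tuple f x; f y; f c])); last first.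
    by move=> j; rewrite (tnth_nth (f c)); case: j => [[|[|[|]]]].
  split=> /= [[x' [y' e]]|->]; last by exists x, y.
  have e0 := congr1 (fun v => v (@Ordinal 3 0 isT)) e.
  have e1 := congr1 (fun v => v (@Ordinal 3 1 isT)) e.
  have e2 := congr1 (fun v => v (@Ordinal 3 2 isT)) e.
  rewrite !(tnth_nth (f c)) /= in e0 e1 e2.
  by rewrite (can_inj fK e0) (can_inj fK e1) (can_inj fK e2).
have [RA [dRA hRA]] := graph _ dAdd.
have [RM [dRM hRM]] := graph _ dMul.
split=> //; first by exists (g 0).
(* The graph of the chart in terms of the graphs [RA] of addition and [RM] of multiplication: [d] is
   the difference [k - x]. If it is at most 1, then [w] is its inverse and [y + 1 = w]; otherwise
   [y + d = 1]. Outside the intended domain the value is zero. *)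
pose R (v : nat -> M) y :=
  ((lt (og_zero M) (v 1%N) /\ lt (v 1%N) (v 0%N) /\ lt (v 0%N) (og_one one M)) /\
   exists d, unit_itv one d /\ RA d (v 1%N) (v 0%N) /\ unit_itv one y /\
     (~ lt (g 1) d /\ (exists w, unit_itv one w /\ RM d w (g 1) /\ RA y (g 1) w) \/
      lt (g 1) d /\ RA y d (g 1))) \/
  (~ (lt (og_zero M) (v 1%N) /\ lt (v 1%N) (v 0%N) /\ lt (v 0%N) (og_one one M)) /\ y = og_zero M).
have RP v k x y : v 0%N = g k -> v 1%N = g x -> x < k ->
    R v y <-> y = g (fold_half (k - x)).
  move=> v0 v1 xk; have [gk0 gk1] := gX k; have [gx0 gx1] := gX x.
  have gxk := proj1 (g_lt _ _) xk.
  have ne : k - x != 0 by rewrite subr_eq0 gt_eqF.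
  rewrite /R v0 v1; split; last first.
    move=> ->; left; split=> //; exists (g (k - x)); split=> //.
    split; first by apply/hRA; ring.
    split=> //; rewrite /fold_half; case: leP => h; last first.
      by right; split; [apply/g_lt|apply/hRA; ring].
    left; split; first by move=> /g_lt; lra.
    exists (g (k - x)^-1); split=> //; split; last by apply/hRA; ring.
    by apply/hRM; rewrite divff.
  case=> [[_ [d [/g_sur [d' <-] [/hRA dE [/g_sur [y' <-] h]]]]]|[nn _]]; last by case: nn.
  have {}dE : d' = k - x by rewrite dE; ring.
  rewrite {}dE in h; congr g; rewrite /fold_half.
  case: h => [[h1 [w [/g_sur [w' <-] [/hRM h2 /hRA h3]]]]|[/g_lt h1 /hRA h2]].
    rewrite ifT; last by rewrite leNgt; apply/negP => /g_lt.
    have -> : (k - x)^-1 = w'; last by rewrite h3; ring.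
    by apply: (mulfI ne); rewrite -h2 divff.
  by rewrite ifF; [rewrite h2; ring|apply/negbTE; rewrite -ltNge].
have Ol := og_lin Gp.
have exR v : exists y, R v y.
  case: (pselect (lt (og_zero M) (v 1%N) /\ lt (v 1%N) (v 0%N) /\ lt (v 0%N) (og_one one M))) => h; last first.
    by exists (og_zero M); right.
  have [h1 [h2 h3]] := h.
  have [|x xE] := g_sur (v 1%N); first by split=> /=; lord.
  have [|k kE] := g_sur (v 0%N); first by split=> /=; lord.
  exists (g (fold_half (k - x))); apply/(RP v k x) => //; apply/g_lt.
  by rewrite xE kE.
have uniR v y y' : R v y -> R v y' -> y = y'.
  case: (pselect (lt (og_zero M) (v 1%N) /\ lt (v 1%N) (v 0%N) /\ lt (v 0%N) (og_one one M))) => h; last first.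
    by move=> [[]//|[_ ->]] [[]//|[_ ->]].
  have [h1 [h2 h3]] := h.
  have [|x xE] := g_sur (v 1%N); first by split=> /=; lord.
  have [|k kE] := g_sur (v 0%N); first by split=> /=; lord.
  have xk : x < k by apply/g_lt; rewrite xE kE.
  by move=> /(RP v k x y (esym kE) (esym xE) xk) -> /(RP v k x y' (esym kE) (esym xE) xk) ->.
have dR : E1 i i R R by rewrite /E1 /R; dfb.
have [t [dt ht]] := dfun_of_rel dR exR uniR.
exists (fun a b => t (scons a (fun=> b))); split.
  apply: (tfun_app0 (s := fun k v => scons (v 0%N) (fun=> v 1%N) k)
       (s' := fun k v => scons (v 0%N) (fun=> v 1%N) k) dt).
  by case=> [|k] /=; dfb.
move=> d d0 d1; have [|k kE] := g_sur d; first by split.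
have tE x : x < k -> t (scons d (fun=> g x)) = g (fold_half (k - x)).
  by move=> xk; apply/(RP (scons d (fun=> g x)) k x) => //; apply: ht.
have ing x : itv lt (og_zero M) d x -> exists x', g x' = x /\ x' < k.
  move=> [x0 xd]; have [|x' xE] := g_sur x; first by split=> /=; lord.
  by exists x'; split=> //; apply/g_lt; rewrite xE kE.
split.
- by move=> x /ing [x' [<- xk]]; rewrite tE.
- move=> x y /ing [x' [<- xk]] /ing [y' [<- yk]]; rewrite !tE // => /g_inj.
  by move=> /fold_half_inj h; congr g; have := h; rewrite !subr_gt0 => /(_ xk yk); lra.
- move=> y /g_sur [y' <-]; have [e [e0 eE]] := fold_half_surj y'.
  have ek : k - e < k by lra.
  exists (g (k - e)); split; first by split; [have [] := gX (k - e)|rewrite -kE; apply/g_lt].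
  by rewrite tE // -eE; congr (g (fold_half _)); ring.
Qed.
End FieldChart.

(** * Short intervals *)

Lemma fin_lt (T : Type) m (F : nat -> T -> Prop) : (forall k, k < m -> fin (F k)) ->
  fin (fun t => exists k, k < m /\ F k t).
Proof.
elim: m => [|m IH] h; first by exists 0 => t [k []].
apply: fin_sub (fin_union (IH _) (h m _)) => // [t [k [km Fk]]|k km]; last by apply: h; lia.
have [e|ne] := eqVneq k m; first by right; rewrite -e.
by left; exists k; split=> //; lia.
Qed.

Section Charts.
Variables (L : signature) (one : csym L) (M : structure (og_expansion L)).
Hypothesis TM : tame one M.
Let T := tm_group TM.
Let O := tm_omin TM.
Let Gp := tg_group T.
Let Ol := og_lin Gp.
Local Notation "x [+] y" := (@og_add L M x y) (at level 50, left associativity).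
Local Notation lt := (@og_lt L M).
Local Notation zero := (og_zero M).
Local Notation unit := (@unit_itv L one M).
Let i : M -> M := @id M.
Let dadd : F2 i i (@og_add L M) (@og_add L M) := d_add i i.
Let dlt : D2 i i lt lt := d_lt i i.

Definition charted (S : M -> Prop) : Prop := exists h, F1 i i h h /\
  [/\ forall x, S x -> unit (h x), forall x y, S x -> S y -> h x = h y -> x = y
    & forall y, unit y -> exists x, S x /\ h x = y].

Lemma charted_rel (S : M -> Prop) (R : M -> M -> Prop) : D1 i i S S -> D2 i i R R ->
  (forall x, S x -> exists y, unit y /\ R x y) ->
  (forall y, unit y -> exists x, S x /\ R x y) ->
  (forall x y y', S x -> unit y -> unit y' -> R x y -> R x y' -> y = y') ->
  (forall x x' y, S x -> S x' -> unit y -> R x y -> R x' y -> x = x') -> charted S.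
Proof.
move=> dS dR tot sur fun_ inj.
have dX : D1 i i unit unit by rewrite /D1 /unit_itv /og_itv /=; dfb.
pose Q (v : nat -> M) y := (S (v 0) /\ unit y /\ R (v 0) y) \/ (~ S (v 0) /\ y = zero).
have [|||t [dt ht]] := @dfun_of_rel _ _ Q.
- by rewrite /E1 /Q; dfb.
- move=> v; case: (pselect (S (v 0))) => Sv; last by exists zero; right.
  by have [y [Xy Ry]] := tot _ Sv; exists y; left.
- move=> v y y' [[Sv [Xy Ry]]|[nS ->]] [[Sv' [Xy' Ry']]|[nS' ->]] //.
  exact: fun_ Sv Xy Xy' Ry Ry'.
have hS x : S x -> unit (t (fun=> x)) /\ R x (t (fun=> x)).
  by move=> Sx; case: (ht (fun=> x)) => [[]|[]].
exists (fun x => t (fun=> x)); split.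
  by apply: (tfun_app0 (s := fun _ v => v 0) (s' := fun _ v => v 0) dt); dfb.
split=> [x /hS []|x y Sx Sy e|y Xy] //.
  have [Xx Rx] := hS x Sx; have [Xy Ry] := hS y Sy.
  by rewrite -e in Ry; apply: inj Rx Ry.
have [x [Sx Rxy]] := sur y Xy; exists x; split=> //.
by have [Xx Rx] := hS x Sx; apply: fun_ Rx Rxy.
Qed.

Lemma charted_ext (S S' : M -> Prop) : (forall x, S x <-> S' x) -> charted S -> charted S'.
Proof. by move=> h; have -> : S' = S by apply: funext => x; apply/propext; split=> /h. Qed.

(** A translation leads to (0,d) with [d] at most 1. The charts cover [d < 1]; for [d = 1] the
    translate is (0,1) itself. *)
Lemma charted_itv a b : lt a b -> ~ lt (a [+] og_one one M) b -> charted (itv lt a b).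
Proof.
move=> ab ba; have [d ad] := og_solvel Gp a b.
have d0 : lt zero d by apply/(og_addp Gp a); rewrite ad.
have d1 : ~ lt (og_one one M) d by move=> /(iffRL (og_ltl Gp _ _ a)); rewrite ad.
have [G [dG hG]] := tg_chart T.
have dS : D1 i i (itv lt a b) (itv lt a b) by rewrite /D1 /itv; dfb.
have tr x : itv lt a b x -> exists y, itv lt zero d y /\ x = a [+] y.
  move=> [ax xb]; have [y ay] := og_solvel Gp a x; exists y; split=> //.
  split; first by apply/(og_addp Gp a); rewrite ay.
  by apply: (iffLR (og_ltl Gp _ _ a)); rewrite ay ad.
have tr' y : itv lt zero d y -> itv lt a b (a [+] y).
  move=> [y0 yd]; split; first by apply/(og_addp Gp).
  by rewrite -ad; apply/(og_ltl Gp).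
case: (pselect (lt d (og_one one M))) => d1'; last first.
  have dE : d = og_one one M by lord.
  apply: (charted_rel (R := fun x y => x = a [+] y)) => //.
  - by rewrite /D2; dfb.
  - by move=> x /tr [y [yd ->]]; exists y; split=> //; rewrite dE in yd.
  - by move=> y uy; exists (a [+] y); split=> //; apply: tr'; rewrite dE.
  - by move=> x y y' _ _ _ -> /og_addIl ->.
  - by move=> x x' y _ _ _ -> ->.
have [h1 h2 h3] := hG d d0 d1'.
apply: (charted_rel (R := fun x z => exists y, itv lt zero d y /\ x = a [+] y /\ z = G d y)) => //.
- by rewrite /D2 /itv; dfb.
- by move=> x /tr [y [yd ->]]; exists (G d y); split; [apply: h1|exists y].
- by move=> z /h3 [y [yd <-]]; exists (a [+] y); split; [apply: tr'|exists y].
- by move=> x z z' _ _ _ [y [_ [-> ->]]] [y' [_ [/og_addIl -> // ->]]].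
- move=> x x' z _ _ _ [y [yd [-> ->]]] [y' [yd' [-> e]]].
  by rewrite (h2 y y').
Qed.

Local Notation oi := (@og_itv L M).

Lemma oi_ddef a b : D1 i i (oi a b) (oi a b).
Proof. by rewrite /D1 /og_itv; case: a => [a|]; case: b => [b|] /=; dfb. Qed.

Lemma oi_convex a b x y z : oi a b x -> oi a b y -> ~ lt z x -> ~ lt y z -> oi a b z.
Proof.
rewrite /og_itv; case: a => [a|]; case: b => [b|] /= [? ?] [? ?] ? ?;
  split=> //; lord.
Qed.

Lemma oi_left a b x : oi a b x -> exists y, oi a b y /\ lt y x.
Proof.
rewrite /og_itv; case: a => [a|] /= [ax xb].
  have [y [ay yx]] := om_dense O ax; exists y; split=> //; split=> //.
  by case: b xb => //= b xb; lord.
have [y yx] := om_down O x; exists y; split=> //; split=> //.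
by case: b xb => //= b xb; lord.
Qed.

Lemma oi_right a b x : oi a b x -> exists y, oi a b y /\ lt x y.
Proof.
rewrite /og_itv; case: b => [b|] /= [ax xb].
  have [y [ay yx]] := om_dense O xb; exists y; split=> //; split=> //.
  by case: a ax => //= a ax; lord.
have [y yx] := om_up O x; exists y; split=> //; split=> //.
by case: a ax => //= a ax; lord.
Qed.

(** A point [u] splits (0,1) into two intervals of length at most 1, both of which have charts. The
    left part of the given interval is mapped to (0,u) through (0,1), [w] to [u], and the right part
    to (u,1). *)
Lemma charted_glue a b w : oi a b w -> charted (oi a (Some w)) ->
  charted (oi (Some w) b) -> charted (oi a b).
Proof.
move=> abw [f [df [f1 f2 f3]]] [g [dg [g1 g2 g3]]].
have [u [u0 u1]] := tg_half T.
have h01 := tg_one T.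
have [|p [dp [p1 p2 p3]]] := @charted_itv zero u u0; first by rewrite og_add0l //; lord.
have [|q [dq [q1 q2 q3]]] := @charted_itv u (og_one one M) u1.
  have h : ~ lt (u [+] og_one one M) (zero [+] og_one one M) by move/(og_ltr Gp); lord.
  by rewrite og_add0l in h.
have dS := oi_ddef a b.
have sl x : oi a b x -> lt x w -> oi a (Some w) x by rewrite /og_itv /= => -[].
have sr x : oi a b x -> lt w x -> oi (Some w) b x by rewrite /og_itv /= => -[].
have sl' x : oi a (Some w) x -> oi a b x.
  rewrite /og_itv /= => -[ax xw]; split=> //.
  by move: abw; rewrite /og_itv; case: b {g1 g2 g3 dS sl sr} => //= b [_ wb]; lord.
have sr' x : oi (Some w) b x -> oi a b x.
  rewrite /og_itv /= => -[wx xb]; split=> //.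
  by move: abw; rewrite /og_itv; case: a {f1 f2 f3 dS sl sr sl'} => //= a [aw _]; lord.
pose R x y := (lt x w /\ lt y u /\ f x = p y) \/ (x = w /\ y = u) \/
  (lt w x /\ lt u y /\ g x = q y).
apply: (charted_rel (R := R)) => //.
- by rewrite /D2 /R; dfb.
- move=> x abx; case: (pselect (lt x w)) => xw.
    have [y [[y0 yu] py]] := p3 _ (f1 x (sl x abx xw)).
    by exists y; split; [split=> /=; lord|left].
  case: (pselect (lt w x)) => wx.
    have [y [[y0 yu] py]] := q3 _ (g1 x (sr x abx wx)).
    by exists y; split; [split=> /=; lord|right; right].
  by exists u; split=> //; right; left; split=> //; lord.
- move=> y [/= y0 y1]; case: (pselect (lt y u)) => yu.
    have [x [ax fx]] := f3 _ (p1 y (conj y0 yu)).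
    exists x; split; first exact: sl'.
    by left; split=> //; case: ax.
  case: (pselect (lt u y)) => uy.
    have [x [ax fx]] := g3 _ (q1 y (conj uy y1)).
    exists x; split; first exact: sr'.
    by right; right; split=> //; case: ax.
  by exists w; split=> //; right; left; split=> //; lord.
- move=> x y y' abx [/= y0 y1] [/= y0' y1'].
  case=> [[xw [yu e]]|[[xw yu]|[wx [uy e]]]];
  case=> [[xw' [yu' e']]|[[xw' yu']|[wx' [uy' e']]]];
    [by apply: p2 => //; rewrite -e -e'|exfalso|exfalso|exfalso|by rewrite yu yu'
    |exfalso|exfalso|exfalso|by apply: q2 => //; rewrite -e -e']; lord.
- move=> x x' y abx abx' [/= y0 y1].
  case=> [[xw [yu e]]|[[xw yu]|[wx [uy e]]]];
  case=> [[xw' [yu' e']]|[[xw' yu']|[wx' [uy' e']]]];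
    [by apply: f2; [exact: sl|exact: sl|rewrite e e']|exfalso|exfalso|exfalso
    |by rewrite xw xw'|exfalso|exfalso|exfalso
    |by apply: g2; [exact: sr|exact: sr|rewrite e e']]; lord.
Qed.

(** Induction on the size of [X]: the interval is cut at a point of [X], and the two parts, which
    contain fewer exceptional points, are glued. *)
Lemma charted_pieces (X : M -> Prop) a b : fin X -> (exists x, oi a b x) ->
  (forall a' b', (exists x, oi a' b' x) ->
     (forall x, oi a' b' x -> oi a b x /\ ~ X x) -> charted (oi a' b')) ->
  charted (oi a b).
Proof.
move=> [n]; elim: n X a b => [|n IH] X a b hX [x0 abx0] h.
  by apply: h; [exists x0|move=> x abx; split=> //; apply: hX].
case: (pselect (exists w, oi a b w /\ X w)) => [[w [abw Xw]]|nX]; last first.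
  by apply: h; [exists x0|move=> x abx; split=> // Xx; apply: nX; exists x].
have [y [aby yw]] := oi_left abw; have [z [abz wz]] := oi_right abw.
apply: (charted_glue abw).
- apply: (IH _ _ _ (hX w Xw)); first by exists y; case: aby.
  move=> a' b' ne sub; apply: h => // x /sub [[ax xw] nX]; split.
    by split=> //; case: abw => _; case: b {abx0 aby abz sub} => //= b wb; move: xw => /=; lord.
  by move=> Xx; apply: nX; split=> // e; rewrite e /= in xw; lord.
- apply: (IH _ _ _ (hX w Xw)); first by exists z; case: abz.
  move=> a' b' ne sub; apply: h => // x /sub [[wx xb] nX]; split.
    by split=> //; case: abw; case: a {abx0 aby abz sub} => //= a aw _; move: wx => /=; lord.
  by move=> Xx; apply: nX; split=> // e; rewrite e /= in wx; lord.
Qed.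

(** By connectedness the set where [f] is below [t] has a boundary point in the interval, and by
    continuity [f] can only have the value [t] there. *)
Lemma intermediate_value f a b x y t : F1 i i f f ->
  (forall x, oi a b x -> cont lt lt f x) -> oi a b x -> oi a b y ->
  lt (f x) t -> lt t (f y) -> exists s, oi a b s /\ f s = t.
Proof.
move=> df cf abx aby xt ty.
have dS : D1 i i (fun s => lt (f s) t) (fun s => lt (f s) t) by rewrite /D1; dfb.
have [s [abs hs]] : exists s, oi a b s /\ bd lt (fun s => lt (f s) t) s.
  apply: contrapT => H.
  have nb s : oi a b s -> ~ bd lt (fun s => lt (f s) t) s.
    by move=> ? ?; apply: H; exists s.
  case: (pselect (lt y x)) => yx.
    have := connect O (x := y) (y := x) dS ltac:(lord) (fun s h1 h2 =>
      nb s (oi_convex aby abx h1 h2)).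
    by move=> [_ /(_ xt)]; lord.
  have := connect O (x := x) (y := y) dS ltac:(lord) (fun s h1 h2 =>
      nb s (oi_convex abx aby h1 h2)).
  by move=> [/(_ xt)]; lord.
exists s; split=> //; apply: contrapT => ne.
have [h|h] : lt (f s) t \/ lt t (f s) by lord.
  apply: (locally_not_bd _ hs); apply: locally_imp (contR O (cf s abs) h) => z zt.
  by split.
apply: (locally_not_bd _ hs); apply: locally_imp (contL O (cf s abs) h) => z zt.
by split; lord.
Qed.

(** The image has no least and no greatest element and is convex by the intermediate value property,
    so it is an open interval inside (0,1). Its length is at most 1, hence it has a chart, which is
    composed with [f]. *)
Lemma charted_open_image f a b : F1 i i f f -> (exists x, oi a b x) ->
  (forall x, oi a b x -> unit (f x)) ->
  (forall x, oi a b x -> cont lt lt f x) ->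
  (forall x y, oi a b x -> oi a b y -> f x = f y -> x = y) ->
  (forall x, oi a b x -> exists y z, oi a b y /\ oi a b z /\ lt (f y) (f x) /\ lt (f x) (f z)) ->
  charted (oi a b).
Proof.
move=> df [x0 abx0] fu cf inj op; have dS := oi_ddef a b.
pose X y := exists x, oi a b x /\ f x = y.
have dX : D1 i i X X by rewrite /D1 /X; dfb.
have ne : exists y, X y by exists (f x0), x0.
have [||s1 [up sap]] := om_sup O dX.
- by [].
- by exists (og_one one M) => y [x [/fu [_ /= h] <-]]; lord.
have [||s0 [lo iap]] := om_inf O dX.
- by [].
- by exists zero => y [x [/fu [/= h _] <-]]; lord.
have XE y : X y <-> itv lt s0 s1 y.
  split=> [[x [abx <-]]|[/iap [y0 [[x0' [? <-]] ?]] /sap [y1 [[x1 [? <-]] ?]]]].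
    have [y' [z' [aby [abz [h1 h2]]]]] := op x abx.
    have g1 : ~ lt (f y') s0 by apply: lo; exists y'.
    have g2 : ~ lt s1 (f z') by apply: up; exists z'.
    by split; lord.
  exact: (intermediate_value (x := x0') (y := x1) df cf).
have /XE [s0x xs1] : X (f x0) by exists x0.
have s00 : ~ lt s0 zero by move=> /iap [y [[x [/fu [/= h _] <-]] ?]]; lord.
have s11 : ~ lt (og_one one M) s1 by move=> /sap [y [[x [/fu [_ /= h] <-]] ?]]; lord.
have h1 : ~ lt (s0 [+] og_one one M) (zero [+] og_one one M) by move=> /(og_ltr Gp).
rewrite og_add0l // in h1.
have [||h [dh [hu hi hs]]] := @charted_itv s0 s1; [lord|lord|].
have fitv x : oi a b x -> itv lt s0 s1 (f x) by move=> abx; apply/XE; exists x.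
exists (fun x => h (f x)); split; first by rewrite /F1; dfb.
split.
- by move=> x /fitv; apply: hu.
- by move=> x y abx aby /hi e; apply: inj => //; apply: e; apply: fitv.
- by move=> y /hs [z [/XE [x [abx <-]] <-]]; exists x.
Qed.

Lemma locinc_open lt' f a b x : oi a b x -> locinc lt lt' f x ->
  exists y z, oi a b y /\ oi a b z /\ lt' (f y) (f x) /\ lt' (f x) (f z).
Proof.
move=> abx [l [r [lx [xr [h1 h2]]]]].
have [y [aby yx]] := oi_left abx; have [z [abz xz]] := oi_right abx.
have [y' [yy' [ly' y'x]]] : exists y', ~ lt y' y /\ lt l y' /\ lt y' x.
  case: (pselect (lt l y)) => ?; first by exists y; lord.
  by have [w [? ?]] := om_dense O lx; exists w; lord.
have [z' [zz' [rz' xz']]] : exists z', ~ lt z z' /\ lt z' r /\ lt x z'.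
  case: (pselect (lt z r)) => ?; first by exists z; lord.
  by have [w [? ?]] := om_dense O xr; exists w; lord.
exists y', z'; split; first by apply: oi_convex aby abx _ _ => //; lord.
split; first by apply: oi_convex abx abz _ _ => //; lord.
by split; [apply: h1|apply: h2].
Qed.

Lemma locinc_inj lt' f a b : omin lt' -> F1 i i f f ->
  (forall x, oi a b x -> locinc lt lt' f x) ->
  forall x y, oi a b x -> oi a b y -> f x = f y -> x = y.
Proof.
move=> O' df li.
have inc x y : oi a b x -> oi a b y -> lt x y -> lt' (f x) (f y).
  move=> abx aby xy; have [c [abc cx]] := oi_left abx; have [d [abd yd]] := oi_right aby.
  apply: (locinc_inc O O' df (a := c) (b := d)) => //; try by split; lord.
  by move=> z [cz zd]; apply: li; apply: oi_convex abc abd _ _; lord.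
move=> x y abx aby e; apply: contrapT => ne.
have irr := lo_irr (om_lin O').
have [h|h] : lt x y \/ lt y x by lord.
  by have := inc x y abx aby h; rewrite e; apply: irr.
by have := inc y x aby abx h; rewrite e; apply: irr.
Qed.

Lemma monotonicity_family m (g : nat -> M -> M) a b :
  (forall k, k < m -> F1 i i (g k) (g k)) -> lt a b ->
  exists c d, subitv lt a b c d /\ forall k, k < m ->
  [\/ forall x y, itv lt c d x -> itv lt c d y -> g k x = g k y,
      forall x, itv lt c d x -> locinc lt lt (g k) x /\ cont lt lt (g k) x
    | forall x, itv lt c d x -> locinc lt (fun x y => lt y x) (g k) x /\ cont lt lt (g k) x].
Proof.
elim: m => [|m IH] dg ab; first by exists a, b; split=> //; split; [|split]; lord.
have [|//|c [d [s1 h]]] := IH; first by move=> k km; apply: dg; lia.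
have cd : lt c d by case: s1 => _ [].
have [c' [d' [s2 [hc hm]]]] := monotonicity O O (dg m (leqnn _)) cd.
exists c', d'; split; first exact: subitv_trans s1 s2.
have sub x : itv lt c' d' x -> itv lt c d x by apply: subitv_itv.
move=> k; rewrite ltnS leq_eqVlt => /orP [/eqP ->|/h {}h].
  case: hm => hm; [constructor 1|constructor 2|constructor 3] => // x hx;
    by split; [apply: hm|apply: hc].
case: h => h; [constructor 1|constructor 2|constructor 3].
- by move=> x y /sub hx /sub hy; apply: h.
- by move=> x /sub; apply: h.
- by move=> x /sub; apply: h.
Qed.

(* An interval that maps definably with finite fibres to a power of (0,1) is a
   finite union of points and of intervals on which some coordinate is strictly
   monotone and continuous, hence in bijection with a subinterval of (0,1). *)
Lemma charted_finite_fibres m (g : nat -> M -> M) a b :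
  (forall k, k < m -> F1 i i (g k) (g k)) -> (exists x, oi a b x) ->
  (forall k x, k < m -> oi a b x -> unit (g k x)) ->
  (forall x, oi a b x -> fin (fun y => oi a b y /\ forall k, k < m -> g k y = g k x)) ->
  charted (oi a b).
Proof.
move=> dg ne gu ff; have dS := oi_ddef a b.
pose gt x y := lt y x.
pose I k x := locinc lt lt (g k) x /\ cont lt lt (g k) x.
pose D k x := locinc lt gt (g k) x /\ cont lt lt (g k) x.
have dI k : k < m -> D1 i i (I k) (I k).
  by move=> /dg dgk; rewrite /D1 /I /locinc /cont; dfb.
have dD k : k < m -> D1 i i (D k) (D k).
  by move=> /dg dgk; rewrite /D1 /D /locinc /cont /gt; dfb.
pose bad x := oi a b x /\ forall k, k < m -> ~ I k x /\ ~ D k x.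
have dbad : D1 i i bad bad.
  apply: t_and; first exact: dS.
  apply: (t_forall_lt (P := fun k v => ~ I k (v 0) /\ ~ D k (v 0))
    (P' := fun k v => ~ I k (v 0) /\ ~ D k (v 0))) => k km.
  by have ? := dI k km; have ? := dD k km; dfb.
(* On an interval of bad points, [monotonicity_family] would give a subinterval on which every
   coordinate is constant, and this subinterval would lie in one finite fibre. *)
have fbad : fin bad.
  apply: (fin_no_itvT O dbad) => c d cd; apply: contrapT => H.
  have hb x : itv lt c d x -> bad x.
    by move=> cdx; apply: contrapT => nb; apply: H; exists x.
  have [c' [d' [s1 hm]]] := monotonicity_family dg cd.
  have cd' : lt c' d' by case: s1 => _ [].
  have hb' x : itv lt c' d' x -> bad x by move=> hx; apply: hb; apply: subitv_itv s1 hx.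
  have [x [cx xd]] := om_dense O cd'; have [abx nID] := hb' x (conj cx xd).
  have cst k y : k < m -> itv lt c' d' y -> g k y = g k x.
    move=> km hy; have [nI nD] := nID k km; case: (hm k km) => h.
    - exact: h.
    - by case: nI; apply: h.
    - by case: nD; apply: h.
  apply: (itv_not_fin O cd' _ (ff x abx)) => y cy yd.
  split; first by have [] := hb' y (conj cy yd).
  by move=> k km; apply: cst.
(* Between these points the monotonicity behaviour of each coordinate does not change, so what one
   coordinate does at a single point [x0] it does on the whole piece. *)
have fbd : fin (fun t => exists k, k < m /\ (bd lt (I k) t \/ bd lt (D k) t)).
  apply: (fin_lt (F := fun k t => bd lt (I k) t \/ bd lt (D k) t)) => k km.
  by apply: fin_union; apply: (om_bd O); [apply: dI|apply: dD].
apply: (charted_pieces (fin_union fbad fbd) ne) => a' b' [x0 abx0] sub.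
have [abx0' nX] := sub x0 abx0.
have [k [km hk]] : exists k, k < m /\ (I k x0 \/ D k x0).
  apply: contrapT => H; apply: nX; left; split=> // k km.
  by split=> h; apply: H; exists k; split=> //; [left|right].
have spread (S : M -> Prop) : D1 i i S S -> (forall t, oi a' b' t -> ~ bd lt S t) ->
    S x0 -> forall x, oi a' b' x -> S x.
  move=> dS' nb Sx0 x abx; case: (pselect (lt x x0)) => xx.
    apply: (iffRL (connect O (x := x) (y := x0) dS' ltac:(lord) _)) => // t ? ?.
    by apply: nb; apply: (oi_convex abx abx0).
  apply: (iffLR (connect O dS' xx _)) => // t ? ?.
  by apply: nb; apply: (oi_convex abx0 abx).
have gu' x : oi a' b' x -> unit (g k x) by move=> /sub [abx _]; apply: gu.
have dgk := dg k km.
case: hk => hk.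
  have all := spread _ (dI k km) _ hk.
  have {}all x : oi a' b' x -> I k x.
    by apply: all => t /sub [_ nXt] bt; apply: nXt; right; exists k; split=> //; left.
  apply: (charted_open_image dgk) => //; first by exists x0.
  - by move=> x /all [].
  - by apply: (locinc_inj O) => // x /all [].
  - by move=> x abx; apply: locinc_open => //; case: (all x abx).
have all := spread _ (dD k km) _ hk.
have {}all x : oi a' b' x -> D k x.
  by apply: all => t /sub [_ nXt] bt; apply: nXt; right; exists k; split=> //; right.
apply: (charted_open_image dgk) => //; first by exists x0.
- by move=> x /all [].
- by apply: (locinc_inj (omin_flip O)) => // x /all [].
- move=> x abx; have [y [z [? [? [? ?]]]]] := locinc_open abx (proj1 (all x abx)).
  by exists z, y.
Qed.
End Charts.

(** * Position of a point relative to a finite set *)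

Section Counting.
Variables (T : Type) (lt : T -> T -> Prop).
Hypothesis O : lin_order lt.

Definition exactly (j : nat) (X : T -> Prop) : Prop :=
  atm j X /\ if j is j'.+1 then ~ atm j' X else True.

Lemma fin_exactly X : fin X -> exists j, exactly j X.
Proof.
move=> [n]; elim: n => [|n IH] h; first by exists 0.
by case: (pselect (atm n X)) => [/IH //|nh]; exists n.+1.
Qed.

Definition rank_at (E : T -> Prop) (j : nat) (t : T) : Prop :=
  exactly j (fun s => E s /\ lt s t).

(** A point of [E] in this gap would count below [t2] but not below [t1], and the two counts would
    differ. *)
Lemma rank_at_gap E j t1 t2 r : rank_at E j t1 -> rank_at E j t2 ->
  ~ lt r t1 -> lt r t2 -> ~ E r.
Proof.
move=> [_ h1] [h2 _] rt1 rt2 Er.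
case: j h1 h2 => [|j] h1 h2; first by case: (h2 r).
apply: h1; apply: atm_sub (h2 r (conj Er rt2)) => s [Es st]; split; last first.
  by move=> e; rewrite e in st.
by split=> //; lord.
Qed.

Lemma rank_at_between E j t1 t2 s : rank_at E j t1 -> rank_at E j t2 ->
  ~ lt s t1 -> ~ lt t2 s -> rank_at E j s.
Proof.
move=> h1 h2 st1 ts2; have gap := rank_at_gap h1 h2.
rewrite /rank_at (_ : (fun r => E r /\ lt r s) = (fun r => E r /\ lt r t1)) //.
apply: funext => r; apply/propext; split=> -[Er rs]; split=> //; last by lord.
by apply: contrapT => rt1; apply: (gap r) => //; lord.
Qed.
End Counting.

(** The last coordinate is chosen among those at which the functions provided by induction for the
    other coordinates give a solution; these functions are then evaluated at it. *)
Lemma definable_tuple_choice (L : signature) (M : structure L)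
    (lt : M -> M -> Prop) m (R : (nat -> M) -> Prop) : omin lt -> picks lt -> M ->
  ddef R R -> exists s : nat -> (nat -> M) -> M,
  (forall k, tfun (@id M) (@id M) (s k) (s k)) /\
  forall v, (exists u, R (ncat m u v)) -> R (ncat m (fun k => s k v) v).
Proof.
move=> O K o; have E0 (u v : nat -> M) : ncat 0 u v = v.
  by apply: funext => k; rewrite /ncat subn0.
elim: m R => [|m IH] R dR.
  exists (fun k v => v k); split; first by move=> k; apply: tfun_var.
  by move=> v [u]; rewrite !E0.
have [s [ds hs]] := IH R dR.
pose R1 v y := R (ncat m (fun k => s k (scons y v)) (scons y v)).
have [|t [dt ht]] := @definable_choice _ _ lt R1 O K o.
  have H : tdef (@id M) (@id M) (fun v => R (fun j => ncat m (fun k => s k v) v j))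
      (fun v => R (fun j => ncat m (fun k => s k v) v j)).
    apply: (t_sub (s := fun j v => ncat m (fun k => s k v) v j)
      (s' := fun j v => ncat m (fun k => s k v) v j) dR) => k.
    by rewrite /ncat; case: (k < m); [apply: ds|apply: tfun_var].
  apply: t_ext H => v; rewrite /R1;
    by rewrite (_ : scons (v 0) (fun k => v k.+1) = v) //; apply: funext => -[].
exists (fun k v => if k < m then s k (scons (t v) v) else t v); split.
  move=> k; case: (k < m) => //.
  apply: (tfun_app0 (s := fun j v => scons (t v) v j) (s' := fun j v => scons (t v) v j) (ds k)).
  by case=> [|j] //=; apply: tfun_var.
move=> v [u]; rewrite !ncatSr ltnn => Ru.
have := ht v (u m) (hs _ (ex_intro _ u Ru)); rewrite /R1.
rewrite (_ : ncat m _ _ = ncat m (fun k => if k < m then s k (scons (t v) v) else t v)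
  (scons (t v) v)) //.
by apply: funext => k; rewrite /ncat; case: (k < m).
Qed.

(** * Charts and the closure operator *)

Section Closure.
Variables (L : signature) (one : csym L) (M : structure (og_expansion L)).
Hypothesis TM : tame one M.
Let T := tm_group TM.
Let O := tm_omin TM.
Let Gp := tg_group T.
Let Ol := og_lin Gp.
Local Notation "x [+] y" := (@og_add L M x y) (at level 50, left associativity).
Local Notation lt := (@og_lt L M).
Local Notation oi := (@og_itv L M).
Let i : M -> M := @id M.
Let dadd : F2 i i (@og_add L M) (@og_add L M) := d_add i i.
Let dlt : D2 i i lt lt := d_lt i i.

Lemma convex_open_itv (S : M -> Prop) : D1 i i S S -> (exists x, S x) ->
  (forall x y z, S x -> S y -> ~ lt z x -> ~ lt y z -> S z) ->
  (forall x, S x -> exists y z, S y /\ S z /\ lt y x /\ lt x z) ->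
  exists a b, forall x, S x <-> oi a b x.
Proof.
move=> dS ne cv op.
have [a ha] : exists a, forall x, (above lt a x <-> exists y, S y /\ lt y x).
  case: (pselect (exists u, forall x, S x -> ~ lt x u)) => [bdd|nb].
    have [s [h1 h2]] := om_inf O dS ne bdd; exists (Some s) => x; split; first exact: h2.
    by move=> [y [/h1 ? ?]] /=; lord.
  exists None => x; split=> // _; apply: contrapT => h; apply: nb; exists x => y Sy yx.
  by apply: h; exists y.
have [b hb] : exists b, forall x, (above (fun x y => lt y x) b x <-> exists y, S y /\ lt x y).
  case: (pselect (exists u, forall x, S x -> ~ lt u x)) => [bdd|nb].
    have [s [h1 h2]] := om_sup O dS ne bdd; exists (Some s) => x; split; first exact: h2.
    by move=> [y [/h1 ? ?]] /=; lord.
  exists None => x; split=> // _; apply: contrapT => h; apply: nb; exists x => y Sy yx.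
  by apply: h; exists y.
exists a, b => x; split=> [/op [y [z [? [? [? ?]]]]]|[/ha [y [Sy yx]] /hb [z [Sz xz]]]].
  by split; [apply/ha; exists y|apply/hb; exists z].
by apply: (cv y z) => //; lord.
Qed.

Lemma charted_short (a b : option M) : charted one (oi a b) ->
  short_interval one (oi a b).
Proof.
move=> [h [dh [h1 h2 h3]]]; split; first by exists a, b.
exists h; split.
  split.
  - by move=> x /h1.
  - by move=> x y; rewrite !inE; apply: h2.
  - by move=> y /h3 [x [? <-]]; exists x.
have dS := oi_ddef a b.
have [phi [hphi _]] : ddef (fun v => oi a b (v 0) /\ v 1 = h (v 0))
    (fun v => oi a b (v 0) /\ v 1 = h (v 0)) by dfb.
pose p (c : M) : {c : M | [set: M] c} := exist _ c I.
exists (to_formula (inl tt : csym (og_expansion L)) 2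
  (fsub (TV (og_expansion L) _) (fun c => TP _ (p c)) phi)) => v.
rewrite sat_to_formula fsat_sub /= -(hphi (ext _ v)).
have e0 := ext_ord (inl tt : csym (og_expansion L)) v ord0.
have e1 := ext_ord (inl tt : csym (og_expansion L)) v ord_max.
by rewrite /= in e0 e1; rewrite e0 e1.
Qed.

Lemma scl_charted A (S : M -> Prop) x : definable_over1 A S ->
  (exists a b, forall y, S y <-> oi a b y) -> charted one S -> S x -> scl one A x.
Proof.
move=> dS [a [b hS]] cS Sx; exists S; split=> //.
have -> : S = oi a b by apply: funext => y; apply/propext.
by apply: charted_short; apply: charted_ext cS.
Qed.

(** Two intervals of length 1 are glued at [e]. The result is definable from [e], so a point
    definable over a set belongs to the closure of that set. *)
Lemma charted_point (e : M) : exists a b, oi (Some a) (Some b) e /\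
  (a [+] og_one one M = e /\ b = e [+] og_one one M) /\
  charted one (oi (Some a) (Some b)).
Proof.
have [a ae] := og_solver Gp (og_one one M) e.
have h01 := tg_one T.
have ae' : lt a e by rewrite -ae; apply/(og_addp Gp).
have eb : lt e (e [+] og_one one M) by apply/(og_addp Gp).
exists a, (e [+] og_one one M); split; first by split.
split=> //; apply: (charted_glue TM (w := e)); first by split.
- by apply: (charted_itv TM) => //; rewrite ae; lord.
- by apply: (charted_itv TM) => //; lord.
Qed.
End Closure.

(** * Types *)

Section Types.
Variables (L : signature) (M : structure (og_expansion L)) (A : set M).
Let z0 : csym (og_expansion L) := inl tt.
Let C := {a : M | A a}.
Let i : C -> M := @sval M A.

Section OneType.
Variables (n : nat) (p : set (param_formula A n)).
Hypothesis hp : complete_type p.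

(** Membership in the type is attached to the predicate and not to a formula, so that equivalent
    formulas can be exchanged freely. *)
Definition holds_in (P : (nat -> M) -> Prop) : Prop := exists phi : fm (og_expansion L) C,
  p (to_formula z0 n phi) /\ forall v, P v <-> fsat i phi v.

Lemma holds_in_sat k (P : 'I_k -> (nat -> M) -> Prop) :
  (forall j, holds_in (P j)) -> exists v : 'I_n -> M, forall j, P j (ext z0 v).
Proof.
move=> /choice[phi h]; have [|v hv] := hp.1 k (fun j => to_formula z0 n (phi j)).
  by move=> j; have [] := h j.
exists v => j; have [_ hj] := h j; apply/hj/(sat_to_formula z0 i v (phi j)); exact: hv.
Qed.

Lemma holds_in_dec P : tdef i i P P -> holds_in P \/ holds_in (fun v => ~ P v).
Proof.
move=> [phi [h _]]; case: (hp.2 (to_formula z0 n phi)) => hphi.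
  by left; exists phi.
by right; exists (FI phi (FB _ _)); split=> // v /=; rewrite h.
Qed.

(** Closure under conjunction is not part of [complete_type]. If it failed, completeness would put
    [P], [Q] and the negated conjunction into the type, against finite satisfiability. *)
Lemma holds_in_and P Q : tdef i i P P -> tdef i i Q Q ->
  holds_in P -> holds_in Q -> holds_in (fun v => P v /\ Q v).
Proof.
move=> dP dQ hP hQ; have [|//|nPQ] := @holds_in_dec (fun v => P v /\ Q v); first exact: t_and.
have [|v hv] := @holds_in_sat 3 (fun j : 'I_3 => if j == 0 :> nat then P else
  if j == 1 :> nat then Q else fun v => ~ (P v /\ Q v)).
  by case=> [[|[|[|]]]].
have h0 := hv (@Ordinal 3 0 isT); have h1 := hv (@Ordinal 3 1 isT).
by have := hv (@Ordinal 3 2 isT); case.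
Qed.

Lemma holds_in_forall k (P : nat -> (nat -> M) -> Prop) :
  (forall j, j < k -> tdef i i (P j) (P j)) -> (forall j, j < k -> holds_in (P j)) ->
  holds_in (fun v => forall j, j < k -> P j v).
Proof.
move=> dP h; have [|//|nP] := @holds_in_dec (fun v => forall j, j < k -> P j v).
  exact: (t_forall_lt dP).
have [|v hv] := @holds_in_sat k.+1 (fun j => if unlift ord0 j is Some j' then P j'
  else (fun v => ~ forall j, j < k -> P j v)).
  by move=> j; case: unliftP => [j' _|_] //; apply: h.
have := hv ord0; rewrite unlift_none; case=> j jk.
by have := hv (lift ord0 (Ordinal jk)); rewrite liftK.
Qed.

Lemma realized_holds_in (N : structure (og_expansion L)) (e : M -> N) (b : 'I_n -> N) P P' :
  elementary e -> realizes e b p -> tdef i (fun a => e (i a)) P P' -> P' (ext z0 b) ->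
  holds_in P.
Proof.
move=> ee rb [phi [h h']] /h' Pb; exists phi; split=> //.
case: (hp.2 (to_formula z0 n phi)) => // /rb /=.
by move/(_ (iffRL (sat_to_formula z0 (fun a : C => e (i a)) b phi) Pb)).
Qed.
End OneType.

Lemma fm_definable_over (N : structure (og_expansion L)) (e : M -> N) (B : set N)
    (P : (nat -> M) -> M -> Prop) (P' : (nat -> N) -> N -> Prop) (w : nat -> N) :
  E1 i (fun a => e (i a)) P P' -> (forall a, A a -> B (e a)) ->
  (forall k, B (w k) \/ w k = og_zero N) ->
  definable_over1 B (P' w).
Proof.
move=> [phi [_ h]] AB Bw.
pose g (a : C) : {x : N | B x} := exist _ (e (sval a)) (AB _ (svalP a)).
pose t k : tm (og_expansion L) {x : N | B x} :=
  if pselect (B (w k)) is left Bk then TP _ (exist _ (w k) Bk) else TK _ z0.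
exists (to_formula z0 1 (fsub (scons (TV _ _ 0) t) (fun a => TP _ (g a)) phi)) => v.
rewrite sat_to_formula fsat_sub /=.
rewrite (_ : (fun k => teval _ _ _) = scons (v ord0) w); last first.
  apply: funext => -[|k] /=; first exact: (ext_ord z0 v ord0).
  rewrite /t; case: pselect => // nB; by case: (Bw k).
exact: (h (scons (v ord0) w)).
Qed.

Lemma definable_over_image (N : structure (og_expansion L)) (e : M -> N) (B : set N)
    n (S : set ('I_n -> N)) : (forall x, B x -> exists2 a, A a & e a = x) ->
  definable_over B S -> exists phi : fm (og_expansion L) C,
    forall w : nat -> N, S (fun j => w j) <-> fsat (fun a => e (i a)) phi w.
Proof.
move=> BA [phi h].
have /choice[g hg] : forall x : {x : N | B x}, exists a : C, e (i a) = sval x.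
  by move=> x; have [a Aa ax] := BA _ (svalP x); exists (exist _ a Aa).
exists (fsub (TV _ C) (fun x => TP _ (g x)) (of_formula phi)) => w.
rewrite fsat_sub h -(fsat_of_formula (@sval N B) phi w) /=.
by rewrite (_ : (fun x => e (i (g x))) = @sval N B) //; apply: funext.
Qed.
End Types.

Section ShortTypes.
Variables (L : signature) (one : csym L) (M : structure (og_expansion L)) (A : set M).
Let z0 : csym (og_expansion L) := inl tt.
Let C := {a : M | A a}.
Let i : C -> M := @sval M A.

Definition embeds (N : structure (og_expansion L)) (S : N -> Prop) : Prop :=
  exists f, F1 (@id N) (@id N) f f /\ (forall x, S x -> unit_itv one (f x)) /\
  forall x y, S x -> S y -> f x = f y -> x = y.

(** A basis of size 0 means that each coordinate of a realization lies in a short interval definable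
    over the image of A, which gives [sigma]. The bijection with (0,1) may use parameters from the
    extension; these must be brought down to M before other extensions can be treated. *)
Lemma short_type_formulas m (p : set (param_formula A m)) : ordered_group M ->
  complete_type p -> short_type one p -> exists sigma : 'I_m -> fm (og_expansion L) C,
  (forall j : 'I_m, holds_in p (fun v => fsat i (sigma j) (fun=> v j))) /\
  forall j (N : structure (og_expansion L)) (e : M -> N), elementary e ->
    embeds (fun t => fsat (fun a => e (i a)) (sigma j) (fun=> t)).
Proof.
move=> Gp hp [N1 [e1 [b [ee1 rb [s [s0 _ bs]]]]]].
suff /choice[sigma h] : forall j : 'I_m, exists phi : fm (og_expansion L) C,
    holds_in p (fun v => fsat i phi (fun=> v j)) /\
    forall (N : structure (og_expansion L)) (e : M -> N), elementary e ->
      embeds (fun t => fsat (fun a => e (i a)) phi (fun=> t)).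
  by exists sigma; split=> j; have [] := h j.
move=> j; have [S [dS [_ [f [[fS finj _] df]]] Sb]] := bs j.
have {dS} [|phi hphi] := definable_over_image (A := A) (e := e1) _ dS.
  move=> x [[a Aa <-]|[k ks]]; first by exists a.
  by move: ks; rewrite (cards0_eq s0) /= inE.
have SE t : S t <-> fsat (fun a => e1 (i a)) phi (fun=> t) by exact: (hphi (fun=> t)).
exists phi; split.
  apply: (realized_holds_in (e := e1) hp ee1 rb (P' := fun v => fsat (fun a => e1 (i a)) phi (fun=> v j))).
    exists (fsub (fun=> TV _ C j) (@TP _ C) phi); split=> v; by rewrite fsat_sub.
  by rewrite -SE ext_ord.
have [P [dP hP]] := definable_over_ddef df.
have [theta [htheta _]] := dP; have [l [th0 [w hw]]] := fm_elim theta.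
pose D (R : structure (og_expansion L)) (u : nat -> R) x y :=
  fsat (of_void R) th0 (ncat l u (scons x (fun=> y))).
pose unitD (R : structure (og_expansion L)) := @unit_itv L one R.
pose V (R : structure (og_expansion L)) (c : C -> R) x := fsat c phi (fun=> x).
(* With parameters [u], the relation [D] defines an injection of the set given by [phi] into (0,1).
   This is a formula in [u] over A. *)
pose St (R : structure (og_expansion L)) (c : C -> R) (u : nat -> R) :=
  (forall x, V R c x -> exists y, unitD R y /\ D R u x y) /\
  (forall x y y', V R c x -> unitD R y -> unitD R y' -> D R u x y -> D R u x y' -> y = y') /\
  (forall x x' y, V R c x -> V R c x' -> unitD R y ->
     D R u x y -> D R u x' y -> x = x').
have dSt (R R' : structure (og_expansion L)) (c : C -> R) (c' : C -> R') :
    tdef c c' (@St R c) (@St R' c').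
  have dphi : D1 c c' (V R c) (V R' c').
    exists (fsub (fun=> TV _ C 0) (@TP _ C) phi); split=> v; by rewrite fsat_sub.
  have dunit : D1 c c' (unitD R) (unitD R').
    have d1 := d_zero c c'; have d2 := d_one c c' one; have d3 := d_lt c c'.
    by rewrite /D1 /unitD /unit_itv /og_itv /=; dfb.
  have dD : E2 c c' (D R) (D R').
    exists (fsub (fun k => if k < l then TV _ C k.+2 else scons (TV _ C 0) (fun=> TV _ C 1) (k - l))
      (of_void (tm (og_expansion L) C)) th0).
    split=> v; rewrite fsat_sub /D;
      rewrite [X in _ <-> fsat X th0 _]of_voidE;
      (rewrite (_ : (fun k => teval _ _ _) = ncat l (fun k => v k.+2) (scons (v 0) (fun=> v 1)));
       [exact: iff_refl|apply: funext => k; rewrite /ncat; case: (k < l) => //; by case: (k - l)]).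
  by rewrite /St; dfb.
(* The parameters of [f] witness this in the extension; if no [u] in M did, the negation of [St] for
   all [u] would transfer. *)
have [u Su] : exists u, St M i u.
  apply: contrapT => H.
  have N1St := tdef_forall z0 ee1 (i := i) (i' := fun a => e1 (i a)) (fun a => erefl) (t_not (dSt _ _ _ _))
    (fun u h => H (ex_intro _ u h)).
  apply: (N1St (fun k => oapp id (og_zero N1) (w k))).
  have DE x y : D N1 (fun k => oapp id (og_zero N1) (w k)) x y <-> (S x /\ y = f x).
    rewrite /D -(hw N1 (@id N1) (of_void N1) (og_zero N1)) -htheta -(hP (scons x (fun=> y))) /=.
    by [].
  split; last split.
  - move=> x /SE Sx; exists (f x); split; first exact: fS.
    by apply/DE.
  - by move=> x y y' _ _ _ /DE [_ ->] /DE [_ ->].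
  - move=> x x' y _ _ _ /DE [Sx ->] /DE [Sx' e]; apply: finj => //; exact/mem_set.
(* The same [u], now in M, works in every elementary extension of M. *)
move=> N e ee.
have [h1 [h2 h3]] : St N (fun a => e (i a)) (fun k => e (u k)).
  by apply/(tdef_elementary z0 ee (i := i) (fun a => erefl) _ (dSt _ _ _ _)).
set u' := (fun k => e (u k)) in h1 h2 h3.
pose SN t := fsat (fun a => e (i a)) phi (fun=> t).
pose Q (v : nat -> N) y := (SN (v 0) /\ unitD N y /\ D N u' (v 0) y) \/ (~ SN (v 0) /\ y = og_zero N).
have [|||t [dt ht]] := @dfun_of_rel _ _ Q.
- have dS : D1 (@id N) (@id N) SN SN.
    exists (fsub (fun=> TV _ N 0) (fun a => TP _ (e (i a))) phi); split=> v; by rewrite fsat_sub.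
  have dunit : D1 (@id N) (@id N) (unitD N) (unitD N).
    have d1 := d_zero (@id N) (@id N); have d2 := d_one (@id N) (@id N) one.
    have d3 := d_lt (@id N) (@id N).
    by rewrite /D1 /unitD /unit_itv /og_itv /=; dfb.
  have dD : D2 (@id N) (@id N) (D N u') (D N u').
    exists (fsub (fun k => if k < l then TP _ (u' k) else scons (TV _ N 0) (fun=> TV _ N 1) (k - l))
      (of_void (tm (og_expansion L) N)) th0).
    split=> v; rewrite fsat_sub /D;
      rewrite [X in _ <-> fsat X th0 _]of_voidE;
      (rewrite (_ : (fun k => teval _ _ _) = ncat l u' (scons (v 0) (fun=> v 1)));
       [exact: iff_refl|apply: funext => k; rewrite /ncat; case: (k < l) => //; by case: (k - l)]).
  by rewrite /E1 /Q; dfb.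
- move=> v; case: (pselect (SN (v 0))) => Sv; last by exists (og_zero N); right.
  by have [y [Xy Ry]] := h1 _ Sv; exists y; left.
- move=> v y y' [[Sv [Xy Ry]]|[nS ->]] [[Sv' [Xy' Ry']]|[nS' ->]] //.
  exact: h2 Sv Xy Xy' Ry Ry'.
have hS x : SN x -> unitD N (t (fun=> x)) /\ D N u' x (t (fun=> x)).
  by move=> Sx; case: (ht (fun=> x)) => [[]|[]].
exists (fun x => t (fun=> x)); split.
  by apply: (tfun_app0 (s := fun _ v => v 0) (s' := fun _ v => v 0) dt); dfb.
split=> [x /hS []|x y Sx Sy e'] //.
have [Xx Rx] := hS x Sx; have [Xy Ry] := hS y Sy.
by rewrite -e' in Ry; apply: h3 Rx Ry.
Qed.
End ShortTypes.

(** * Eliminating a variable *)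

Section Fibration.
Variables (L : signature) (one : csym L) (C : Type) (m k : nat).
Variable sigma : 'I_m -> fm (og_expansion L) C.

(* Variables below m are the x's; they are followed in [Phi] by the k variables
   y' already treated and by the last y.  In a tuple [w] fed to [slice], the
   last y sits in position m instead, before the y'. *)
Section Definitions.
Variables (R : structure (og_expansion L)) (c : C -> R) (Phi : (nat -> R) -> Prop).
Local Notation lt := (@og_lt L R).

Definition in_box (w : nat -> R) : Prop := forall j, j < m ->
  if insub j is Some j' then fsat c (sigma j') (fun=> w j) else True.

Definition slice (w : nat -> R) (s : R) : Prop :=
  Phi (fun l => if l < m then w l else if l < m + k then w l.+1 else s).

Definition jump_at (w : nat -> R) : Prop := in_box w /\ bd lt (slice w) (w m).

Definition jumps (y : nat -> R) (t : R) : Prop :=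
  exists u, jump_at (ncat m u (scons t y)).

Definition edge (y : nat -> R) (t : R) : Prop := bd lt (jumps y) t.

(* Nodes are the edges and cells the intervals between them, numbered by the
   number of edges below. *)
Definition cell (j : nat) (y : nat -> R) (t : R) : Prop :=
  ~ edge y t /\ rank_at lt (edge y) j t.

Definition node (j : nat) (y : nat -> R) (t : R) : Prop :=
  edge y t /\ rank_at lt (edge y) j t.

(** [slice] passes over position [m], where the tuple carries the point at which the section is
    tested for a jump. *)
Lemma slice_ncat u t t' y : slice (ncat m u (scons t y)) = slice (ncat m u (scons t' y)).
Proof.
apply: funext => s; congr Phi; apply: funext => l; rewrite /ncat.
case: (ltnP l m) => // lm; have -> : l.+1 < m = false by lia.
by have -> : l.+1 - m = (l - m).+1 by lia.
Qed.

Lemma in_box_ncat u y : in_box (ncat m u y) <-> in_box u.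
Proof. by split=> h j jm; have := h j jm; rewrite /ncat jm. Qed.

Lemma cell_convex j y s t r : lin_order lt -> cell j y s -> cell j y t ->
  ~ lt r s -> ~ lt t r -> cell j y r.
Proof.
move=> O [es rs] [et rt] h1 h2; split; last exact: (rank_at_between O rs rt h1 h2).
case: (pselect (r = t)) => [->|ne] //.
by apply: (rank_at_gap O rs rt) => //; lord.
Qed.
End Definitions.

Section Definability.
Variables (R R' : structure (og_expansion L)) (c : C -> R) (c' : C -> R').
Variables (Phi : (nat -> R) -> Prop) (Phi' : (nat -> R') -> Prop).
Hypothesis dPhi : tdef c c' Phi Phi'.
Let dlt : D2 c c' (@og_lt L R) (@og_lt L R') := d_lt c c'.

Lemma d_in_box : tdef c c' (in_box c) (in_box c').
Proof.
apply: t_forall_lt => j jm; case: insubP => [j' _ _|_]; last exact: t_true.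
by exists (fsub (fun=> TV _ C j) (@TP _ C) (sigma j')); split=> v; rewrite fsat_sub.
Qed.

Lemma d_slice : E1 c c' (slice Phi) (slice Phi').
Proof.
apply: (t_sub (s := fun l v => if l < m then v l.+1 else if l < m + k then v l.+2 else v 0)
  (s' := fun l v => if l < m then v l.+1 else if l < m + k then v l.+2 else v 0) dPhi) => l.
by case: (l < m); [apply: tfun_var|case: (l < m + k); apply: tfun_var].
Qed.

Lemma d_jump_at : tdef c c' (jump_at c Phi) (jump_at c' Phi').
Proof.
apply: t_and; first exact: d_in_box.
by have dS := d_slice; rewrite /bd; dfb.
Qed.

Lemma d_jumps : E1 c c' (jumps c Phi) (jumps c' Phi').
Proof.
apply: t_ext (t_exs m d_jump_at) => v; rewrite /jumps;
  by rewrite (_ : scons (v 0) (fun k => v k.+1) = v) //; apply: funext => -[].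
Qed.

Lemma d_edge : E1 c c' (edge c Phi) (edge c' Phi').
Proof. by have dJ := d_jumps; rewrite /E1 /edge /bd; dfb. Qed.

Lemma d_rank j : E1 c c' (fun y => rank_at (@og_lt L R) (edge c Phi y) j)
  (fun y => rank_at (@og_lt L R') (edge c' Phi' y) j).
Proof.
have dE := d_edge; rewrite /E1 /rank_at /exactly; apply: t_and; first by dfb.
by case: j => [|j]; dfb.
Qed.

Lemma d_cell j : E1 c c' (cell c Phi j) (cell c' Phi' j).
Proof. by apply: t_and; [apply: t_not; apply: d_edge|apply: d_rank]. Qed.

Lemma d_node j : E1 c c' (node c Phi j) (node c' Phi' j).
Proof. by apply: t_and; [apply: d_edge|apply: d_rank]. Qed.
End Definability.

Section InTame.
Variables (N : structure (og_expansion L)) (c : C -> N) (Phi : (nat -> N) -> Prop).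
Hypotheses (TN : tame one N) (dPhi : tdef c c Phi Phi).
Hypothesis emb : forall j : 'I_m, embeds one (fun t : N => fsat c (sigma j) (fun=> t)).
Variable y : nat -> N.
Let O := tm_omin TN.
Let Ol := om_lin O.
Local Notation lt := (@og_lt L N).
Let id_of P : tdef c c P P -> tdef (@id N) (@id N) P P.
Proof. exact: (tdef_right (g := c)). Qed.
Let at_y P : E1 c c P P -> D1 (@id N) (@id N) (P y) (P y).
Proof.
move=> /id_of dP.
by apply: (t_sub (s := scons (fun v => v 0) (fun l _ => y l)) (s' := scons (fun v => v 0) (fun l _ => y l)) dP); case=> [|l] /=; dfb.
Qed.

Lemma edge_fin : fin (edge c Phi y).
Proof. by apply: (om_bd O); apply: at_y; apply: d_jumps. Qed.

Lemma cell_or_node t : exists j, cell c Phi j y t \/ node c Phi j y t.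
Proof.
have [|j hj] := @fin_exactly _ (fun s => edge c Phi y s /\ lt s t).
  by apply: fin_sub edge_fin => s [].
by exists j; case: (pselect (edge c Phi y t)) => h; [right|left].
Qed.

Lemma node_uniq j s t : node c Phi j y s -> node c Phi j y t -> s = t.
Proof.
move=> [es rs] [et rt]; apply: contrapT => ne.
have [h|h] : lt s t \/ lt t s by lord.
  by apply: (rank_at_gap Ol rs rt (r := s)) => //; lord.
by apply: (rank_at_gap Ol rt rs (r := t)) => //; lord.
Qed.

(** Edges are finite in number, so an interval around [t] is free of them, and the number of edges
    below is the same throughout that interval. *)
Lemma cell_open j t : cell c Phi j y t ->
  exists a b, cell c Phi j y a /\ cell c Phi j y b /\ lt a t /\ lt t b.
Proof.
move=> [et rt]; have [a0 a0t] := om_down O t; have [b0 tb0] := om_up O t.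
have [b [tb [_ hb]]] := fin_gap O edge_fin tb0.
have [a [_ [at_ ha]]] := fin_gap_left O edge_fin a0t.
have [b' [tb' bb']] := om_dense O tb; have [a' [aa' at']] := om_dense O at_.
have same u v : (forall r, edge c Phi y r -> lt r u <-> lt r v) ->
    rank_at lt (edge c Phi y) j u -> rank_at lt (edge c Phi y) j v.
  move=> h; rewrite /rank_at (_ : (fun s => edge c Phi y s /\ lt s u) = (fun s => edge c Phi y s /\ lt s v)) //.
  by apply: funext => r; apply/propext; split=> -[er]; move: (h r er); tauto.
have gap r : edge c Phi y r -> ~ (lt a r /\ lt r b).
  move=> er [ar rb]; have [h|[h|h]] : lt r t \/ (r = t \/ lt t r) by lord.
  - exact: (ha r ar h er).
  - by apply: et; rewrite -h.
  - exact: (hb r h rb er).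
exists a', b'; split; [|split=> //]; (split; first by move=> er; apply: (gap _ er); lord).
  by apply: same rt => r er; have := gap r er; lord.
by apply: same rt => r er; have := gap r er; lord.
Qed.

(** A cell is convex and contains no boundary point of the set of jumps, so it lies entirely inside
    or entirely outside that set. *)
Lemma cell_jumps j s t : cell c Phi j y s -> cell c Phi j y t ->
  jumps c Phi y s -> jumps c Phi y t.
Proof.
have dJ := at_y (d_jumps dPhi); move=> hs ht.
case: (pselect (lt t s)) => ts.
  apply: (iffRL (connect O (x := t) (y := s) dJ _ _)); first by lord.
  by move=> r h1 h2; have [] := cell_convex Ol ht hs h1 h2.
apply: (iffLR (connect O dJ ts _)).
by move=> r h1 h2; have [] := cell_convex Ol hs ht h1 h2.
Qed.

(** Definable choice assigns to each [t] of the cell a tuple [x t] in the box whose section jumps at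
    [t]. Applying the embeddings [f] coordinatewise gives a definable map to a power of (0,1), as
    [charted_finite_fibres] demands. *)
Lemma cell_charted j : (exists t, cell c Phi j y t) ->
  (forall t, cell c Phi j y t -> jumps c Phi y t) ->
  (exists a b, forall t, cell c Phi j y t <-> og_itv a b t) /\
  charted one (cell c Phi j y).
Proof.
move=> ne sub.
have [|a [b hab]] := convex_open_itv TN (at_y (d_cell dPhi j)) ne _ (@cell_open j).
  by move=> s t r hs ht; apply: cell_convex.
split; first by exists a, b.
have K := tame_picks (tm_group TN).
have [s [ds hs]] := definable_tuple_choice m O K (og_zero N) (id_of (d_jump_at dPhi)).
pose x t l := s l (scons t y).
have dx l : F1 (@id N) (@id N) (fun t => x t l) (fun t => x t l).
  apply: (tfun_app0 (s := fun k v => scons (v 0) y k) (s' := fun k v => scons (v 0) y k) (ds l)).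
  by case=> [|l'] /=; dfb.
have hx t : cell c Phi j y t -> jump_at c Phi (ncat m (x t) (scons t y)).
  by move=> /sub /hs.
have /choice[f hf] := emb.
pose g l t := if insub l is Some l' then f l' (x t l) else t.
have gE l (lm : l < m) t : g l t = f (Ordinal lm) (x t l).
  by rewrite /g (insubT (fun l => l < m) lm).
have xin l (lm : l < m) t : cell c Phi j y t -> fsat c (sigma (Ordinal lm)) (fun=> x t l).
  move=> /hx [/in_box_ncat h _]; have := h l lm.
  by rewrite (insubT (fun l => l < m) lm).
apply: (charted_ext (S := og_itv a b)) => [t|]; first by rewrite hab.
apply: (charted_finite_fibres TN (m := m) (g := g)).
- move=> l lm; have [df _] := hf (Ordinal lm).
  have -> : g l = fun t => f (Ordinal lm) (x t l) by apply: funext => t; rewrite gE.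
  by have dxl := dx l; rewrite /F1; dfb.
- by have [t /hab ?] := ne; exists t.
- move=> l t lm /hab ct; rewrite gE; have [_ [h _]] := hf (Ordinal lm).
  by apply: h; apply: xin.
(* Points of the same fibre have the same tuple [x t], because the embeddings are injective; so all
   of them are boundary points of one section, which has only finitely many. *)
- move=> t0 /hab c0.
  have dsec : D1 (@id N) (@id N) (slice Phi (ncat m (x t0) (scons t0 y)))
      (slice Phi (ncat m (x t0) (scons t0 y))).
    apply: (t_sub (s := scons (fun v => v 0) (fun l _ => ncat m (x t0) (scons t0 y) l))
       (s' := scons (fun v => v 0) (fun l _ => ncat m (x t0) (scons t0 y) l)) (id_of (d_slice dPhi))).
    by case=> [|l] /=; dfb.
  apply: fin_sub (om_bd O dsec) => t [/hab ct gt].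
  have [_ bt] := hx t ct.
  have E : slice Phi (ncat m (x t) (scons t y)) = slice Phi (ncat m (x t0) (scons t0 y)).
    rewrite (slice_ncat _ _ _ t0).
    congr (slice Phi _); apply: funext => l; rewrite /ncat; case: ifP => // lm.
    have := gt l lm; rewrite !gE; have [_ [_ inj]] := hf (Ordinal lm).
    by apply: inj; apply: xin.
  by move: bt; rewrite E /ncat ltnn subnn.
Qed.
End InTame.
End Fibration.

(** * Induction on the length of [q], and the theorem *)

Section Orthogonality.
Variables (L : signature) (one : csym L) (M : structure (og_expansion L)) (A : set M).
Let z0 : csym (og_expansion L) := inl tt.
Let C := {a : M | A a}.
Let i : C -> M := @sval M A.
Hypothesis TM : tame one M.
Variables (m n : nat) (p : set (param_formula A m)) (q : set (param_formula A n)).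
Hypotheses (hp : complete_type p) (hq : complete_type q).
Variable sigma : 'I_m -> fm (og_expansion L) C.
Hypothesis p_sigma : forall j : 'I_m, holds_in p (fun v => fsat i (sigma j) (fun=> v j)).
Hypothesis emb : forall j (N : structure (og_expansion L)) (e : M -> N), elementary e ->
  embeds one (fun t => fsat (fun a => e (i a)) (sigma j) (fun=> t)).
Variables (N : structure (og_expansion L)) (e : M -> N) (c : 'I_n -> N).
Hypotheses (ee : elementary e) (rc : realizes e c q).
Hypothesis indep : forall j, ~ scl one (e @` A `|` [set c l | l in [set l | l <> j]]) (c j).
Let i' : C -> N := fun a => e (i a).
Let O := tm_omin TM.
Let Ol := om_lin O.
Let TN : tame one N := tame_extend ee TM.

Definition cut (R : structure (og_expansion L)) k (w : nat -> R) : nat -> R :=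
  fun l => if l < k then w l else og_zero R.

Lemma avoid_jumps k (kn : k < n) Phi Phi' : tdef i i' Phi Phi' -> exists j,
  cell k sigma i' Phi' j (cut k (ext z0 c)) (ext z0 c k) /\
  forall s, cell k sigma i' Phi' j (cut k (ext z0 c)) s ->
    ~ jumps k sigma i' Phi' (cut k (ext z0 c)) s.
Proof.
move=> dPhi; set y := cut k _.
have dPhi' : tdef i' i' Phi' Phi'.
  by apply: (tdef_right (k := i') (g := id) _ dPhi).
have emb' j := emb j ee.
have extc : ext z0 c k = c (Ordinal kn) by exact: (ext_ord z0 c (Ordinal kn)).
set B := e @` A `|` [set c l | l in [set l | l <> Ordinal kn]].
have AB a : A a -> B (e a) by left; exists a.
have By l : B (y l) \/ y l = og_zero N.
  rewrite /y /cut; case: ltnP => lk; last by right.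
  left; right; have ln : l < n by lia.
  exists (Ordinal ln); last by rewrite -(ext_ord z0 c (Ordinal ln)).
  by move=> /= [lk']; lia.
have nB S : definable_over1 B S -> (exists a b, forall t, S t <-> og_itv a b t) ->
    charted one S -> ~ S (ext z0 c k).
  by move=> dS iS cS Sc; apply: (@indep (Ordinal kn)); rewrite -extc; apply: scl_charted cS Sc.
have [j [hj|hj]] := cell_or_node k sigma TN dPhi' y (ext z0 c k); exists j; last first.
  exfalso.
  (* The interval of radius 1 around the [j]-th node. A node is determined by its number, so this
     interval is definable over [B], and it is short by [charted_point]. *)
  pose P (R : structure (og_expansion L)) (D : (nat -> R) -> R -> Prop) (w : nat -> R) t :=
    exists s, D w s /\ exists a, og_add a (og_one one R) = s /\
      og_lt a t /\ og_lt t (og_add s (og_one one R)).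
  have dP : E1 i i' (P M (node k sigma i Phi j)) (P N (node k sigma i' Phi' j)).
    have d1 := d_node k sigma dPhi j; have d2 := d_add i i'; have d3 := d_lt i i'.
    by have d4 := d_one i i' one; rewrite /E1 /P; dfb.
  have [a [b [ab [[ae be] ch]]]] := charted_point TN (ext z0 c k).
  have PE t : P N (node k sigma i' Phi' j) y t <-> og_itv (Some a) (Some b) t.
    split=> [[s [hs [a' [a's [h1 h2]]]]]|[/= h1 h2]].
      have es := node_uniq TN hs hj; rewrite es in a's h2.
      rewrite /og_itv /= be; split=> //.
      by rewrite -ae in a's; rewrite -(og_addIr (tg_group (tm_group TN)) a's).
    exists (ext z0 c k); split=> //; exists a; split=> //; split=> //.
    by rewrite -be.
  apply: (nB _ (fm_definable_over dP AB By)).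
  - by exists (Some a), (Some b) => t.
  - by apply: charted_ext ch => t; rewrite PE.
  - by apply/PE.
split=> // s hs hjs.
have [iJ cJ] := cell_charted TN dPhi' emb' (ex_intro _ s hs)
  (fun t ht => cell_jumps TN dPhi' hs ht hjs).
exact: (nB _ (fm_definable_over (d_cell k sigma dPhi j) AB By) iJ cJ).
Qed.

Definition depends_below (R : Type) l (P : (nat -> R) -> Prop) : Prop :=
  forall v v', (forall j, j < l -> v j = v' j) -> P v -> P v'.

Lemma holds_in_tdef l (r : set (param_formula A l)) P : holds_in r P ->
  exists P', tdef i i' P P'.
Proof. by move=> [phi [_ h]]; exists (fsat i' phi); exists phi. Qed.

Lemma tdefl P P' : tdef i i' P P' -> tdef i i P P.
Proof. by move=> [phi [h _]]; exists phi. Qed.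

(** For [k = 0] the predicate concerns [x] alone and completeness of [p] decides it. In the step,
    the last coordinate is replaced by an unspecified point of its cell, on which the truth value
    does not depend. *)
Lemma decide k : k <= n -> forall Phi Phi', tdef i i' Phi Phi' ->
  depends_below (m + k) Phi -> exists P Q, holds_in p P /\ holds_in q Q /\
  ((forall v w, P v -> Q w -> Phi (ncat m v w)) \/
   (forall v w, P v -> Q w -> ~ Phi (ncat m v w))).
Proof.
elim: k => [|k IH] kn Phi Phi' dPhi low.
  have hT : holds_in q (fun=> True).
    have [//|nT] := holds_in_dec hq (t_true i i).
    by have [|v /(_ ord0) []] := @holds_in_sat _ _ _ _ _ hq 1 (fun=> fun=> ~ True).
  have low' v w : Phi v <-> Phi (ncat m v w).
    by split; apply: low => j jm; rewrite /ncat ifT //; lia.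
  case: (holds_in_dec hp (tdefl dPhi)) => h.
    by exists Phi, (fun=> True); split=> //; split=> //; left=> v w /low'.
  exists (fun v => ~ Phi v), (fun=> True); split=> //; split=> //; right=> v w nv _.
  by move=> /(low' v w).
have [j [cj nj]] := avoid_jumps kn dPhi.
have dcell := d_cell k sigma dPhi j.
have djumps := d_jumps k sigma dPhi.
(* [Phi] with the last coordinate quantified over the [j]-th cell. The cell is determined by the
   earlier coordinates, so [Psi] depends on the variables below [m + k] only and induction
   applies. *)
pose Psi (R : structure (og_expansion L)) (D : (nat -> R) -> R -> Prop) (F : (nat -> R) -> Prop)
    (v : nat -> R) := exists s, D (cut k (fun l => v (m + l))) s /\
  F (fun l => if l < m + k then v l else s).
have dPsi : tdef i i' (Psi M (cell k sigma i Phi j) Phi) (Psi N (cell k sigma i' Phi' j) Phi').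
  have dz := d_zero i i'.
  apply: t_ex; apply: t_and.
    apply: (t_eapp1 (s := fun l v => cut k (fun l => v (m + l).+1) l)
      (s' := fun l v => cut k (fun l => v (m + l).+1) l) (t := fun v => v 0) (t' := fun v => v 0) _ _ dcell); last by dfb.
    by move=> l; rewrite /cut; case: (l < k); dfb.
  apply: (t_sub (s := fun l v => if l < m + k then v l.+1 else v 0)
      (s' := fun l v => if l < m + k then v l.+1 else v 0) dPhi) => l.
  by case: (l < m + k); dfb.
have [||P [Q [hP [hQ dec]]]] := IH _ _ _ dPsi; first by lia.
  move=> v v' vv [s [hs Fs]]; exists s; split.
    suff <- : cut k (fun l => v (m + l)) = cut k (fun l => v' (m + l)) by [].
    by apply: funext => l; rewrite /cut; case: ltnP => // lk; apply: vv; lia.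
  by apply: low Fs => l lk; case: ltnP => // lmk; apply: vv.
(* What [avoid_jumps] establishes for [c], as a predicate. Since [c] realizes [q], it becomes a
   formula of [q] and can be used in M. *)
pose avoids (R : structure (og_expansion L)) (D J : (nat -> R) -> R -> Prop) (w : nat -> R) :=
  D (cut k w) (w k) /\ forall s, D (cut k w) s -> ~ J (cut k w) s.
have davoids : tdef i i' (avoids M (cell k sigma i Phi j) (jumps k sigma i Phi))
    (avoids N (cell k sigma i' Phi' j) (jumps k sigma i' Phi')).
  have dz := d_zero i i'.
  have dcut l : tfun i i' (fun v => cut k v l) (fun v => cut k v l).
    by rewrite /cut; case: (l < k); dfb.
  have dcut' l : tfun i i' (fun v => cut k (fun l => v l.+1) l) (fun v => cut k (fun l => v l.+1) l).
    by rewrite /cut; case: (l < k); dfb.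
  apply: t_and.
    by apply: (t_eapp1 dcut _ dcell); dfb.
  apply: t_all; apply: t_imp.
    by apply: (t_eapp1 dcut' _ dcell (t := fun v => v 0) (t' := fun v => v 0)); dfb.
  apply: t_not.
  by apply: (t_eapp1 dcut' _ djumps (t := fun v => v 0) (t' := fun v => v 0)); dfb.
have hbox : holds_in p (in_box sigma i).
  apply: (holds_in_forall hp) => l lm; rewrite (insubT (fun l => l < m) lm).
    by exists (fsub (fun=> TV _ C l) (@TP _ C) (sigma (Ordinal lm))); split=> v; rewrite fsat_sub.
  exact: (p_sigma (Ordinal lm)).
have [P' dP] := holds_in_tdef hP; have [Q' dQ] := holds_in_tdef hQ.
exists (fun v => P v /\ in_box sigma i v),
  (fun w => Q w /\ avoids M (cell k sigma i Phi j) (jumps k sigma i Phi) w).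
split; first by apply: (holds_in_and hp) => //; [exact: tdefl dP|exact: d_in_box].
split.
  apply: (holds_in_and hq) => //; [exact: tdefl dQ|exact: tdefl davoids|].
  by apply: (realized_holds_in hq ee rc davoids).
(* For [v] in the box a boundary point of its section would be a jump. The cell contains none, so by
   connectedness the section is constant on it, and some point of the cell satisfies [Phi] exactly
   when [w k] does. *)
have key v w : in_box sigma i v -> avoids M (cell k sigma i Phi j) (jumps k sigma i Phi) w ->
    Psi M (cell k sigma i Phi j) Phi (ncat m v w) <-> Phi (ncat m v w).
  move=> bv [cw aw]; set y := cut k w in cw aw.
  have yE : cut k (fun l => ncat m v w (m + l)) = y.
    apply: funext => l; rewrite /y /cut /ncat (_ : (m + l < m) = false); last by lia.
    by rewrite (_ : m + l - m = l) //; lia.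
  pose S s := slice m k Phi (ncat m v (scons s y)) s.
  have SE s t : slice m k Phi (ncat m v (scons s y)) t <-> S t.
    by rewrite /S (slice_ncat _ _ _ _ s t).
  have FE s : Phi (fun l => if l < m + k then ncat m v w l else s) <-> S s.
    rewrite /S /slice (_ : (fun l => if l < m then _ else _) =
      (fun l => if l < m + k then ncat m v w l else s)) //.
    apply: funext => l; rewrite /ncat; case: (ltnP l m) => lm.
      by rewrite ifT //; lia.
    case: ltnP => // lmk; rewrite (_ : (l.+1 < m) = false); last by lia.
    rewrite (_ : l.+1 - m = (l - m).+1) /=; last by lia.
    by rewrite /y /cut ifT //; lia.
  have TE : Phi (ncat m v w) <-> S (w k).
    rewrite -FE; have E l : l < m + k.+1 -> ncat m v w l = if l < m + k then ncat m v w l else w k.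
      move=> lk; case: ltnP => // lmk; rewrite /ncat ifF; last by lia.
      by congr w; lia.
    by split; apply: low => l lk; rewrite -?E // {1}E.
  have dS : D1 (@id M) (@id M) (slice m k Phi (ncat m v (scons (w k) y))) (slice m k Phi (ncat m v (scons (w k) y))).
    have dsec := tdef_right (k := @id M) (g := i) (fun a => erefl) (d_slice m k (tdefl dPhi)).
    apply: (t_sub (s := fun l u => scons (u 0) (ncat m v (scons (w k) y)) l)
      (s' := fun l u => scons (u 0) (ncat m v (scons (w k) y)) l) dsec).
    by case=> [|l] /=; dfb.
  have nbd t : cell k sigma i Phi j y t -> ~ bd (@og_lt L M) (slice m k Phi (ncat m v (scons (w k) y))) t.
    move=> /aw njt bt; apply: njt; exists v; split; first by apply/in_box_ncat.
    by rewrite {2}/ncat ltnn subnn /= (slice_ncat _ _ _ _ t (w k)).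
  have same s : cell k sigma i Phi j y s -> S s <-> S (w k).
    move=> cs; rewrite -!(SE (w k)).
    case: (pselect (og_lt (w k) s)) => h.
      apply: iff_sym; apply: (connect O dS); first by lord.
      by move=> t h1 h2; apply: nbd; apply: (cell_convex Ol cw cs).
    apply: (connect O dS) => //.
    by move=> t h1 h2; apply: nbd; apply: (cell_convex Ol cs cw).
  rewrite TE /Psi yE; split=> [[s [cs /FE Ss]]|Sw]; first by apply/(same s cs).
  by exists (w k); split=> //; apply/FE.
case: dec => dec; [left|right] => v w [Pv bv] [Qw aw]; first by apply/key => //; apply: dec.
by move=> /key h; apply: (dec v w) => //; apply: h.
Qed.
End Orthogonality.

Lemma tcat_ncat (R : Type) (m n : nat) (v : 'I_m -> R) (w : 'I_n -> R) (v' w' : nat -> R) :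
  (forall j : 'I_m, v' j = v j) -> (forall j : 'I_n, w' j = w j) ->
  (fun j : 'I_(m + n) => ncat m v' w' j) = tcat v w.
Proof.
move=> hv hw; apply: funext => j; rewrite /tcat /ncat.
by case: splitP => k -> //; rewrite (_ : m + k - m = k) //; lia.
Qed.

Theorem corollary4p22 (L : signature) (one : csym L)
    (M : structure (og_expansion L))
    (hgroup : ordered_group M)
    (homin : o_minimal M)
    (hsemi : semi_bounded M)
    (hnonlin : ~ linear_structure M)
    (hone : og_lt (og_zero M) (og_one one M))
    (hrcf : unit_itv_expands_rcf one M)
    (A : set M) (m n : nat)
    (p : set (param_formula A m)) (q : set (param_formula A n))
    (hp : complete_type p) (hq : complete_type q) :
  short_type one p -> scl_independent_type one q -> weakly_orthogonal p q.
Proof.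
move=> hshort [N [e [c [ee rc [s [sn indep _]]]]]].
have T := rcf_tame_group hgroup hone hrcf.
have TM : tame one M by split=> //; apply: o_minimal_omin T homin.
have [sigma [p_sigma emb]] := short_type_formulas hgroup hp hshort.
(* A basis with [n] elements consists of all coordinates, so each one is independent of all the
   others. *)
have sT j : j \in s.
  have /eqP -> : s == [set: 'I_n]%SET by rewrite eqEcard finset.subsetT finset.cardsT card_ord sn leqnn.
  by rewrite finset.in_setT.
have indep' j : ~ scl one (e @` A `|` [set c l | l in [set l | l <> j]]) (c j).
  have := indep j (sT j); congr (~ scl one (_ `|` _) _).
  congr image; apply/seteqP; split=> l /=; first by case.
  by move=> ?; split=> //; apply: sT.
pose z0 : csym (og_expansion L) := inl tt.
pose i := @sval M A.
(* The formulas implied in M by one formula of [p] and one of [q]. Such a set is finitely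
   satisfiable because [p] and [q] are, with their variables separate; completeness is what [decide]
   provides. *)
pose r : set (param_formula A (m + n)) := [set phi | exists P Q,
  holds_in p P /\ holds_in q Q /\ forall v w, P v -> Q w ->
    @sat _ (add_consts i) _ phi (fun j => ncat m v w j)].
exists r.
- split=> [k phi rphi|phi].
    have /choice[P /choice[Q hPQ]] := rphi.
    have [|v hv] := holds_in_sat hp (P := P); first by move=> j; have [] := hPQ j.
    have [|w hw] := holds_in_sat hq (P := Q); first by move=> j; have [_ []] := hPQ j.
    exists (fun j => ncat m (ext z0 v) (ext z0 w) j) => j.
    by have [_ [_ h]] := hPQ j; apply: h.
  have [||P [Q [hP [hQ dec]]]] := @decide _ one M A TM m n p q hp hq sigma p_sigma emb
    N e c ee rc indep' n (leqnn n) (fsat i (of_formula phi)) (fsat (fun a => e (i a)) (of_formula phi)).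
  + by exists (of_formula phi).
  + move=> v v' vv; rewrite !fsat_of_formula.
    by rewrite (_ : (fun j : 'I_(m + n) => v j) = (fun j : 'I_(m + n) => v' j)) //;
      apply: funext => j; apply: vv.
  case: dec => dec; [left|right]; exists P, Q; split=> //; split=> // v w Pv Qw.
    by rewrite -fsat_of_formula; apply: dec.
  by move=> h; apply: (dec v w) => //; rewrite fsat_of_formula.
- move=> N' e' ee' b d rb rd phi [P [Q [[phiP [pP hP]] [[phiQ [qQ hQ]] h]]]].
  pose i' := fun a => e' (i a).
  (* The implication from [P] and [Q] to [phi] is transferred to [N'] as one universal statement
     about a joint tuple. Its two blocks are padded with zero, since [ext z0] pads with the constant
     [z0], which is zero. *)
  pose left_ (R : structure (og_expansion L)) (u : nat -> R) l := if l < m then u l else og_zero R.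
  pose right_ (R : structure (og_expansion L)) (u : nat -> R) l := if l < n then u (m + l) else og_zero R.
  have tr := tdef_forall z0 ee' (i := i) (i' := i') (fun a => erefl)
    (P := fun u => fsat i phiP (left_ M u) -> fsat i phiQ (right_ M u) -> fsat i (of_formula phi) u)
    (Q := fun u => fsat i' phiP (left_ N' u) -> fsat i' phiQ (right_ N' u) -> fsat i' (of_formula phi) u).
  have dz := d_zero i i'.
  have {}tr := tr _ _ (ncat m (ext z0 b) (ext z0 d)).
  have key : fsat i' (of_formula phi) (ncat m (ext z0 b) (ext z0 d)).
    apply: tr.
    + apply: t_imp; last apply: t_imp; last by exists (of_formula phi).
        apply: (t_sub (s := fun l u => left_ M u l) (s' := fun l u => left_ N' u l)).
          by exists phiP.
        by move=> l; rewrite /left_; case: (l < m); dfb.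
      apply: (t_sub (s := fun l u => right_ M u l) (s' := fun l u => right_ N' u l)).
        by exists phiQ.
      by move=> l; rewrite /right_; case: (l < n); dfb.
    + move=> u /hP Pu /hQ Qu; rewrite fsat_of_formula.
      have := h _ _ Pu Qu; congr sat; apply: funext => j; rewrite /ncat /left_ /right_.
      case: ltnP => // mj; rewrite ifT; last by have := ltn_ord j; lia.
      by congr u; lia.
    + have := rb _ pP; rewrite sat_to_formula; congr fsat; apply: funext => l.
      rewrite /left_ /ncat /ext; case: ltnP => // ml; rewrite insubF //.
      by apply/negbTE; rewrite -leqNgt.
    + have := rd _ qQ; rewrite sat_to_formula; congr fsat; apply: funext => l.
      rewrite /right_ /ncat /ext; case: (ltnP l n) => nl.
        by rewrite ltnNge leq_addr /= (_ : m + l - m = l) //; lia.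
      by rewrite insubF //; apply/negbTE; rewrite -leqNgt.
  move: key; rewrite fsat_of_formula; by rewrite (tcat_ncat (ext_ord z0 b) (ext_ord z0 d)).
Qed.
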